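(* Let $d\ge2$ and let $\Gamma\subset\mathbb Z^d$ be a lattice of full rank which is not even. Then there exists $\varepsilon=\varepsilon(\Gamma)>0$ such that, for any $\Gamma$-periodic potential $V\colon\mathbb Z^d\to\mathbb R$ with $\|V\|_\infty<\varepsilon$, the spectrum of the operator $H=\Delta+V$ on $\ell^2(\mathbb Z^d)$ is an interval.
   Context: A lattice of full rank $\Gamma\subset\mathbb Z^d$ is $\Gamma=\{n_1a_1+\dots+n_da_d\colon n_j\in\mathbb Z\}$ with $a_1,\dots,a_d\in\mathbb Z^d$ linearly independent over $\mathbb R$. Its dual lattice is $\Gamma'=\{b\in\mathbb R^d\colon e^{2\pi i\langle b,a\rangle}=1\ \forall a\in\Gamma\}$. The lattice $\Gamma$ is called even if $(1/2,\dots,1/2)\in\Gamma'$; equivalently, if $n_1+\dots+n_d\in2\mathbb Z$ for every $n=(n_1,\dots,n_d)\in\Gamma$. $V$ is $\Gamma$-periodic if $V(n+a)=V(n)$ for all $n\in\mathbb Z^d$, $a\in\Gamma$. The operator $H$ on $\ell^2(\mathbb Z^d)$ is defined by $(H\psi)(n)=(\Delta\psi)(n)+V(n)\psi(n)$, $(\Delta\psi)(n)=\sum_{m\in\mathbb Z^d\colon|m-n|_1=1}\psi(m)$, where $|n|_1=|n_1|+\dots+|n_d|$. *)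

(* Defs.v *)
From HB Require Import structures.
From mathcomp Require Import all_boot all_order all_algebra.
From mathcomp Require Import all_classical all_reals all_analysis.
From mathcomp Require Import complex.
Set Implicit Arguments.
Unset Strict Implicit.
Unset Printing Implicit Defensive.
Import Order.TTheory GRing.Theory Num.Theory.
Import numFieldNormedType.Exports.
Local Open Scope classical_set_scope.
Local Open Scope complex_scope.
Local Open Scope ring_scope.

Section Lattices.
Variables (R : realType) (d : nat).
Implicit Types (G : set 'rV[int]_d) (a : 'rV[int]_d) (b : 'rV[R]_d).

Definition to_real a : 'rV[R]_d := map_mx intr a.

Definition full_rank_lattice G : Prop :=
  exists a : 'I_d -> 'rV[int]_d,
    free [seq to_real (a j) | j <- enum 'I_d] /\
    G = [set v | exists n : 'I_d -> int, v = \sum_j a j *~ n j].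

Definition inner b (b' : 'rV[R]_d) : R := \sum_i b 0 i * b' 0 i.

(* e^{i x} *)
Definition expi (x : R) : R[i] := cos x +i* sin x.

Definition dual_lattice G : set 'rV[R]_d :=
  [set b | forall a, G a -> expi (2 * pi * inner b (to_real a)) = 1].

Definition even_lattice G : Prop := dual_lattice G (const_mx (1 / 2)).

Definition lattice_periodic G (V : 'rV[int]_d -> R) : Prop :=
  forall a, G a -> periodic V a.

Definition sup_norm (V : 'rV[int]_d -> R) : \bar R :=
  ereal_sup [set `|V n|%:E | n in [set: 'rV[int]_d]].

End Lattices.

Section Operators.
Variables (R : realType) (d : nat).

(* Vectors of l^2(Z^d) are the functions psi satisfying [l2 psi]; operators on
   l^2(Z^d) are represented by maps on all functions, of which only the
   restriction to l^2(Z^d) matters. *)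
Local Notation Fun := ('rV[int]_d -> R[i]).
Implicit Types (psi phi : Fun) (A B : Fun -> Fun).

Definition l2 psi : Prop :=
  summable [set: 'rV[int]_d] (fun n => (Normc.normc (psi n) ^+ 2)%:E).

(* Meaningful only when [l2 psi]: [fine] sends +oo to 0. *)
Definition l2norm psi : R :=
  Num.sqrt (fine (\esum_(n in [set: 'rV[int]_d])
                    (Normc.normc (psi n) ^+ 2)%:E)).

Definition bounded_operator A : Prop :=
  [/\ forall psi, l2 psi -> l2 (A psi),
      forall (c : R[i]) psi phi, l2 psi -> l2 phi ->
        A (fun n => c * psi n + phi n) = (fun n => c * A psi n + A phi n)
    & exists C : R, forall psi, l2 psi -> l2norm (A psi) <= C * l2norm psi].

Definition resolvent_set A : set R[i] :=
  [set z | exists B, bounded_operator B /\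
     forall psi, l2 psi ->
       (fun n => A (B psi) n - z * B psi n) = psi /\
       B (fun n => A psi n - z * psi n) = psi].

Definition spectrum A : set R[i] := ~` resolvent_set A.

Definition norm1 (n : 'rV[int]_d) : int := \sum_i `|n 0 i|.

(* The index set is finite, so the finitely supported sum is the full sum. *)
Definition laplacian psi : Fun :=
  fun n => \sum_(m \in [set m : 'rV[int]_d | norm1 (m - n) = 1]) psi m.

Definition schrodinger (V : 'rV[int]_d -> R) psi : Fun :=
  fun n => laplacian psi n + (V n)%:C * psi n.

End Operators.

(* An interval of the real line, nonempty by convention, seen inside C. *)
Definition complex_interval (R : realType) (S : set R[i]) : Prop :=
  exists J : set R, [/\ is_interval J, J !=set0 & S = [set x%:C | x in J]].

(* Main.v *)
Require Import Defs.
From mathcomp Require Import all_boot all_order all_algebra.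
From mathcomp Require Import all_classical all_reals all_analysis.
From mathcomp Require Import complex.
From mathcomp Require Import finmap ring lra zify.
Import Order.TTheory GRing.Theory Num.Theory.
Import numFieldNormedType.Exports.
Local Open Scope ring_scope.
Set Implicit Arguments.
Unset Strict Implicit.
Unset Printing Implicit Defensive.

(** Write [H = Delta + V]. A [G]-periodic function is a combination of the plane
    waves of the finite set [A] of dual vectors modulo [Z^d], so on Bloch functions
    of quasi-momentum [x] the operator [H] is a Hermitian matrix: the diagonal of
    the branches [h (x + g)], [g] in [A], where [h x = 2 * \sum_i cos (x i)], plus
    a matrix that does not depend on [x] and has norm at most [sup |V|]. Let [c]
    be real. If the numbers of negative eigenvalues of this matrix minus [c] at
    two quasi-momenta differ, the matrix is singular somewhere on the
    segment between them ([definite_rank_change_singular], [band_crossing]), and a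
    bounded solution of [H psi = c psi] puts [c] in the spectrum
    ([bounded_eigenfunction_spectrum]).

    So it is enough that every [c] strictly between [- 2 d] and [2 d] is interior
    to an unperturbed band: more branches are above [c] at one quasi-momentum than
    at another. This follows from looking at a point where some branches cross
    the level [c]: if, in some direction, the numbers of rising and of falling ones
    differ, stepping to either side of the point changes the number of branches
    above ([local_overlap]). On a curve in the level set of [h], generically the
    branch [g = 0] is alone at the level, as the coincidence of two branches along
    the curve would force all angles of [g] to be 0 or all to be [pi], and the
    latter makes the lattice even ([overlap_level_generic]). The only exception is
    [d = 2], [c = 0], where the level set of [h] is a union of lines; there one
    compares the two sides of a saddle point ([overlap_level_plane]). By
    compactness a small perturbation is harmless for all [c] at some distance from
    [- 2 d] and [2 d] ([overlap_uniform]).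

    Near the edges one uses that the spectrum is an honest spectrum. It is real,
    and if [b] belongs to it and [c < b], then the form of [H - c] is positive on
    some finitely supported function ([spectrum_above]): otherwise [b] would have
    a bounded resolvent, built from a Neumann series. Averaging over quasi-momenta
    ([floquet_average]) gives a Floquet matrix with an eigenvalue above [c]. At a
    quasi-momentum where no branch reaches [2 d] all eigenvalues are below [c], so
    [c] is in the spectrum as well ([spectrum_upper_edge]); the lower edge is
    symmetric. Together, all points between two points of the spectrum belong to
    it.

    All estimates in the space of square summable functions are made on finite
    sums: [H] only couples neighbouring points, so bounds on finitely supported
    functions extend to all. *)

(** * Definite subspaces of Hermitian forms *)

Section HermitianForms.
Variable R : realType.
Local Notation C := R[i].
Local Open Scope complex_scope.
Local Open Scope sesquilinear_scope.

Definition mxform n (Q : 'M[C]_n) (v : 'rV[C]_n) : C := (v *m Q *m v ^t*) 0 0.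

Definition sqnorm n (v : 'rV[C]_n) : C := \sum_i `|v 0 i| ^+ 2.

Definition has_positive_subspace n (Q : 'M[C]_n) (r : nat) : Prop :=
  exists B : 'M[C]_n, (r <= \rank B)%N /\
    forall v : 'rV_n, v != 0 -> (v <= B)%MS -> 0 < mxform Q v.

Lemma mxformN n (Q : 'M[C]_n) v : mxform (- Q) v = - mxform Q v.
Proof. by rewrite /mxform mulmxN mulNmx mxE. Qed.

Lemma mxformD n (Q Q' : 'M[C]_n) v : mxform (Q + Q') v = mxform Q v + mxform Q' v.
Proof. by rewrite /mxform mulmxDr mulmxDl mxE. Qed.

Lemma mxformZ n (Q : 'M[C]_n) (a : C) v :
  mxform Q (a *: v) = `|a| ^+ 2 * mxform Q v.
Proof.
rewrite /mxform linearZ/= map_mxZ -scalemxAr -!scalemxAl scalerA mxE.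
by rewrite normCKC.
Qed.

Lemma mxform_diag n (d : 'rV[C]_n) v :
  mxform (diag_mx d) v = \sum_i d 0 i * `|v 0 i| ^+ 2.
Proof.
rewrite /mxform mul_mx_diag mxE; apply: eq_bigr => i _.
by rewrite !mxE normCK mulrAC mulrC.
Qed.

Lemma sqnormE n (v : 'rV[C]_n) : sqnorm v = (v *m v ^t*) 0 0.
Proof. by rewrite mxE; apply: eq_bigr => i _; rewrite !mxE normCK. Qed.

Lemma sqnorm_ge0 n (v : 'rV[C]_n) : 0 <= sqnorm v.
Proof. by apply: sumr_ge0 => i _; rewrite exprn_ge0. Qed.

Lemma sqnorm_eq0 n (v : 'rV[C]_n) : (sqnorm v == 0) = (v == 0).
Proof.
apply/idP/eqP => [|->]; last first.
  by rewrite /sqnorm big1// => i _; rewrite mxE normr0 expr0n.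
rewrite psumr_eq0; last by move=> i _; rewrite exprn_ge0.
move=> /allP h; apply/rowP => i; rewrite mxE; apply/eqP.
by have := h i (mem_index_enum i); rewrite /= expf_eq0/= normr_eq0.
Qed.

Lemma sqnorm_gt0 n (v : 'rV[C]_n) : (0 < sqnorm v) = (v != 0).
Proof. by rewrite lt_neqAle sqnorm_ge0 andbT eq_sym sqnorm_eq0. Qed.

Lemma sqnorm_unitary n (P : 'M[C]_n) (w : 'rV_n) :
  P \is unitarymx -> sqnorm (w *m P) = sqnorm w.
Proof.
move=> /unitarymxP hP; rewrite !sqnormE trmx_mul map_mxM/= mulmxA.
by rewrite -(mulmxA w) hP mulmx1.
Qed.

(** A nonzero common vector would make the form both positive and negative. *)
Lemma definite_subspaces_rank n (Q : 'M[C]_n) r1 r2 :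
  has_positive_subspace Q r1 -> has_positive_subspace (- Q) r2 -> (r1 + r2 <= n)%N.
Proof.
move=> [B1 [r1B pos]] [B2 [r2B neg]].
apply: leq_trans (leq_add r1B r2B) _; rewrite -mxrank_sum_cap.
have [cap0|/rowV0Pn[v vcap v0]] := eqVneq (B1 :&: B2)%MS 0.
  by rewrite cap0 mxrank0 addn0 rank_leq_col.
have := neg v v0 (submx_trans vcap (capmxSr _ _)).
have := pos v v0 (submx_trans vcap (capmxSl _ _)).
by rewrite mxformN oppr_gt0 => /lt_trans h /h; rewrite ltxx.
Qed.

Lemma has_positive_subspaceW n (Q : 'M[C]_n) r1 r2 :
  (r1 <= r2)%N -> has_positive_subspace Q r2 -> has_positive_subspace Q r1.
Proof. by move=> r12 [B [rB pB]]; exists B; split=> //; apply: leq_trans rB. Qed.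

Lemma positive_vector n (Q : 'M[C]_n) (v : 'rV_n) :
  0 < mxform Q v -> has_positive_subspace Q 1.
Proof.
move=> Qv; have v0 : v != 0.
  by apply: contraTneq Qv => ->; rewrite /mxform !mul0mx mxE ltxx.
exists (<<v>>)%MS; split; first by rewrite genmxE rank_rV v0.
move=> w w0; rewrite genmxE => /sub_rVP[a wE]; move: w0; rewrite {}wE.
rewrite scaler_eq0 negb_or => /andP[a0 _]; rewrite mxformZ.
by apply: mulr_gt0 => //; apply: exprn_gt0; rewrite normr_gt0.
Qed.

(** Diagonalisation turns sign conditions on eigenvalues into support conditions
    on the coordinates in an orthonormal basis of eigenvectors. *)
Lemma rows_span n (P : 'M[C]_n) (I : {set 'I_n}) : P \is unitarymx ->
  exists B : 'M[C]_n, \rank B = #|I| /\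
    forall v : 'rV_n, (v <= B)%MS ->
      exists2 w : 'rV_n, v = w *m P & forall i, i \notin I -> w 0 i = 0.
Proof.
move=> uP; have PU := unitarymx_unit uP.
pose f (k : 'I_#|I|) : 'I_n := enum_val k.
exists (<<rowsub f P>>)%MS; split.
  rewrite genmxE -[P]mul1mx -mul_rowsub_mx mxrankMfree ?row_free_unit//.
  apply/eqP; apply/row_freeP; exists (rowsub f 1%:M)^T.
  apply/matrixP => i j; rewrite !mxE (bigD1 (f i))//= !mxE eqxx mul1r.
  rewrite big1 ?addr0 => [|k kfi]; last by rewrite !mxE eq_sym (negbTE kfi) mul0r.
  by rewrite eq_sym (inj_eq enum_val_inj).
move=> v; rewrite genmxE => /submxP[x ->].
exists (x *m rowsub f 1%:M); first by rewrite -mulmxA mul_rowsub_mx mul1mx.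
move=> i iI; rewrite !mxE big1// => k _; rewrite !mxE.
case: eqP => [fki|]; last by rewrite mulr0.
by move: iI; rewrite -fki enum_valP.
Qed.

Lemma finite_pos_lower_bound (I : finType) (a : I -> R) :
  (forall i, 0 < a i) -> exists2 e, 0 < e & forall i, e <= a i.
Proof.
move=> a0; have inv_ge0 i : 0 <= (a i)^-1 by rewrite invr_ge0 ltW.
have s0 : 0 < 1 + \sum_i (a i)^-1 by rewrite ltr_pwDl ?sumr_ge0.
exists (1 + \sum_i (a i)^-1)^-1; first by rewrite invr_gt0.
move=> i; rewrite -[leRHS]invrK lef_pV2 ?posrE ?invr_gt0//.
rewrite (bigD1 i)//= addrCA lerDl addr_ge0// sumr_ge0//.
Qed.

(** The spectral decomposition splits the space according to the signs of the
    eigenvalues, none of which vanishes; [e] is a lower bound of their moduli, and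
    measures how large a perturbation both definite subspaces survive. *)
Lemma nondegenerate_splitting n (Q : 'M[C]_n) :
  Q \is hermsymmx -> Q \in unitmx ->
  exists r1 r2 (B1 B2 : 'M[C]_n) (e : R),
    [/\ (r1 + r2 = n)%N, 0 < e,
     (\rank B1 = r1) /\
       (forall v : 'rV_n, (v <= B1)%MS -> e%:C * sqnorm v <= mxform Q v) &
     (\rank B2 = r2) /\
       (forall v : 'rV_n, (v <= B2)%MS -> mxform Q v <= - (e%:C * sqnorm v))].
Proof.
move=> hQ uQ.
have /orthomx_spectralP := hermitian_normalmx hQ.
have uP := spectral_unitarymx Q; rewrite (invmx_unitary uP).
have /mxOverP spR := hermitian_spectral_diag_real hQ.
move: uP spR; set P := spectralmx Q; set sp := spectral_diag Q => uP spR QE.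
pose a i : R := complex.Re (sp 0 i).
have aE i : sp 0 i = (a i)%:C by rewrite RRe_real// spR.
have anz i : 0 < `|a i|.
  rewrite normr_gt0; apply: contraTneq uQ => ai0.
  rewrite QE !unitmx_mul [X in _ && X && _]unitmxE det_diag.
  by rewrite (bigD1 i)//= aE ai0 mul0r unitr0 andbF.
have [e e0 ea] := finite_pos_lower_bound anz.
have form w : mxform Q (w *m P) = \sum_i (a i)%:C * `|w 0 i| ^+ 2.
  rewrite QE /mxform trmx_mul map_mxM/= !mulmxA -(mulmxA w).
  rewrite (unitarymxP uP) mulmx1 -!mulmxA [P *m _]mulmxA (unitarymxP uP) mul1mx.
  rewrite mulmxA -/(mxform _ _) mxform_diag.
  by apply: eq_bigr => i _; congr (_ * _); exact: aE.
have nrm w : sqnorm (w *m P) = sqnorm w by exact: sqnorm_unitary.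
have [B1 [rB1 B1P]] := rows_span [set i | 0 < a i] uP.
have [B2 [rB2 B2P]] := rows_span (~: [set i | 0 < a i]) uP.
exists #|[set i | 0 < a i]|, #|~: [set i | 0 < a i]|, B1, B2, e.
split=> //; first by rewrite cardsC card_ord.
- split=> // v /B1P[w -> wI]; rewrite nrm form mulr_sumr; apply: ler_sum => i _.
  have [ai|/wI->] := boolP (i \in [set i | 0 < a i]); last first.
    by rewrite normr0 expr0n !mulr0.
  rewrite ler_wpM2r ?exprn_ge0// lecR; move: ai; rewrite inE => ai.
  by have := ea i; rewrite gtr0_norm.
- split=> // v /B2P[w -> wI]; rewrite nrm form mulr_sumr -sumrN.
  apply: ler_sum => i _.
  have [ai|/wI->] := boolP (i \in ~: [set i | 0 < a i]); last first.
    by rewrite normr0 expr0n !mulr0 oppr0.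
  rewrite -mulNr ler_wpM2r ?exprn_ge0// -rmorphN lecR.
  move: ai; rewrite !inE -leNgt => ai.
  by have := ea i; rewrite ler0_norm// lerNr.
Qed.

(** If every [Q s] is invertible, the space splits into a positive and a negative
    subspace of [Q s], and both stay definite for [Q s'] with [s'] near [s]. As
    their ranks add up to [n], no larger negative subspace can appear, so the
    largest rank of a negative subspace is locally constant in [s]. It is
    therefore at least [r2] at [s = 0], where no room is left for it beside the
    positive subspace of rank [r1]. *)
Lemma definite_rank_change_singular n (Q : R -> 'M[C]_n) r1 r2 :
  (forall s, Q s \is hermsymmx) ->
  (forall s (e : R), 0 < e -> \forall s' \near s, forall v,
     mxform (Q s) v - e%:C * sqnorm v <= mxform (Q s') v
       <= mxform (Q s) v + e%:C * sqnorm v) ->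
  has_positive_subspace (Q 0) r1 -> has_positive_subspace (- Q 1) r2 ->
  (n < r1 + r2)%N ->
  exists s, exists2 v : 'rV[C]_n, v != 0 & v *m Q s = 0.
Proof.
move=> hQ cQ pos0 neg1 nr; apply: contrapT => nsing.
have uQ s : Q s \in unitmx.
  rewrite -row_free_unit -kermx_eq0; apply/rowV0P => v /sub_kermxP vQ.
  by apply: contrapT => /eqP v0; apply: nsing; exists s, v.
pose X s := `[< has_positive_subspace (- Q s) r2 >].
have locconst s : \forall s' \near s, X s' = X s.
  have [m1 [m2 [B1 [B2 [e [m12 e0 [rB1 pB1] [rB2 nB2]]]]]]] :=
    nondegenerate_splitting (hQ s) (uQ s).
  have small s' : (forall v, mxform (Q s) v - (e / 2)%:C * sqnorm v <= mxform (Q s') v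
       <= mxform (Q s) v + (e / 2)%:C * sqnorm v) -> X s' = (r2 <= m2)%N.
    move=> cs.
    have hp : has_positive_subspace (Q s') m1.
      exists B1; rewrite rB1; split=> // v v0 /pB1 pv.
      have /andP[+ _] := cs v.
      have : 0 < (e / 2)%:C * sqnorm v by rewrite mulr_gt0 ?sqnorm_gt0// ltcR divr_gt0.
      have : e%:C = (e/2)%:C + (e/2)%:C :> C by rewrite -rmorphD/= -splitr.
      move=> eE; move: pv; rewrite eE mulrDl => pv p1 p2.
      apply: lt_le_trans p2; rewrite subr_gt0; apply: lt_le_trans pv.
      by rewrite ltrDl.
    have hn : has_positive_subspace (- Q s') m2.
      exists B2; rewrite rB2; split=> // v v0 /nB2 pv.
      have /andP[_ +] := cs v.
      have : 0 < (e / 2)%:C * sqnorm v by rewrite mulr_gt0 ?sqnorm_gt0// ltcR divr_gt0.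
      have : e%:C = (e/2)%:C + (e/2)%:C :> C by rewrite -rmorphD/= -splitr.
      move=> eE; move: pv; rewrite eE mulrDl => pv p1 p2.
      rewrite mxformN oppr_gt0; apply: le_lt_trans p2 _.
      rewrite -ltrBrDr sub0r; apply: le_lt_trans pv _.
      by rewrite ltrN2 ltrDl.
    apply/asboolP/idP => [hr2|r2m2]; last exact: has_positive_subspaceW hn.
    by have := definite_subspaces_rank hp hr2; rewrite -m12 leq_add2l.
  have cs := cQ s _ (divr_gt0 e0 (ltr0Sn _ 1)).
  have Xs : X s = (r2 <= m2)%N by apply: small; exact: (nbhs_singleton cs).
  by near=> s'; rewrite Xs small//; near: s'.
(* A locally constant truth value is a continuous real function with values 0
   and 1, which cannot jump by the intermediate value theorem. *)
pose f s : R := (X s)%:R.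
have cf : continuous f.
  move=> s; rewrite /f; apply: cvg_near_cst; by apply: filterS (locconst s) => s' ->.
have X0 : X 0 = false.
  apply/asboolP => n0; have := definite_subspaces_rank pos0 n0.
  by rewrite leqNgt nr.
have X1 : X 1 = true by apply/asboolP.
have [||c _] := @IVT R f 0 1 (1 / 2) ler01.
- exact: continuous_subspaceT.
- by rewrite /f X0 X1 mulr0n mulr1n minEle maxEle ler01; apply/andP; split; lra.
- by rewrite /f; case: (X c) => /=; lra.
Unshelve. all: by end_near.
Qed.

End HermitianForms.

(** * Plane waves and finite Fourier analysis *)

Section PlaneWaves.
Variables (R : realType) (d : nat).
Local Notation C := R[i].
Local Notation cj := (@Num.conj C).
Local Notation Z := 'rV[int]_d.
Local Open Scope complex_scope.
Implicit Types (x y : 'I_d -> R) (n a : Z).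

Lemma expiD (s t : R) : expi (s + t) = expi s * expi t.
Proof. by rewrite /expi cosD sinD; simpc; rewrite addrC [X in _ +i* X]addrC; congr (_ +i* _); ring. Qed.

Lemma expi0 : expi (0 : R) = 1.
Proof. by rewrite /expi cos0 sin0. Qed.

Lemma expiN (t : R) : expi (- t) = cj (expi t).
Proof. by rewrite /expi cosN sinN. Qed.

Lemma expi_mulJ (t : R) : expi t * cj (expi t) = 1.
Proof. by rewrite -expiN -expiD subrr expi0. Qed.

Lemma norm_expi (t : R) : `|expi t| = 1.
Proof.
by apply/eqP; rewrite -(@eqrXn2 _ 2)// normCK expi_mulJ expr1n.
Qed.

Lemma expiMn (t : R) k : expi (t *+ k) = expi t ^+ k.
Proof. by elim: k => [|k IH]; rewrite ?expi0// mulrS expiD IH exprS. Qed.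

Lemma expi2pi_int (k : int) : expi (2 * pi * k%:~R : R) = 1.
Proof.
have nat_case (j : nat) : expi (2 * pi * j%:R : R) = 1.
  by rewrite mulr_natr expiMn /expi mulr_natl cos2pi sin2pi expr1n.
case: k => j; first exact: nat_case.
by rewrite NegzE mulrNz mulrN expiN pmulrn nat_case rmorph1.
Qed.

Lemma expi_eq1_itv (t : R) : 0 < t < 2 * pi -> expi t != 1.
Proof.
move=> /andP[t0 tpi]; apply/eqP => -[cost _].
have : cos t = 1 - (sin (t / 2) ^+ 2) *+ 2.
  rewrite {1}(splitr t) cosD -!expr2 cos2sin2 mulr2n; ring.
have : 0 < sin (t / 2) by apply: sin_gt0_pi; apply/andP; split; lra.
rewrite cost => s0 /eqP; rewrite eq_sym subr_eq addrC -subr_eq subrr eq_sym.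
by rewrite mulrn_eq0 expf_eq0/= gt_eqF.
Qed.

Definition dot x n : R := \sum_i x i * (n 0 i)%:~R.

Lemma dotDr x n a : dot x (n + a) = dot x n + dot x a.
Proof. by rewrite -big_split/=; apply: eq_bigr => i _; rewrite mxE rmorphD/= mulrDr. Qed.

Lemma dotNr x n : dot x (- n) = - dot x n.
Proof. by rewrite -sumrN; apply: eq_bigr => i _; rewrite mxE rmorphN/= mulrN. Qed.

Lemma dotDl x y n : dot (fun i => x i + y i) n = dot x n + dot y n.
Proof. by rewrite -big_split/=; apply: eq_bigr => i _; rewrite mulrDl. Qed.

Definition plane_wave x n : C := expi (dot x n).

Lemma plane_waveD x n a : plane_wave x (n + a) = plane_wave x n * plane_wave x a.
Proof. by rewrite /plane_wave dotDr expiD. Qed.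

Lemma plane_waveN x n : plane_wave x (- n) = cj (plane_wave x n).
Proof. by rewrite /plane_wave dotNr expiN. Qed.

Lemma plane_waveDl x y n :
  plane_wave (fun i => x i + y i) n = plane_wave x n * plane_wave y n.
Proof. by rewrite /plane_wave dotDl expiD. Qed.

Lemma plane_wave0 x : plane_wave x 0 = 1.
Proof. by rewrite /plane_wave /dot big1 ?expi0// => i _; rewrite mxE mulr0. Qed.

Section Frequencies.
Variable m : nat.
Local Notation M := (m.+1).
Local Notation J := {ffun 'I_d -> 'I_m.+1}.
Implicit Types g q : J.

(** The frequencies of the discrete torus of side [m.+1], as angles. *)
Definition freq (g : J) (i : 'I_d) : R := 2 * pi * (g i)%:R / M%:R.

(** The same finite type indexes the frequencies and the points of the
    fundamental box, which makes their pairing symmetric. *)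
Definition box_point (q : J) : Z := \row_i (q i)%:Z.

Lemma dot_freq_sym (g q : J) : dot (freq g) (box_point q) = dot (freq q) (box_point g).
Proof. by apply: eq_bigr => i _; rewrite /freq !mxE !pmulrn; field. Qed.

Lemma geometric_sum_expi (k : int) :
  \sum_(j < M) expi (2 * pi * (j : nat)%:R / M%:R * k%:~R : R) =
    if (M %| k)%Z then M%:R else 0 :> C.
Proof.
have expiE (j : nat) : expi (2 * pi * j%:R / M%:R * k%:~R : R) =
    expi (2 * pi / M%:R * k%:~R) ^+ j.
  rewrite -expiMn; congr expi; rewrite -mulr_natr; ring.
under eq_bigr do rewrite expiE.
set z := expi _.
have M0 : M%:R != 0 :> R by rewrite pnatr_eq0.
case: ifP => Mk.
  have -> : z = 1.
    have /dvdzP[q kE] := Mk; rewrite /z kE -[RHS](expi2pi_int q); congr expi.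
    by rewrite rmorphM/=; move: M0; rewrite !pmulrn => M0; field.
  by under eq_bigr do rewrite expr1n; rewrite sumr_const card_ord.
have z1 : z != 1.
  pose r := (k %% M)%Z; have kE : k = (k %/ M)%Z * M + r := divz_eq k M.
  have rM : 0 <= r < M%:Z by rewrite modz_ge0// ltz_pmod.
  have r0 : r != 0 by apply: contraFneq Mk => r0; apply/dvdz_mod0P.
  have -> : z = expi (2 * pi * r%:~R / M%:R).
    rewrite -[RHS]mul1r -[X in X * _](expi2pi_int (k %/ M)%Z) -expiD /z; congr expi.
    by rewrite {1}kE rmorphD rmorphM/=; move: M0; rewrite !pmulrn => M0; field.
  apply: expi_eq1_itv; have M1 : 0 < M%:R :> R by rewrite ltr0n.
  have r1 : 0 < r%:~R :> R by rewrite ltr0z lt_neqAle eq_sym r0; case/andP: rM.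
  rewrite !divr_gt0 ?mulr_gt0 ?pi_gt0// ltr_pdivrMr// ltr_pM2l ?mulr_gt0 ?pi_gt0//.
  by rewrite pmulrn ltr_int; case/andP: rM.
have zM : z ^+ M = 1.
  rewrite -expiMn -mulr_natr -[RHS](expi2pi_int k); congr expi.
  by field.
have := subrX1 z M; rewrite zM subrr => /esym/eqP.
by rewrite mulf_eq0 subr_eq0 (negbTE z1) => /eqP.
Qed.

Lemma sum_plane_wave (n : Z) :
  \sum_(g : J) plane_wave (freq g) n =
    if [forall i, (M %| n 0%R i)%Z] then (M ^ d)%:R else 0.
Proof.
have expi_sum (f : 'I_d -> R) : expi (\sum_i f i) = \prod_i expi (f i).
  by apply: (big_morph _ expiD expi0).
under eq_bigr do rewrite /plane_wave expi_sum.
rewrite -(bigA_distr_bigA (fun i (j : 'I_M) =>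
  expi (2 * pi * (j : nat)%:R / M%:R * (n 0 i)%:~R))).
under eq_bigr do rewrite geometric_sum_expi.
case: ifP => [/forallP h|/forallP h].
  by under eq_bigr do rewrite h; rewrite prodr_const card_ord natrX.
have [i hi] : exists i, ~~ (M %| n 0%R i)%Z.
  by apply/existsP; rewrite -negb_forall; apply/negP => /forallP.
by apply/eqP/prodf_eq0; exists i => //; rewrite (negbTE hi).
Qed.

Lemma dvd_box_pointB (g q : J) :
  [forall i, (M %| (box_point g - box_point q)%R 0%R i)%Z] = (g == q).
Proof.
apply/forallP/eqP => [h|-> i]; last by rewrite subrr mxE dvdz0.
apply/ffunP => i; apply/val_inj => /=; have := h i; rewrite !mxE => hi.
have : (g i = q i %[mod M]) by apply/eqP; rewrite -eqz_nat -!modz_nat eqz_mod_dvd.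
by rewrite !modn_small.
Qed.

End Frequencies.
End PlaneWaves.

Section LatticePeriodicFunctions.
Variables (R : realType) (d : nat).
Local Notation C := R[i].
Local Notation cj := (@Num.conj C).
Local Notation Z := 'rV[int]_d.
Local Open Scope complex_scope.

(** By Cramer's rule, the determinant of a basis maps the integer vectors into
    the lattice. *)
Lemma lattice_multiple (G : set Z) : full_rank_lattice R G ->
  exists m : nat, forall k : Z, G (k *+ m.+1).
Proof.
move=> [a [afree GE]].
pose A : 'M[int]_d := \matrix_(j, i) a j 0 i.
have detA : \det A != 0.
  apply/eqP => detA0.
  have : \det (map_mx intr A : 'M[R]_d) = 0 by rewrite det_map_mx detA0.
  move=> /eqP/det0P[w w0 wA].
  have [i wi] : exists i, w 0 i != 0.
    apply/existsP; apply: contraNT w0; rewrite negb_exists => /forallP w0.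
    by apply/eqP/rowP => i; rewrite mxE; apply/eqP; have := w0 i; rewrite negbK.
  have := @freeP _ _ _ [tuple to_real R (a j) | j < d].
  rewrite /= /tuple.mktuple/= -/(enum _) => /(_ afree (fun j => w 0 j)).
  move=> h; move/eqP: wi; apply; apply: h.
  rewrite -[RHS]wA mulmx_sum_row; apply: eq_bigr => j _; congr (_ *: _).
  have -> : (codom (fun j => to_real R (a j)))`_j = to_real R (a j).
    by rewrite -[RHS](tnth_mktuple (fun j => to_real R (a j))) (tnth_nth 0).
  by apply/rowP => l; rewrite !mxE.
have GA (w : Z) : G (w *m A).
  rewrite GE; exists (fun j => w 0 j); rewrite mulmx_sum_row.
  apply: eq_bigr => j _; apply/rowP => l; rewrite mxE mxE mxE.
  by rewrite -scaler_int mxE intz.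
have Gdet (k : Z) : G (k *~ \det A).
  have -> : k *~ \det A = k *m (\adj A) *m A.
    by rewrite -mulmxA mul_adj_mx mul_mx_scalar -scaler_int intz.
  exact: GA.
case: (\det A) detA Gdet => [[|m]|m] // _ Gdet.
  by exists m => k; exact: Gdet.
by exists m => k; have := Gdet (- k); rewrite NegzE mulNrz mulrNz opprK.
Qed.

Variables (m : nat) (G : set Z).
Hypothesis GM : forall k : Z, G (k *+ m.+1).
Local Notation M := (m.+1).
Local Notation J := {ffun 'I_d -> 'I_m.+1}.
Local Notation pw g := (plane_wave (freq R g)).

Lemma plane_wave_period (g : J) n (k : Z) : pw g (n + k *+ M) = pw g n.
Proof.
rewrite plane_waveD [X in _ * X](_ : _ = 1) ?mulr1// /plane_wave.
have -> : dot (freq R g) (k *+ M) = 2 * pi * (\sum_i (g i)%:Z * k 0 i)%:~R.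
  rewrite rmorph_sum/= mulr_sumr; apply: eq_bigr => i _.
  by rewrite mulmxnE -[k 0 i *+ _]mulr_natr natz !rmorphM/= /freq !pmulrn; field.
exact: expi2pi_int.
Qed.

Lemma plane_wave_orthogonal (g h : J) :
  \sum_(q : J) pw g (box_point q) * cj (pw h (box_point q)) =
    if g == h then (M ^ d)%:R else 0.
Proof.
rewrite -dvd_box_pointB -(@sum_plane_wave R); apply: eq_bigr => q _.
rewrite plane_waveD plane_waveN /plane_wave.
by rewrite (dot_freq_sym _ q g) (dot_freq_sym _ q h).
Qed.

Definition fourier_coef (f : Z -> C) (g : J) : C :=
  (M ^ d)%:R^-1 * \sum_(q : J) f (box_point q) * cj (pw g (box_point q)).

Lemma Md_neq0 : (M ^ d)%:R != 0 :> C.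
Proof. by rewrite pnatr_eq0 expn_eq0. Qed.

Lemma fourier_coef_sum (b : J -> C) h :
  fourier_coef (fun n => \sum_g b g * pw g n) h = b h.
Proof.
rewrite /fourier_coef; under eq_bigr do rewrite mulr_suml.
rewrite exchange_big (bigD1 h)//= [X in _ * (_ + X)]big1 => [|g gh].
  under eq_bigr do rewrite -mulrA.
  by rewrite -mulr_sumr plane_wave_orthogonal eqxx addr0 mulrCA mulVf ?Md_neq0// mulr1.
under eq_bigr do rewrite -mulrA.
by rewrite -mulr_sumr plane_wave_orthogonal (negbTE gh) mulr0.
Qed.

Lemma box_representative (n : Z) : exists q : J, exists k : Z, n = box_point q + k *+ M.
Proof.
have qlt i : (`|(n 0%R i %% M)%Z| < M)%N.
  by rewrite -ltz_nat gez0_abs ?modz_ge0// ltz_pmod.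
exists [ffun i => Ordinal (qlt i)], (\row_i (n 0%R i %/ M)%Z).
apply/rowP => i; rewrite mxE mulmxnE !mxE ffunE/= gez0_abs ?modz_ge0//.
by rewrite addrC -[_ *+ _]mulr_natr natz -divz_eq.
Qed.

Lemma fourier_series (f : Z -> C) n :
  (forall n k, f (n + k *+ M) = f n) -> f n = \sum_g fourier_coef f g * pw g n.
Proof.
move=> fM; have [q [k ->]] := box_representative n.
rewrite fM; under eq_bigr do rewrite plane_wave_period /fourier_coef -mulrA mulr_suml.
rewrite -mulr_sumr exchange_big/= (bigD1 q)//= [X in _ + X]big1 ?addr0 => [|r rq].
  under eq_bigr do rewrite mulrAC -mulrA.
  rewrite -mulr_sumr; under eq_bigr do rewrite -plane_waveN -plane_waveD.
  rewrite sum_plane_wave dvd_box_pointB eqxx mulrC -mulrA mulfV ?mulr1 ?Md_neq0//.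
under eq_bigr do rewrite -mulrA [X in _ * X]mulrC.
rewrite -mulr_sumr; under eq_bigr do rewrite -plane_waveN -plane_waveD.
by rewrite sum_plane_wave dvd_box_pointB eq_sym (negbTE rq) mulr0.
Qed.

(** Representatives modulo [Z^d] of the dual lattice of [G]: since [G] contains
    [M Z^d], dual vectors have coordinates in [Z / M]. *)
Definition dual_freqs : {set J} :=
  [set g | `[< forall a, G a -> pw g a = 1 >]].

(** For a frequency outside the dual lattice, translating [f] by some vector of
    the lattice, which does not change [f], multiplies the coefficient by a factor
    different from 1. *)
Lemma fourier_coef_off_dual (f : Z -> C) g :
  (forall a, G a -> periodic f a) -> g \notin dual_freqs -> fourier_coef f g = 0.
Proof.
move=> fG; rewrite inE => /asboolPn/existsNP[a /not_implyP[Ga pwa]].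
have fM n k : f (n + k *+ M) = f n by exact: fG.
have : fourier_coef (fun n => f (n + a)) g = fourier_coef f g.
  by congr fourier_coef; apply/funext => n; exact: fG.
have -> : (fun n => f (n + a)) =
    (fun n => \sum_g (fourier_coef f g * pw g a) * pw g n).
  apply/funext => n; rewrite (fourier_series _ fM); apply: eq_bigr => h _.
  by rewrite plane_waveD mulrA mulrAC.
move=> /(etrans (esym (fourier_coef_sum (fun h => fourier_coef f h * pw h a) g))).
move=> /eqP; rewrite -subr_eq0 -[X in _ - X]mulr1 -mulrBr.
by rewrite mulf_eq0 subr_eq0 => /orP[/eqP//|/eqP].
Qed.

Local Notation N := #|dual_freqs|.
Local Notation pwA i := (pw (@enum_val _ (mem dual_freqs) i)).

(** The [G]-periodic function with prescribed Fourier coefficients. *)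
Definition synth (v : 'rV[C]_N) (n : Z) : C := \sum_i v 0 i * pwA i n.

Lemma synth_series (f : Z -> C) n : (forall a, G a -> periodic f a) ->
  f n = synth (\row_i fourier_coef f (enum_val i)) n.
Proof.
move=> fG; rewrite (@fourier_series f n); last by move=> *; exact: fG.
rewrite (bigID (mem dual_freqs))/= [X in _ + X]big1 ?addr0 => [|g gA].
  rewrite /synth big_enum_val/=; apply: eq_bigr => i _; by rewrite mxE.
by rewrite fourier_coef_off_dual// mul0r.
Qed.

Lemma synth_periodic v a : G a -> periodic (synth v) a.
Proof.
move=> Ga n; apply: eq_bigr => i _; rewrite plane_waveD.
suff -> : pwA i a = 1 by rewrite mulr1.
by have := enum_valP i; rewrite inE => /asboolP; exact.
Qed.

Lemma synth_parseval (v : 'rV[C]_N) :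
  \sum_(q : J) `|synth v (box_point q)| ^+ 2 = (M ^ d)%:R * sqnorm v.
Proof.
under eq_bigr => q _.
  rewrite normCK /synth rmorph_sum/= big_distrlr/=.
  over.
rewrite exchange_big/= /sqnorm mulr_sumr; apply: eq_bigr => i _.
rewrite exchange_big/= (bigD1 i)//= [X in _ + X]big1 ?addr0 => [|j ji].
  under eq_bigr do rewrite rmorphM mulrACA.
  by rewrite -mulr_sumr plane_wave_orthogonal eqxx mulrC normCK.
under eq_bigr do rewrite rmorphM mulrACA.
rewrite -mulr_sumr plane_wave_orthogonal (inj_eq enum_val_inj) eq_sym.
by rewrite (negbTE ji) mulr0.
Qed.

Lemma synth_eq0 v : (forall n, synth v n = 0) -> v = 0.
Proof.
move=> v0; apply/eqP; rewrite -sqnorm_eq0.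
have := synth_parseval v; rewrite big1 => [/esym/eqP|q _]; last first.
  by rewrite v0 normr0 expr0n.
by rewrite mulf_eq0 (negbTE Md_neq0).
Qed.

End LatticePeriodicFunctions.

(** * Finitely supported functions and local symmetric operators *)

Section LocalOperators.
Variables (R : realType) (d : nat).
Local Notation C := R[i].
Local Notation Z := 'rV[int]_d.
Local Notation Fun := (Z -> C).
Local Open Scope complex_scope.
Implicit Types (f g psi phi : Fun) (A K : Fun -> Fun).

Definition rdot (z w : C) : R :=
  complex.Re z * complex.Re w + complex.Im z * complex.Im w.

Definition nrm2 (z : C) : R := rdot z z.

Lemma nrm2E z : Normc.normc z ^+ 2 = nrm2 z.
Proof. by case: z => a b; rewrite /nrm2 /rdot/= sqr_sqrtr ?addr_ge0 ?sqr_ge0// !expr2. Qed.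

Lemma nrm2C z : (nrm2 z)%:C = `|z| ^+ 2.
Proof. by rewrite -nrm2E rmorphXn. Qed.

Lemma nrm2_ge0 z : 0 <= nrm2 z.
Proof. by rewrite -nrm2E sqr_ge0. Qed.

Lemma nrm2_eq0 z : nrm2 z = 0 -> z = 0.
Proof.
rewrite -nrm2E => /eqP; rewrite expf_eq0/= => /eqP; exact: Normc.eq0_normc.
Qed.

Lemma nrm20 : nrm2 0 = 0. Proof. by rewrite /nrm2 /rdot/= !mul0r addr0. Qed.

Lemma nrm2M z w : nrm2 (z * w) = nrm2 z * nrm2 w.
Proof. by rewrite -!nrm2E Normc.normcM exprMn. Qed.

Lemma nrm2_real (r : R) : nrm2 r%:C = r ^+ 2.
Proof. by rewrite /nrm2 /rdot/= mul0r addr0 expr2. Qed.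

Lemma nrm2D_le z w : nrm2 (z + w) <= 2 * nrm2 z + 2 * nrm2 w.
Proof.
case: z w => a b [a' b']; rewrite /nrm2 /rdot/=.
by have := sqr_ge0 (a - a'); have := sqr_ge0 (b - b'); nra.
Qed.

Lemma rdotC z w : rdot z w = rdot w z.
Proof. by rewrite /rdot; ring. Qed.

Lemma rdotDl z z' w : rdot (z + z') w = rdot z w + rdot z' w.
Proof. by case: z z' w => a b [a' b'] [e f]; rewrite /rdot/=; ring. Qed.

Lemma rdotZl (r : R) z w : rdot (r%:C * z) w = r * rdot z w.
Proof. by case: z w => a b [e f]; rewrite /rdot/=; ring. Qed.

Definition finsupported psi := exists s : seq Z, forall n, n \notin s -> psi n = 0.

Definition fsupp_sum (T : nmodType) (f : Z -> T) : T := \sum_(n \in [set: Z]) f n.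

Lemma fsupp_sumE (T : nmodType) (f : Z -> T) (s : seq Z) :
  (forall n, n \notin s -> f n = 0) -> fsupp_sum f = \sum_(n <- undup s) f n.
Proof.
move=> fs; rewrite /fsupp_sum (fsbigE (undup s)) ?undup_uniq//=.
  by apply: eq_bigl => n; rewrite in_setT.
by move=> n _; rewrite mem_undup; exact: fs.
Qed.

(** The real part of the inner product; the sum is meaningful as soon as one
    of the functions has finite support. *)
Definition rip f g : R := fsupp_sum (fun n => rdot (f n) (g n)).
Local Notation N f := (rip f f).

Lemma ripC f g : rip f g = rip g f.
Proof. by congr fsupp_sum; apply/funext => n; rewrite rdotC. Qed.

Lemma rip0l h : rip (fun=> 0) h = 0.
Proof. by rewrite /rip (@fsupp_sumE _ _ [::]) ?big_nil// => n _; rewrite /rdot/= !mul0r addr0. Qed.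

Lemma ripZ (r : R) f h : rip (fun n => r%:C * f n) h = r * rip f h.
Proof.
rewrite /rip /fsupp_sum mulr_fsumr; apply: eq_fsbigr => n _; exact: rdotZl.
Qed.

Lemma ripDl f g h : finsupported f -> finsupported g ->
  rip (fun n => f n + g n) h = rip f h + rip g h.
Proof.
move=> [s1 fs] [s2 gs]; pose s := s1 ++ s2.
have fs' n : n \notin s -> f n = 0 by rewrite mem_cat negb_or => /andP[/fs].
have gs' n : n \notin s -> g n = 0 by rewrite mem_cat negb_or => /andP[_ /gs].
have r0 z : rdot 0 z = 0 by rewrite /rdot/= !mul0r addr0.
rewrite /rip !(@fsupp_sumE _ _ s) => [|n /gs'->|n /fs'->|n sn]//.
  by rewrite -big_split; apply: eq_bigr => n _; rewrite rdotDl.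
by rewrite fs'// gs'// addr0.
Qed.

Lemma finsupportedZ (a : C) f : finsupported f -> finsupported (fun n => a * f n).
Proof. by move=> [s fs]; exists s => n /fs ->; rewrite mulr0. Qed.

Lemma rip_comb (r s : R) f g h : finsupported f -> finsupported g ->
  rip (fun n => r%:C * f n + s%:C * g n) h = r * rip f h + s * rip g h.
Proof. by move=> ff fg; rewrite ripDl ?ripZ//; exact: finsupportedZ. Qed.

Lemma rip_ge0 f : 0 <= N f.
Proof. by apply: fsumr_ge0 => n _; exact: nrm2_ge0. Qed.

Lemma rip_sum f (s : seq Z) : (forall n, n \notin s -> f n = 0) ->
  N f = \sum_(n <- undup s) nrm2 (f n).
Proof. by move=> fs; rewrite /rip (@fsupp_sumE _ _ s)// => n /fs ->; exact: nrm20. Qed.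

Lemma sum_seq_le_rip f (s : seq Z) : finsupported f -> uniq s ->
  \sum_(n <- s) nrm2 (f n) <= N f.
Proof.
move=> [t ft] us; rewrite (@rip_sum f (s ++ t)); last first.
  by move=> n; rewrite mem_cat negb_or => /andP[_ /ft].
rewrite [leRHS](bigID (mem s))/= -[leLHS]addr0; apply: lerD; last first.
  by apply: sumr_ge0 => n _; exact: nrm2_ge0.
rewrite le_eqVlt; apply/orP; left; apply/eqP; rewrite -[RHS]big_filter.
apply: perm_big.
apply: uniq_perm; rewrite ?filter_uniq ?undup_uniq// => n.
by rewrite mem_filter mem_undup mem_cat; case: (n \in s).
Qed.

Lemma finsupported_lin (a : C) f g : finsupported f -> finsupported g ->
  finsupported (fun n => a * f n + g n).
Proof.
move=> [s1 fs] [s2 gs]; exists (s1 ++ s2) => n.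
by rewrite mem_cat negb_or => /andP[/fs-> /gs->]; rewrite mulr0 addr0.
Qed.

(** Symmetry is only required on finitely supported functions, and locality
    carries everything from them to arbitrary functions, so that no infinite
    sum has to be manipulated. *)
Record symop A : Prop := Symop {
  op_linear : forall (a : C) f g n, A (fun n => a * f n + g n) n = a * A f n + A g n;
  op_finsupported : forall f, finsupported f -> finsupported (A f);
  op_local : forall n, exists s : seq Z, forall f g,
     (forall k, k \in s -> f k = g k) -> A f n = A g n;
  op_sym : forall f g, finsupported f -> finsupported g -> rip (A f) g = rip f (A g) }.

Lemma symopZ_shift A (a b : R) : symop A ->
  symop (fun f n => a%:C * A f n + b%:C * f n).
Proof.
move=> [lA fA loc sA]; split.
- by move=> c f g n; rewrite lA; ring.
- move=> f ff; apply: finsupported_lin; first exact: fA.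
  by have [s fs] := ff; exists s => n /fs ->; rewrite mulr0.
- move=> n; have [s hs] := loc n; exists (n :: s) => f g fg.
  rewrite (hs f g) => [|k ks]; last by rewrite fg// inE ks orbT.
  by rewrite fg ?mem_head.
- move=> f g ff fg; have fAf := fA f ff; have fAg := fA g fg.
  rewrite rip_comb// [RHS]ripC rip_comb// sA//.
  by rewrite [rip g f]ripC [rip (A g) f]ripC.
Qed.

Lemma symop_sqr A : symop A -> symop (fun f => A (A f)).
Proof.
move=> [lA fA loc sA]; split.
- move=> a f g n; rewrite -lA; congr (A _ n); apply/funext => k; exact: lA.
- by move=> f ff; apply/fA/fA.
- move=> n; have [s hs] := loc n.
  have [t ht] : exists t : Z -> seq Z, forall k f g,
      (forall l, l \in t k -> f l = g l) -> A f k = A g k.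
    by have [t ht] := choice loc; exists t.
  exists (flatten (map t s)) => f g fg; apply: hs => k ks; apply: ht => l lt.
  by apply: fg; apply/flattenP; exists (t k) => //; apply: map_f.
- by move=> f g ff fg; have fAf := fA f ff; have fAg := fA g fg; rewrite !sA.
Qed.

(** For [0 <= K <= q] the identity
    [q K (q - K) = K (q - K) K + (q - K) K (q - K)]
    exhibits [K (q - K)] as a nonnegative operator, so [K^2 <= q K <= q^2]. *)
Lemma form_bound_norm_bound K (q : R) : symop K -> 0 < q ->
  (forall f, finsupported f -> 0 <= rip (K f) f <= q * N f) ->
  forall f, finsupported f -> N (K f) <= q ^+ 2 * N f.
Proof.
move=> sK q0 hK f ff; have fK := op_finsupported sK.
have fKf := fK f ff; have fKKf := fK _ fKf.
pose g n := q%:C * f n + (-1)%:C * K f n.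
have fg : finsupported g by apply: finsupported_lin => //; exact: finsupportedZ.
have ripg h : rip g h = q * rip f h - rip (K f) h.
  by rewrite rip_comb// mulN1r.
have /andP[Kg _] := hK g fg; have /andP[_ KK] := hK _ (fK _ ff).
have /andP[_ Kf] := hK _ ff.
have KgE : rip (K g) g = q * (q * rip (K f) f - N (K f)) - (q * N (K f) - rip (K (K f)) (K f)).
  rewrite (op_sym sK)// ripg -!(op_sym sK)// ![rip (K _) g]ripC !ripg.
  rewrite ![rip f (K _)]ripC [rip (K f) (K (K f))]ripC.
  by rewrite (op_sym sK fKf ff) (op_sym sK fKKf ff).
move: KK Kf Kg; rewrite {}KgE.
move: (N (K f)) (rip (K (K f)) (K f)) (rip (K f) f) (N f) => b c a e KK Kf h.
have : 0 <= q * (q * a - b) by lra.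
by rewrite pmulr_rge0// => h2; nra.
Qed.

(** Norm bounds on finite sums, in place of the possibly infinite sum. *)
Definition l2le f (c : R) := forall s : seq Z, uniq s -> \sum_(n <- s) nrm2 (f n) <= c.

(** By locality, on a finite set of points [A f] only depends on a truncation of
    [f] to a finite set. *)
Lemma local_bound A (c : R) : symop A -> 0 <= c ->
  (forall f, finsupported f -> N (A f) <= c * N f) ->
  forall f b, l2le f b -> l2le (A f) (c * b).
Proof.
move=> sA c0 hA f b fb s us.
have [t ht] : exists t : Z -> seq Z, forall k f g,
    (forall l, l \in t k -> f l = g l) -> A f k = A g k.
  by have [t ht] := choice (op_local sA); exists t.
pose u := flatten (map t s); pose f' n := if n \in u then f n else 0.
have f'0 n : n \notin u -> f' n = 0 by rewrite /f' => /negbTE ->.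
have ff' : finsupported f' by exists u.
have -> : \sum_(n <- s) nrm2 (A f n) = \sum_(n <- s) nrm2 (A f' n).
  apply: eq_big_seq => n ns; congr nrm2; apply: ht => l lt.
  by rewrite /f' ifT//; apply/flattenP; exists (t n) => //; apply: map_f.
apply: le_trans (sum_seq_le_rip (op_finsupported sA ff') us) _.
apply: le_trans (hA _ ff') _; apply: ler_wpM2l => //.
rewrite (rip_sum f'0); apply: le_trans (fb _ (undup_uniq u)).
apply: ler_sum => n _; rewrite /f'; case: ifP => // _.
by rewrite nrm20 nrm2_ge0.
Qed.

Lemma l2leW f b c : b <= c -> l2le f b -> l2le f c.
Proof. by move=> bc fb s us; apply: le_trans bc; exact: fb. Qed.

Lemma l2le_pt f c n : l2le f c -> nrm2 (f n) <= c.
Proof. by move=> /(_ [:: n] isT); rewrite big_seq1. Qed.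

Lemma l2leD2 f g b c : l2le f b -> l2le g c -> l2le (fun n => f n + g n) (2 * b + 2 * c).
Proof.
move=> fb gc s us; apply: le_trans (lerD (ler_wpM2l _ (fb s us)) (ler_wpM2l _ (gc s us))) => //.
rewrite !mulr_sumr -big_split; apply: ler_sum => n _; exact: nrm2D_le.
Qed.

Lemma l2leZ (a : C) f c : l2le f c -> l2le (fun n => a * f n) (nrm2 a * c).
Proof.
move=> fc s us; under eq_bigr do rewrite nrm2M.
by rewrite -mulr_sumr ler_wpM2l ?nrm2_ge0// fc.
Qed.

Lemma l2le_triangle f g b c : 0 <= b -> 0 <= c ->
  l2le f (b ^+ 2) -> l2le g (c ^+ 2) -> l2le (fun n => f n + g n) ((b + c) ^+ 2).
Proof.
move=> b0 c0 fb gc.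
have zero h : l2le h (0 ^+ 2) -> forall n, h n = 0.
  move=> h0 n; apply: nrm2_eq0; apply/eqP; rewrite eq_le nrm2_ge0 andbT.
  by have := l2le_pt n h0; rewrite expr0n.
have [b00|bneq0] := eqVneq b 0.
  rewrite b00 in fb; have f0 := zero _ fb; rewrite b00 add0r.
  by rewrite (_ : (fun n => _) = g)//; apply/funext => n; rewrite f0 add0r.
have [c00|cneq0] := eqVneq c 0.
  rewrite c00 in gc; have g0 := zero _ gc; rewrite c00 addr0.
  by rewrite (_ : (fun n => _) = f)//; apply/funext => n; rewrite g0 addr0.
have {b0}b0 : 0 < b by rewrite lt_neqAle eq_sym bneq0.
have {c0}c0 : 0 < c by rewrite lt_neqAle eq_sym cneq0.
move=> s us.
(* The weights [c / b] and [b / c] make the sum of the bounds a perfect square. *)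
have split n : nrm2 (f n + g n) <= (1 + c / b) * nrm2 (f n) + (1 + b / c) * nrm2 (g n).
  case: (f n) (g n) => x y [x' y']; rewrite /nrm2 /rdot/= -subr_ge0.
  rewrite [X in 0 <= X](_ : _ = b / c * ((c / b * x - x') ^+ 2 + (c / b * y - y') ^+ 2)).
    by rewrite mulr_ge0 ?addr_ge0 ?sqr_ge0// divr_ge0 ?ltW.
  by field; rewrite bneq0 cneq0.
apply: le_trans (ler_sum _ (fun n _ => split n)) _.
rewrite big_split/= -!mulr_sumr.
rewrite [leRHS](_ : _ = (1 + c / b) * b ^+ 2 + (1 + b / c) * c ^+ 2).
  by apply: lerD; apply: ler_wpM2l; rewrite ?fb ?gc// addr_ge0// divr_ge0 ?ltW.
by field; rewrite bneq0 cneq0.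
Qed.

Lemma geometric_squeeze (x c q : R) : 0 <= q < 1 ->
  (forall j : nat, x <= c * q ^+ j) -> x <= 0.
Proof.
move=> /andP[q0 q1] h; rewrite leNgt; apply/negP => x0.
have : ((fun j => c * q ^+ j) @ \oo --> c * 0)%classic.
  by apply: cvgM; [exact: cvg_cst|apply: cvg_expr; rewrite ger0_norm].
rewrite mulr0 => /cvgr_lt/(_ _ x0)[j _ /(_ j (leqnn _))] /=.
by rewrite ltNge h.
Qed.

End LocalOperators.

(** * Resolvents of local symmetric operators *)

Section SquareSummable.
Variables (R : realType) (d : nat).
Local Notation C := R[i].
Local Notation Z := 'rV[int]_d.
Local Notation Fun := (Z -> C).
Local Open Scope classical_set_scope.
Local Open Scope complex_scope.
Local Open Scope ring_scope.
Implicit Types (f g psi phi : Fun) (A K : Fun -> Fun).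
Local Notation N f := (rip f f).

Lemma esum_le_l2le psi (c : R) :
  (\esum_(n in [set: Z]) (Normc.normc (psi n) ^+ 2)%:E <= c%:E)%E <-> l2le psi c.
Proof.
have sumE (s : seq Z) : (\sum_(n <- s) (Normc.normc (psi n) ^+ 2)%:E)%E =
    (\sum_(n <- s) nrm2 (psi n))%:E.
  by rewrite sumEFin; congr EFin; apply: eq_bigr => n _; rewrite nrm2E.
split=> [h s us|h].
  rewrite -lee_fin -sumE; apply: le_trans h; apply: esum_ge.
  exists [set` s]; first by split=> //; exact: finite_seq.
  by rewrite -fsbig_seq.
apply: ub_ereal_sup => _ [A [fA _] <-].
rewrite fsbig_finite// sumE lee_fin; apply: h; exact: fset_uniq.
Qed.

Lemma l2P psi : l2 psi <-> exists c, l2le psi c.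
Proof.
have -> : l2 psi = (\esum_(n in [set: Z]) (Normc.normc (psi n) ^+ 2)%:E < +oo)%E.
  rewrite /l2 /summable; congr (_ < _)%E; apply: eq_esum => n _.
  by rewrite gee0_abs// lee_fin sqr_ge0.
split=> [h|[c /esum_le_l2le h]]; last exact: le_lt_trans h (ltry _).
exists (fine (\esum_(n in [set: Z]) (Normc.normc (psi n) ^+ 2)%:E)%E).
apply/esum_le_l2le; rewrite fineK// ge0_fin_numE//.
by apply: esum_ge0 => n _; rewrite lee_fin sqr_ge0.
Qed.

Lemma l2norm_sqr psi : l2 psi -> l2le psi (l2norm psi ^+ 2).
Proof.
have E0 : (0 <= \esum_(n in [set: Z]) (Normc.normc (psi n) ^+ 2)%:E)%E.
  by apply: esum_ge0 => n _; rewrite lee_fin sqr_ge0.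
move=> /l2P[c /esum_le_l2le hc]; rewrite /l2norm sqr_sqrtr ?fine_ge0//.
apply/esum_le_l2le; rewrite fineK// ge0_fin_numE//; exact: le_lt_trans hc (ltry _).
Qed.

Lemma l2norm_ge0 psi : 0 <= l2norm psi. Proof. exact: sqrtr_ge0. Qed.

Lemma l2norm_le psi c : 0 <= c -> l2le psi (c ^+ 2) -> l2norm psi <= c.
Proof.
move=> c0 /esum_le_l2le hc; rewrite -[leRHS]ger0_norm// -sqrtr_sqr ler_sqrt ?sqr_ge0//.
rewrite -lee_fin fineK// ge0_fin_numE; first exact: le_lt_trans hc (ltry _).
by apply: esum_ge0 => n _; rewrite lee_fin sqr_ge0.
Qed.

Lemma op0 A n : symop A -> A (fun=> 0) n = 0.
Proof.
move=> sA; have := op_linear sA (-1) (fun=> 0) (fun=> 0) n.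
rewrite [X in _ = X](_ : _ = 0); last by ring.
move=> e; rewrite -[RHS]e; congr (A _ n).
by apply/funext => k; rewrite mulr0 addr0.
Qed.

(** The Neumann series of [f] converges pointwise; its limit is square
    summable because finite sums pass to the limit. *)
Lemma neumann K (q : R) f (a : R) : symop K -> 0 < q < 1 ->
  (forall g b, l2le g b -> l2le (K g) (q ^+ 2 * b)) ->
  0 <= a -> l2le f (a ^+ 2) ->
  exists u, l2le u ((a / (1 - q)) ^+ 2) /\ forall n, u n - K u n = f n.
Proof.
move=> sK /andP[q0 q1] hK a0 fa.
have q1' : 0 < 1 - q by rewrite subr_gt0.
pose T (i : nat) := iter i K f.
have Ti i : l2le (T i) ((q ^+ i * a) ^+ 2).
  elim: i => [|i /hK]; first by rewrite mul1r.
  by rewrite -exprMn mulrA -exprS.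
pose S (j : nat) n : C := \sum_(0 <= i < j) T i n.
have tail j k : (j <= k)%N ->
    l2le (fun n => S k n - S j n) ((q ^+ j * a / (1 - q)) ^+ 2).
  move=> jk; rewrite -(subnKC jk).
  have : l2le (fun n => S (j + (k - j))%N n - S j n)
      ((q ^+ j * a * (1 - q ^+ (k - j)) / (1 - q)) ^+ 2).
    elim: (k - j)%N => [|r IH].
      rewrite addn0 expr0 subrr mulr0 mul0r => s us.
      by rewrite big1 ?expr0n// => n _; rewrite subrr nrm20.
    have -> : (fun n => S (j + r.+1)%N n - S j n) =
        fun n => (S (j + r)%N n - S j n) + T (j + r)%N n.
      by apply/funext => n; rewrite addnS /S big_nat_recr//= addrAC.
    have -> : q ^+ j * a * (1 - q ^+ r.+1) / (1 - q) =
       q ^+ j * a * (1 - q ^+ r) / (1 - q) + q ^+ (j + r) * a.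
      by rewrite exprD exprS; field; rewrite gt_eqF.
    apply: l2le_triangle => //; last by rewrite mulr_ge0// exprn_ge0// ltW.
    rewrite divr_ge0 ?(ltW q1')// !mulr_ge0 ?exprn_ge0 ?(ltW q0)//.
    by rewrite subr_ge0 exprn_ile1 ?ltW.
  apply: l2leW; rewrite ler_pXn2r ?nnegrE ?divr_ge0 ?mulr_ge0 ?exprn_ge0 ?(ltW q0) ?(ltW q1')//.
    rewrite ler_pM2r ?invr_gt0// ler_piMr ?mulr_ge0 ?exprn_ge0 ?(ltW q0)//.
    by rewrite lerBlDr lerDl exprn_ge0// ltW.
  by rewrite subr_ge0 exprn_ile1 ?ltW.
have TRe i n : `|complex.Re (T i n)| <= a * q ^+ i /\ `|complex.Im (T i n)| <= a * q ^+ i.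
  have := l2le_pt n (Ti i); rewrite mulrC /nrm2 /rdot => h.
  have aq0 : 0 <= a * q ^+ i by rewrite mulr_ge0 ?exprn_ge0 ?(ltW q0).
  have h1 := sqr_ge0 (complex.Re (T i n)); have h2 := sqr_ge0 (complex.Im (T i n)).
  split; rewrite -ler_sqr ?nnegrE// real_normK ?num_real//; rewrite !expr2 in h h1 h2 *; lra.
have cvgpart (t : nat -> R) : (forall i, `|t i| <= a * q ^+ i) -> cvgn (series t).
  move=> tle; apply: normed_cvg.
  apply: (@series_le_cvg _ _ (geometric a q)).
  - by move=> i; exact: normr_ge0.
  - by move=> i; rewrite /geometric/= mulr_ge0 ?exprn_ge0 ?(ltW q0).
  - by move=> i; exact: tle.
  - by apply: is_cvg_geometric_series; rewrite ger0_norm// ltW.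
have SRe n j : complex.Re (S j n) = series (fun i => complex.Re (T i n)) j.
  by rewrite /series/= /S (big_morph (@complex.Re R) (id1 := 0) (op1 := +%R))// => -[? ?] [? ?].
have SIm n j : complex.Im (S j n) = series (fun i => complex.Im (T i n)) j.
  by rewrite /series/= /S (big_morph (@complex.Im R) (id1 := 0) (op1 := +%R))// => -[? ?] [? ?].
pose u n : C := limn (series (fun i => complex.Re (T i n))) +i*
                limn (series (fun i => complex.Im (T i n))).
have cRe n : ((fun j => complex.Re (S j n)) @ \oo --> complex.Re (u n))%classic.
  under eq_fun do rewrite SRe; apply: cvgpart => i; exact: (TRe i n).1.
have cIm n : ((fun j => complex.Im (S j n)) @ \oo --> complex.Im (u n))%classic.
  under eq_fun do rewrite SIm; apply: cvgpart => i; exact: (TRe i n).2.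
have utail j : l2le (fun n => u n - S j n) ((q ^+ j * a / (1 - q)) ^+ 2).
  move=> s us.
  have cv : ((fun k => \sum_(n <- s) nrm2 (S k n - S j n)) @ \oo -->
      \sum_(n <- s) nrm2 (u n - S j n))%classic.
    elim: s {us} => [|n s IH].
      by under eq_fun do rewrite big_nil; rewrite big_nil; exact: cvg_cst.
    under eq_fun do rewrite big_cons; rewrite big_cons; apply: cvgD => // {s IH}.
    rewrite /nrm2 /rdot.
    have ReB (z w : C) : complex.Re (z - w) = complex.Re z - complex.Re w by case: z w => ? ? [].
    have ImB (z w : C) : complex.Im (z - w) = complex.Im z - complex.Im w by case: z w => ? ? [].
    under eq_fun do rewrite ReB ImB; rewrite ReB ImB.
    by apply: cvgD; apply: cvgM; apply: cvgB => //; exact: cvg_cst.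
  apply: (closed_cvg (fun x => x <= (q ^+ j * a / (1 - q)) ^+ 2)) cv.
    exact: closed_le.
  by exists j => // k /= jk; exact: tail.
exists u; split.
  have := utail 0%N; rewrite mul1r; congr l2le; apply/funext => n.
  by rewrite /S big_geq// subr0.
move=> n; apply/eqP; rewrite -subr_eq0; apply/eqP/nrm2_eq0/eqP.
rewrite eq_le nrm2_ge0 andbT.
apply: (@geometric_squeeze _ _ (4 * (a / (1 - q)) ^+ 2) (q ^+ 2)).
  by rewrite exprn_ge0 ?ltW//= exprn_ilt1 ?ltW.
move=> j.
have KS : K (S j) n = \sum_(0 <= i < j) T i.+1 n.
  elim: j => [|j IH]; rewrite /S.
    rewrite [RHS]big_geq// -[RHS](op0 n sK); congr (K _ n); apply/funext => k.
    by rewrite big_geq.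
  rewrite [RHS]big_nat_recr//= -IH.
  have := op_linear sK 1 (S j) (T j) n; rewrite mul1r => <-; congr (K _ n).
  by apply/funext => k; rewrite mul1r big_nat_recr.
have SS : S j.+1 n = f n + K (S j) n.
  by rewrite KS /S big_nat_recl.
have Ku : K u n - K (S j) n = K (fun k => u k - S j k) n.
  have := op_linear sK (-1) (S j) u n; rewrite mulN1r addrC => <-; congr (K _ n).
  by apply/funext => k; rewrite mulN1r addrC.
have -> : u n - K u n - f n = (u n - S j.+1 n) + (-1) * K (fun k => u k - S j k) n.
  by rewrite SS -Ku; ring.
apply: le_trans (nrm2D_le _ _) _; rewrite nrm2M.
have -> : nrm2 (-1 : C) = 1 by rewrite /nrm2 /rdot/= oppr0 mulr0 addr0 mulrNN mul1r.
rewrite mul1r.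
have h1 := l2le_pt n (utail j.+1); have h2 := l2le_pt n (hK _ _ (utail j)).
rewrite -exprM mulnC.
have E : q ^+ 2 * (q ^+ j * a / (1 - q)) ^+ 2 <= (a / (1 - q)) ^+ 2 * q ^+ (j * 2).
  rewrite -(mulrA _ a) exprMn -exprM mulrA [leRHS]mulrC ler_wpM2r ?sqr_ge0//.
  by rewrite ler_piMl ?exprn_ge0 ?(ltW q0)// exprn_ile1 ?ltW.
have E' : (q ^+ j.+1 * a / (1 - q)) ^+ 2 = q ^+ 2 * (q ^+ j * a / (1 - q)) ^+ 2.
  by rewrite (exprS q j) -[RHS]exprMn !mulrA.
rewrite E' in h1; lra.
Qed.

End SquareSummable.

Section Resolvent.
Variables (R : realType) (d : nat).
Local Notation C := R[i].
Local Notation Z := 'rV[int]_d.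
Local Notation Fun := (Z -> C).
Local Open Scope complex_scope.
Implicit Types (f g psi phi : Fun) (A K : Fun -> Fun).
Local Notation N f := (rip f f).

(** With [P = A - x] one has [(P - iy) (P + iy) = P^2 + y^2], which is bounded
    below; its inverse is a Neumann series, and composing with [P + iy] gives
    the resolvent at [x + iy]. *)
Lemma resolvent_of_lower_bound A (x y c0 delta : R) : symop A -> 0 <= c0 -> 0 < delta ->
  (forall f, finsupported f -> N (fun n => 1%:C * A f n + (- x)%:C * f n) <= c0 * N f) ->
  (forall f, finsupported f ->
    delta * N f <= N (fun n => 1%:C * A f n + (- x)%:C * f n) + y ^+ 2 * N f) ->
  resolvent_set A (x +i* y).
Proof.
move=> sA c00 delta0 upper lower.
pose P f := fun n => 1%:C * A f n + (- x)%:C * f n.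
have sP : symop P := symopZ_shift 1 (- x) sA.
(* [c] exceeds an upper bound of [P^2 + y^2], so that the form of
   [K = 1 - (P^2 + y^2) / c] lies between 0 and [q < 1]. *)
pose c := c0 + y ^+ 2 + delta + 1.
have y0 := sqr_ge0 y.
have cgt0 : 0 < c by rewrite /c; lra.
pose K f := fun n => (- c^-1)%:C * P (P f) n + (1 - y ^+ 2 / c)%:C * f n.
have sK : symop K := symopZ_shift _ _ (symop_sqr sP).
pose q := 1 - delta / c.
have q01 : 0 < q < 1.
  rewrite /q subr_gt0 ltr_pdivrMr// gtrBl divr_gt0// andbT /c; lra.
have formK f : finsupported f -> rip (K f) f = N f - (N (P f) + y ^+ 2 * N f) / c.
  move=> ff; have fPf := op_finsupported sP ff; have fPPf := op_finsupported sP fPf.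
  by rewrite rip_comb// (op_sym sP)//; field; rewrite gt_eqF.
have hK f : finsupported f -> 0 <= rip (K f) f <= q * N f.
  move=> ff; rewrite formK// /q; have := upper f ff; have := lower f ff.
  rewrite -/(P f); have := rip_ge0 f; move: (N f) (N (P f)) => a b a0 lo up.
  apply/andP; split.
    rewrite subr_ge0 ler_pdivrMr// /c; nra.
  rewrite mulrBl mul1r lerD2l lerN2 mulrAC ler_pM2r ?invr_gt0//.
have /andP[q0 q1] := q01.
have Kb g b : l2le g b -> l2le (K g) (q ^+ 2 * b).
  apply: local_bound => //; first exact: sqr_ge0.
  exact: form_bound_norm_bound.
have Pb g b : l2le g b -> l2le (P g) (c0 * b) by apply: local_bound.
have KE w n : w n - K w n = c^-1%:C * (P (P w) n + (y ^+ 2)%:C * w n).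
  rewrite /K; move: (P (P w) n) (w n) => u v.
  by rewrite rmorphN rmorphB rmorph1 rmorphM /=; ring.
have ci0 : c^-1%:C != 0 :> C by rewrite (inj_eq (@complexI R) _ 0) gt_eqF ?invr_gt0.
pose D z f := fun n => A f n - z * f n.
have Plin (a : C) f g n : P (fun n => a * f n + g n) n = a * P f n + P g n.
  exact: op_linear.
have fact (s : R) f n : s ^+ 2 = y ^+ 2 ->
    D (x +i* s) (fun k => s *i * f k + P f k) n = P (P f) n + (y ^+ 2)%:C * f n.
  move=> <-; have E g k : D (x +i* s) g k = - s *i * g k + P g k.
    rewrite /D /P mul1r rmorphN/=.
    have -> : x +i* s = x%:C + s *i by simpc.
    by ring.
  rewrite E Plin.
  have -> : (s ^+ 2)%:C = - (s *i) * (s *i) :> C by simpc; rewrite expr2.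
  by ring.
have uniq_sol f : l2 f -> (forall n, D (x +i* y) f n = 0) -> f = fun=> 0.
  move=> /l2P[b fb] Df.
  have KF n : K f n = f n.
    apply/eqP; rewrite eq_sym -subr_eq0 KE.
    have PE k : P f k = y *i * f k.
      apply/eqP; rewrite -subr_eq0; apply/eqP; rewrite -[RHS](Df k) /D /P.
      have -> : x +i* y = x%:C + y *i by simpc.
      by rewrite mul1r rmorphN; ring.
    have -> : P f = fun k => y *i * f k + 0.
      by apply/funext => k; rewrite addr0.
    rewrite Plin (op0 n sP) addr0 PE.
    have -> : (y ^+ 2)%:C = - (y *i) * (y *i) :> C by simpc; rewrite expr2.
    by apply/eqP; ring.
  have KFf : K f = f by apply/funext.
  have fj j : l2le f (b * (q ^+ 2) ^+ j).
    elim: j => [|j IH]; first by rewrite expr0 mulr1.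
    by rewrite -KFf exprS mulrCA; apply: Kb.
  apply/funext => n; apply/nrm2_eq0/eqP; rewrite eq_le nrm2_ge0 andbT.
  apply: (@geometric_squeeze _ _ b (q ^+ 2)).
    by rewrite sqr_ge0 exprn_ilt1 ?(ltW q0).
  by move=> j; exact: l2le_pt (fj j).
pose c1 := (nrm2 (y *i : C) + c0) * 2 * ((1 - q)^-1 * c) ^+ 2.
have exist_sol f a : 0 <= a -> l2le f (a ^+ 2) ->
    exists u, l2le u (c1 * a ^+ 2) /\ forall n, D (x +i* y) u n = f n.
  move=> a0 fa.
  have cfa : l2le (fun n => c^-1%:C * f n) ((c^-1 * a) ^+ 2).
    by have := l2leZ c^-1%:C fa; rewrite nrm2_real exprMn.
  have ca0 : 0 <= c^-1 * a by rewrite mulr_ge0// invr_ge0 ltW.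
  have [w [wb wK]] := neumann sK q01 Kb ca0 cfa.
  exists (fun k => y *i * w k + P w k); split.
    have := l2leD2 (l2leZ (y *i) wb) (Pb _ _ wb); apply: l2leW.
    rewrite /c1; set t := nrm2 _.
    have : (c^-1 * a / (1 - q)) ^+ 2 <= ((1 - q)^-1 * c) ^+ 2 * a ^+ 2.
      rewrite -exprMn; apply: lerXn2r; rewrite ?nnegrE.
      - by rewrite divr_ge0// subr_ge0 ltW.
      - by rewrite !mulr_ge0// ?invr_ge0 ?subr_ge0 ltW.
      - have c_ge1 : 1 <= c by rewrite /c; lra.
        rewrite -mulrA [leRHS](_ : _ = c * (a / (1 - q))); last by ring.
        rewrite ler_wpM2r//; first by rewrite divr_ge0// subr_ge0 ltW.
        by apply: (@le_trans _ _ 1) => //; rewrite invf_le1.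
    have t0 : 0 <= t := nrm2_ge0 _.
    rewrite -[leRHS]mulrA; move: (((1 - q)^-1 * c) ^+ 2 * a ^+ 2) ((c^-1 * a / (1 - q)) ^+ 2) => X Y YX; nra.
  move=> n; rewrite fact//.
  by have := wK n; rewrite KE => /(mulfI ci0).
pose B f := xget (fun=> 0) [set u | l2 u /\ D (x +i* y) u = f]%classic.
have DE f g (a : C) n : D (x +i* y) (fun n => a * f n + g n) n =
    a * D (x +i* y) f n + D (x +i* y) g n.
  by rewrite /D (op_linear sA); ring.
have D_inj f g : l2 f -> l2 g -> D (x +i* y) f = D (x +i* y) g -> f = g.
  move=> f2 g2 fg.
  have : (fun n => (-1) * f n + g n) = fun=> 0.
    apply: uniq_sol => [|n]; last by rewrite DE fg; ring.
    have [b fb] := (l2P _).1 f2; have [b' gb] := (l2P _).1 g2.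
    by apply/l2P; eexists; apply: l2leD2 gb; exact: l2leZ fb.
  move=> /(congr1 (fun h => h _)) E; apply/funext => n; move: (E n).
  by rewrite mulN1r addrC => /eqP; rewrite subr_eq0 => /eqP.
have BP f : l2 f -> [/\ l2 (B f), D (x +i* y) (B f) = f &
    forall a, 0 <= a -> l2le f (a ^+ 2) -> l2le (B f) (c1 * a ^+ 2)].
  move=> f2; have [u [ub uf]] := exist_sol f _ (l2norm_ge0 f) (l2norm_sqr f2).
  have u2 : l2 u by apply/l2P; eexists; exact: ub.
  have [B2 DB] : [set u | l2 u /\ D (x +i* y) u = f]%classic (B f).
    by apply: (@xgetPex _ (fun=> 0)); exists u; split=> //; exact/funext.
  split=> // a a0 fa; have [v [vb vf]] := exist_sol f a a0 fa.
  rewrite (D_inj (B f) v)//; first by apply/l2P; eexists; exact: vb.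
  by rewrite DB; apply/esym/funext.
have l2lin (a : C) f g : l2 f -> l2 g -> l2 (fun n => a * f n + g n).
  move=> /l2P[b fb] /l2P[b' gb]; apply/l2P.
  by eexists; apply: l2leD2 gb; exact: l2leZ fb.
have c1_ge0 : 0 <= c1.
  apply: mulr_ge0; last exact: sqr_ge0.
  by apply: mulr_ge0 => //; apply: addr_ge0 => //; exact: nrm2_ge0.
exists B; split; last first.
  move=> psi psi2; split; first by have [_ + _] := BP _ psi2.
  have PD : D (x +i* y) psi = fun n => (- y) *i * psi n + P psi n.
    apply/funext => n; rewrite /D /P.
    have -> : x +i* y = x%:C + y *i by simpc.
    have -> : (- y) *i = - (y *i) :> C by simpc.
    by rewrite mul1r rmorphN/=; ring.
  have D2 : l2 (D (x +i* y) psi).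
    rewrite PD; apply: l2lin => //; have [b pb] := (l2P _).1 psi2.
    by apply/l2P; eexists; exact: Pb pb.
  by have [B2 DB _] := BP _ D2; apply: D_inj.
split.
- by move=> f /BP[].
- move=> a f g f2 g2; have [Bf2 DBf _] := BP _ f2; have [Bg2 DBg _] := BP _ g2.
  have [Bfg2 DBfg _] := BP _ (l2lin a f g f2 g2).
  apply: D_inj => //; first exact: l2lin.
  by rewrite DBfg; apply/funext => n; rewrite DE DBf DBg.
- exists (Num.sqrt c1) => f f2; have [Bf2 _ Bb] := BP _ f2.
  apply: l2norm_le; first by rewrite mulr_ge0 ?sqrtr_ge0 ?l2norm_ge0.
  by rewrite exprMn sqr_sqrtr//; apply: Bb; [exact: l2norm_ge0|exact: l2norm_sqr].
Qed.

End Resolvent.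

(** * The Schroedinger operator and its spectrum *)

Section Schroedinger.
Variables (R : realType) (d : nat).
Local Notation C := R[i].
Local Notation Z := 'rV[int]_d.
Local Notation Fun := (Z -> C).
Local Notation dir := (bool * 'I_d)%type.
Local Open Scope classical_set_scope.
Local Open Scope complex_scope.
Local Open Scope ring_scope.
Implicit Types (f g psi phi : Fun) (A K : Fun -> Fun) (e : dir).
Local Notation N f := (rip f f).

Definition step e : Z := if e.1 then delta_mx 0 e.2 else - delta_mx 0 e.2.

Lemma stepE e i : step e 0 i = if e.2 == i then (if e.1 then 1 else -1) else 0.
Proof.
rewrite /step; case: e => [[] j] /=; rewrite !mxE eqxx/= eq_sym; case: eqP => //.
Qed.

Lemma step_inj : injective step.
Proof.
move=> [b i] [b' j] eij; have := congr1 (fun v : Z => v 0 j) eij.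
have := congr1 (fun v : Z => v 0 i) eij; rewrite !stepE/= !eqxx eq_sym.
by case: eqP => [->|]; case: b {eij}; case: b'.
Qed.

Lemma norm1_eq1 (n : Z) : norm1 n = 1 <-> exists e, n = step e.
Proof.
split=> [n1|[e ->]]; last first.
  rewrite /norm1 (bigD1 e.2)//= big1 ?addr0 => [|j ej].
    by rewrite stepE eqxx; case: e.1.
  by rewrite stepE eq_sym (negbTE ej) normr0.
have [i ni] : exists i, n 0 i != 0.
  apply/existsP; rewrite -[X in is_true X]negbK negb_exists; apply/negP => /forallP h.
  move: n1; rewrite /norm1 big1// => i _.
  by have := h i; rewrite negbK => /eqP ->.
have ni1 : 1 <= `|n 0 i| by move: ni; lia.
have rest0 : 0 <= \sum_(j | j != i) `|n 0 j| by apply: sumr_ge0 => j _.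
move: n1; rewrite /norm1 (bigD1 i)//= => n1.
have nr : \sum_(j | j != i) `|n 0 j| = 0.
  by apply/eqP; rewrite eq_le rest0 andbT; move: n1 ni1; move: (\sum_(j | _) _) `|n 0 i| => x y; lia.
have nj j : j != i -> n 0 j = 0.
  move=> ji; apply/eqP; rewrite -normr_eq0; apply/eqP.
  by apply: (psumr_eq0P _ nr) => // k _; exact: normr_ge0.
move: n1; rewrite nr addr0 => n1.
exists (0 < n 0 i, i); apply/rowP => j; rewrite stepE /=.
by case: eqP => [<-|/eqP ij]; [move: (n 0 i) n1 => x; case: ifP; lia | apply: nj; rewrite eq_sym].
Qed.

Lemma laplacianE psi n : laplacian psi n = \sum_(e : dir) psi (n + step e).
Proof.
rewrite /laplacian -big_enum/=.
rewrite -(big_map (fun e => n + step e) xpredT psi) [RHS]fsbig_seq; last first.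
  by rewrite map_inj_uniq ?enum_uniq// => e e' /addrI/step_inj.
apply: eq_fsbigl; apply/seteqP; split=> m /=.
  by move=> /norm1_eq1[e me]; apply/mapP; exists e; rewrite ?mem_enum// -me addrC subrK.
by move=> /mapP[e _ ->]; apply/norm1_eq1; exists e; rewrite addrC addKr.
Qed.

Lemma finsupported_shift (v : Z) f : finsupported f -> finsupported (fun n => f (n + v)).
Proof.
move=> [s fs]; exists (map (fun n => n - v) s) => n ns; apply: fs.
by apply: contra ns => ns; apply/mapP; exists (n + v); rewrite ?addrK.
Qed.

Lemma rip_shift (v : Z) f g : rip (fun n => f (n + v)) g = rip f (fun n => g (n - v)).
Proof.
rewrite /rip /fsupp_sum [RHS](reindex_fsbigT (fun n => n + v)).
  by apply: eq_fsbigr => n _; rewrite addrK.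
by exists (fun n => n - v) => n; rewrite ?addrK ?subrK.
Qed.

Lemma finsupported_sum (I : eqType) (r : seq I) (F : I -> Fun) :
  (forall i, finsupported (F i)) -> finsupported (fun n => \sum_(i <- r) F i n).
Proof.
move=> Ff; elim: r => [|i r IH]; first by exists [::] => n _; rewrite big_nil.
have -> : (fun n => \sum_(j <- i :: r) F j n) = fun n => 1 * F i n + \sum_(j <- r) F j n.
  by apply/funext => n; rewrite big_cons mul1r.
exact: finsupported_lin.
Qed.

Lemma rip_sumr (I : eqType) (r : seq I) (F : I -> Fun) g :
  (forall i, finsupported (F i)) ->
  rip (fun n => \sum_(i <- r) F i n) g = \sum_(i <- r) rip (F i) g.
Proof.
move=> Ff; elim: r => [|i r IH].
  rewrite big_nil /rip (@fsupp_sumE _ _ _ [::]) ?big_nil// => n _.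
  by rewrite big_nil /rdot/= !mul0r addr0.
have -> : (fun n => \sum_(j <- i :: r) F j n) = fun n => F i n + \sum_(j <- r) F j n.
  by apply/funext => n; rewrite big_cons.
by rewrite ripDl ?IH ?big_cons//; exact: finsupported_sum.
Qed.

Lemma laplacian_sym f g : finsupported f -> finsupported g ->
  rip (laplacian f) g = rip f (laplacian g).
Proof.
have lapE (h : Fun) : laplacian h = fun n => \sum_(e <- index_enum dir) h (n + step e).
  by apply/funext => n; exact: laplacianE.
move=> ff fg; rewrite !lapE rip_sumr => [|e]; last exact: finsupported_shift.
rewrite [RHS]ripC rip_sumr => [|e]; last exact: finsupported_shift.
rewrite [RHS](reindex_inj (h := fun e : dir => (~~ e.1, e.2)))/=; last first.
  by move=> [b i] [b' j] [/negb_inj -> ->].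
apply: eq_bigr => -[b i] _; rewrite rip_shift [RHS]ripC; congr rip.
by apply/funext => n; congr g; case: b; rewrite /step/= ?opprK.
Qed.

Variable V : Z -> R.
Local Notation H := (schrodinger V).

Lemma schrodinger_symop : symop H.
Proof.
split.
- move=> a f g n; rewrite /schrodinger !laplacianE big_split/= -mulr_sumr; ring.
- move=> f ff.
  have lapE : H f = fun n => 1 * (\sum_(e <- index_enum dir) f (n + step e)) + (V n)%:C * f n.
    by apply/funext => n; rewrite /schrodinger laplacianE mul1r.
  rewrite lapE; apply: finsupported_lin.
    by apply: finsupported_sum => e; exact: finsupported_shift.
  by have [s fs] := ff; exists s => n /fs ->; rewrite mulr0.
- move=> n; exists (n :: [seq n + step e | e <- enum {: dir}]) => f g fg.
  rewrite /schrodinger !laplacianE (fg n) ?mem_head//; congr (_ + _).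
  apply: eq_bigr => e _; apply: fg; rewrite inE; apply/orP; right.
  by apply: map_f; rewrite mem_enum.
- move=> f g ff fg.
  have Vf (h : Fun) : finsupported h -> finsupported (fun n => (V n)%:C * h n).
    by move=> [s hs]; exists s => n /hs ->; rewrite mulr0.
  have lapf (h : Fun) : finsupported h -> finsupported (laplacian h).
    move=> fh; have -> : laplacian h = fun n => \sum_(e <- index_enum dir) h (n + step e).
      by apply/funext => n; exact: laplacianE.
    by apply: finsupported_sum => e; exact: finsupported_shift.
  have HE h k : finsupported h ->
      rip (H h) k = rip (laplacian h) k + rip (fun n => (V n)%:C * h n) k.
    by move=> fh; rewrite -ripDl; [|exact: lapf|exact: Vf].
  rewrite HE// [RHS]ripC HE// laplacian_sym// ripC; congr (_ + _).
  rewrite [RHS]ripC; congr fsupp_sum; apply/funext => n.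
  by rewrite rdotZl [RHS]rdotC rdotZl rdotC.
Qed.

Lemma rip_shift_norm (v : Z) f : N (fun n => f (n + v)) = N f.
Proof. by rewrite rip_shift; congr rip; apply/funext => n; rewrite subrK. Qed.

Lemma ripD2_le f g : finsupported f -> finsupported g ->
  N (fun n => f n + g n) <= 2 * N f + 2 * N g.
Proof.
move=> [s1 fs] [s2 gs]; pose s := s1 ++ s2.
have fs' n : n \notin s -> f n = 0 by rewrite mem_cat negb_or => /andP[/fs].
have gs' n : n \notin s -> g n = 0 by rewrite mem_cat negb_or => /andP[_ /gs].
rewrite (rip_sum fs') (rip_sum gs') (@rip_sum _ _ _ s); last first.
  by move=> n sn; rewrite fs'// gs'// addr0.
by rewrite !mulr_sumr -big_split/=; apply: ler_sum => n _; exact: nrm2D_le.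
Qed.

Variable vmax : R.
Hypothesis Vbound : forall n, `|V n| <= vmax.

Lemma schrodinger_bounded (x : R) : exists2 c0, 0 <= c0 &
  forall f, finsupported f -> N (fun n => 1%:C * H f n + (- x)%:C * f n) <= c0 * N f.
Proof.
have lap (r : seq dir) : exists2 c0, 0 <= c0 &
    forall f, finsupported f -> N (fun n => \sum_(e <- r) f (n + step e)) <= c0 * N f.
  elim: r => [|e r [c0 c00 IH]].
    exists 0 => // f ff; rewrite mul0r (_ : (fun _ => _) = fun=> 0) ?rip0l//.
    by apply/funext => n; rewrite big_nil.
  exists (2 + 2 * c0) => [|f ff]; first by rewrite addr_ge0// mulr_ge0.
  have -> : (fun n => \sum_(j <- e :: r) f (n + step j)) =
      fun n => f (n + step e) + \sum_(j <- r) f (n + step j).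
    by apply/funext => n; rewrite big_cons.
  apply: le_trans (ripD2_le _ _) _; first exact: finsupported_shift.
    by apply: finsupported_sum => j; exact: finsupported_shift.
  by rewrite rip_shift_norm; have := IH f ff; lra.
have [c0 c00 lapc] := lap (index_enum dir).
have vm2 := sqr_ge0 (vmax + `|x|).
exists (2 * c0 + 2 * (vmax + `|x|) ^+ 2) => [|f ff].
  by apply: addr_ge0; apply: mulr_ge0.
have -> : (fun n => 1%:C * H f n + (- x)%:C * f n) =
    fun n => (\sum_(e <- index_enum dir) f (n + step e)) + (V n - x)%:C * f n.
  by apply/funext => n; rewrite /schrodinger laplacianE rmorphN rmorphB/=; ring.
have fW : finsupported (fun n => (V n - x)%:C * f n).
  by have [s fs] := ff; exists s => n /fs ->; rewrite mulr0.
apply: le_trans (ripD2_le _ fW) _.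
  by apply: finsupported_sum => j; exact: finsupported_shift.
suff : N (fun n => (V n - x)%:C * f n) <= (vmax + `|x|) ^+ 2 * N f.
  by have := lapc f ff; lra.
have [s fs] := ff; rewrite (rip_sum fs) (@rip_sum _ _ _ s); last first.
  by move=> n /fs ->; rewrite mulr0.
rewrite mulr_sumr; apply: ler_sum => n _; rewrite nrm2M nrm2_real.
rewrite ler_wpM2r ?nrm2_ge0// -real_normK ?num_real//.
apply: lerXn2r; rewrite ?nnegrE ?normr_ge0//.
  by apply: le_trans (normr_ge0 (V n)) (le_trans (Vbound n) _); rewrite lerDl.
by apply: le_trans (ler_normB _ _) _; rewrite lerD2r.
Qed.

Lemma spectrum_real z : spectrum H z -> complex.Im z = 0.
Proof.
case: z => x y zspec /=; apply: contrapT => /eqP y0; apply: zspec.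
have [c0 c00 up] := schrodinger_bounded x.
apply: (@resolvent_of_lower_bound _ _ H x y c0 (y ^+ 2)) => //.
- exact: schrodinger_symop.
- by rewrite exprn_even_gt0//= y0.
- by move=> f ff; rewrite lerDr rip_ge0.
Qed.

Lemma rip_comb_sqr (r : R) f g : finsupported f -> finsupported g ->
  N (fun n => 1%:C * f n + r%:C * g n) = N f + 2 * r * rip f g + r ^+ 2 * N g.
Proof.
move=> ff fg; rewrite rip_comb// [rip f (fun _ => _)]ripC [rip g (fun _ => _)]ripC.
by rewrite !rip_comb// [rip g f]ripC; ring.
Qed.

(** The sign [s] selects the edge. With [D = s b - s c] the hypothesis says that
    [- s (H - b)] has form at least [D > 0], and
    [|(H - b) f|^2 = |(H - b) f + s D f|^2 - 2 s D <(H - b) f, f> - D^2 |f|^2]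
    is then at least [D^2 |f|^2]. *)
Lemma resolvent_outside_form_range (b c s : R) : s ^+ 2 = 1 ->
  s * c < s * b ->
  (forall f, finsupported f -> s * rip (H f) f <= s * c * N f) ->
  resolvent_set H b%:C.
Proof.
move=> s2 cb form; have [c0 c00 up] := schrodinger_bounded b.
have db : 0 < s * b - s * c by rewrite subr_gt0.
apply: (@resolvent_of_lower_bound _ _ H b 0 c0 ((s * b - s * c) ^+ 2)) => //.
- exact: schrodinger_symop.
- by rewrite exprn_gt0.
- move=> f ff; rewrite expr0n mul0r addr0.
  have fHf := op_finsupported schrodinger_symop ff.
  pose g n := 1%:C * H f n + (- b)%:C * f n.
  have fg : finsupported g by apply: finsupported_lin => //; exact: finsupportedZ.
  have gf : rip g f = rip (H f) f - b * N f by rewrite rip_comb//; ring.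
  have := rip_ge0 (fun n => 1%:C * g n + (s * (s * b - s * c))%:C * f n).
  rewrite rip_comb_sqr// gf -/g; have := form f ff; move: (rip (H f) f) (N f) (N g) (rip_ge0 f) => h a gg a0 hs pos.
  set D := s * b - s * c in db pos *.
  have sD : (s * D) * (s * D) = D ^+ 2 by rewrite mulrACA -expr2 s2 mul1r.
  have : D * (s * h - s * c * a) <= 0 by rewrite pmulr_rle0// subr_le0.
  have : s * b = D + s * c by rewrite /D subrK.
  move=> sb h1.
  have : gg + 2 * (s * D) * (h - b * a) + D ^+ 2 * a >= 0.
    by rewrite -sD; lra.
  have -> : 2 * (s * D) * (h - b * a) = 2 * (D * (s * h - s * b * a)) by ring.
  rewrite sb => h3.
  have : D * (s * h - (D + s * c) * a) = D * (s * h - s * c * a) - D ^+ 2 * a by ring.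
  move=> h4; lra.
Qed.

Lemma spectrum_above b c : spectrum H b%:C -> c < b ->
  exists2 f, finsupported f & c * N f < rip (H f) f.
Proof.
move=> sb cb; apply: contrapT => none; apply: sb.
apply: (@resolvent_outside_form_range b c 1); rewrite ?expr1n ?mul1r// => f ff.
by rewrite !mul1r leNgt; apply/negP => h; apply: none; exists f.
Qed.

Lemma spectrum_below a c : spectrum H a%:C -> a < c ->
  exists2 f, finsupported f & rip (H f) f < c * N f.
Proof.
move=> sa ac; apply: contrapT => none; apply: sa.
apply: (@resolvent_outside_form_range a c (-1)).
- by rewrite sqrrN expr1n.
- by rewrite !mulN1r ltrN2.
- move=> f ff; rewrite !mulN1r mulNr lerN2 leNgt; apply/negP => h.
  by apply: none; exists f.
Qed.

End Schroedinger.

Section BoundedEigenfunctions.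
Variables (R : realType) (d : nat).
Local Notation C := R[i].
Local Notation Z := 'rV[int]_d.
Local Notation Fun := (Z -> C).
Local Notation dir := (bool * 'I_d)%type.
Local Open Scope complex_scope.
Implicit Types (f g psi phi : Fun).

Definition exp_weight (t : R) (n : Z) : R := \prod_i t ^+ `|n 0%R i|%N.

Lemma exp_weight_gt0 (t : R) (n : Z) : 0 < t -> 0 < exp_weight t n.
Proof. by move=> t0; apply: prodr_gt0 => i _; rewrite exprn_gt0. Qed.

Lemma sum_uniq_le (I : finType) (G : I -> R) (s : seq I) : (forall i, 0 <= G i) ->
  uniq s -> \sum_(i <- s) G i <= \sum_i G i.
Proof.
move=> G0 us; rewrite big_uniq//= [leRHS](bigID (mem s))/= lerDl.
by apply: sumr_ge0.
Qed.

Lemma geometric_sum_le (r : R) K : 0 < r < 1 -> \sum_(j < K) r ^+ j <= (1 - r)^-1.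
Proof.
move=> /andP[r0 r1]; have r1' : 0 < 1 - r by rewrite subr_gt0.
rewrite -[leRHS]mul1r ler_pdivlMr// mulrC.
have := subrX1 r K => /(congr1 -%R); rewrite opprB -mulNr opprB => <-.
by rewrite lerBlDr lerDl exprn_ge0// ltW.
Qed.

(** Sending each coordinate to its sign and its modulus embeds a finite set of
    points in a product of finite sets, over which the sum of the weights is a
    product of geometric sums. *)
Lemma exp_weight_summable (t : R) (s : seq Z) : 0 < t < 1 -> uniq s ->
  \sum_(n <- s) exp_weight t n <= (2 * (1 - t)^-1) ^+ d.
Proof.
move=> t01 us; have /andP[t0 t1] := t01.
pose K := \max_(n <- s) \max_i `|n 0%R i|%N.
have ltK n i : n \in s -> (`|n 0%R i| < K.+1)%N.
  move=> ns; rewrite ltnS /K; apply: leq_trans (leq_bigmax_seq _ ns isT).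
  exact: leq_bigmax.
pose code (n : Z) : {ffun 'I_d -> bool * 'I_K.+1} :=
  [ffun i => (n 0 i < 0, inord `|n 0%R i|%N)].
pose G (y : {ffun 'I_d -> bool * 'I_K.+1}) : R := \prod_i t ^+ (y i).2.
have -> : \sum_(n <- s) exp_weight t n = \sum_(y <- map code s) G y.
  rewrite big_map; apply: eq_big_seq => n ns; apply: eq_bigr => i _.
  by rewrite ffunE/= inordK ?ltK.
have uc : uniq (map code s).
  rewrite map_inj_in_uniq// => n n' ns ns' /ffunP cnn'; apply/rowP => i.
  have := cnn' i; rewrite !ffunE => -[sgn /(congr1 val)/=].
  by rewrite !inordK ?ltK//; lia.
apply: le_trans (sum_uniq_le _ uc) _.
  by move=> y; apply: prodr_ge0 => i _; rewrite exprn_ge0// ltW.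
rewrite /G -(bigA_distr_bigA (fun (i : 'I_d) (p : bool * 'I_K.+1) => t ^+ p.2)).
rewrite prodr_const card_ord; apply: lerXn2r; rewrite ?nnegrE.
- by apply: sumr_ge0 => p _; rewrite exprn_ge0// ltW.
- by rewrite mulr_ge0// invr_ge0 subr_ge0 ltW.
rewrite -(pair_bigA _ (fun (b : bool) (j : 'I_K.+1) => t ^+ j))/= big_bool/=.
by have := @geometric_sum_le t K.+1 t01; lra.
Qed.

Lemma exp_weight_step (t : R) (n : Z) (e : dir) : 0 < t < 1 ->
  `|exp_weight t (n + step e) - exp_weight t n| <=
     (t^-1 - 1) * exp_weight t (n + step e).
Proof.
move=> /andP[t0 t1].
have tinv : 1 < t^-1 by rewrite invf_gt1.
have rest : \prod_(i | i != e.2) t ^+ `|(n + step e)%R 0%R i|%N =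
    \prod_(i | i != e.2) t ^+ `|n 0%R i|%N.
  by apply: eq_bigr => i ie; rewrite mxE stepE eq_sym (negbTE ie) addr0.
rewrite /exp_weight (bigD1 e.2)//= [X in `|_ - X|](bigD1 e.2)//= rest.
set P := \prod_(i | _) _; have P0 : 0 < P by apply: prodr_gt0 => i _; rewrite exprn_gt0.
rewrite -mulrBl normrM (gtr0_norm P0) mulrA ler_pM2r//.
have : (`|(n + step e)%R 0%R e.2| = `|n 0%R e.2|.+1)%N \/
       (`|n 0%R e.2| = `|(n + step e)%R 0%R e.2|.+1)%N.
  by rewrite mxE stepE eqxx; move: (n 0 e.2) => x; case: e.1 => /=; lia.
have tk k : 0 < t ^+ k by rewrite exprn_gt0.
case=> ->; rewrite exprS; [move: (tk `|n 0%R e.2|%N)|move: (tk `|(n + step e)%R 0%R e.2|%N)];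
  move: (t ^+ _) => x x0.
  rewrite ler0_norm ?subr_le0 ?ler_piMl ?(ltW x0) ?(ltW t1)// mulrA mulrBl mul1r.
  by rewrite mulVf ?gt_eqF// opprB mulrBl mul1r.
rewrite ger0_norm ?subr_ge0 ?ler_piMl ?(ltW x0) ?(ltW t1)//.
have : 0 <= (t^-1 - 1) - (1 - t).
  have -> : t^-1 - 1 - (1 - t) = (1 - t) ^+ 2 / t by field; rewrite gt_eqF.
  by rewrite divr_ge0 ?sqr_ge0 ?ltW.
by rewrite subr_ge0 => h; rewrite -{1}[x]mul1r -mulrBl ler_pM2r.
Qed.

Lemma l2le_sum_triangle (r : seq dir) (F : dir -> Fun) a : 0 <= a ->
  (forall e, l2le (F e) (a ^+ 2)) ->
  l2le (fun n => \sum_(e <- r) F e n) (((size r)%:R * a) ^+ 2).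
Proof.
move=> a0 Fa; elim: r => [|e r IH].
  by move=> s us; rewrite big1 ?sqr_ge0// => n _; rewrite big_nil nrm20.
have -> : (fun n => \sum_(j <- e :: r) F j n) = fun n => F e n + \sum_(j <- r) F j n.
  by apply/funext => n; rewrite big_cons.
rewrite /= -natr1 mulrDl mul1r [X in X ^+ 2]addrC.
by apply: l2le_triangle => //; rewrite mulr_ge0.
Qed.

(** The functions [t^|n| psi(n)] are square summable, and applying [H - z] to
    them multiplies the norm by [O(t^-1 - 1)] at most, because neighbouring
    values of the weight have a ratio close to 1; so [H - z] has no bounded
    inverse. *)
Lemma bounded_eigenfunction_spectrum (V : Z -> R) psi (z : C) (b : R) :
  (forall n, nrm2 (psi n) <= b) -> (forall n, schrodinger V psi n = z * psi n) ->
  (exists n, psi n != 0) -> spectrum (schrodinger V) z.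
Proof.
move=> psib eig [n0 psi0] [B [[_ _ [c Bc]] Binv]].
pose k : R := (size (index_enum dir))%:R.
pose w (t : R) n : C := (exp_weight t n)%:C * psi n.
have w2 t : 0 < t < 1 -> l2 (w t).
  move=> t01; have /andP[t0 t1] := t01.
  apply/l2P; exists ((2 * (1 - t)^-1) ^+ d * b) => s us.
  have b0 : 0 <= b := le_trans (nrm2_ge0 _) (psib 0).
  apply: le_trans (_ : \sum_(n <- s) exp_weight t n * b <= _).
    apply: ler_sum => n _; rewrite nrm2M nrm2_real ler_pM ?sqr_ge0 ?nrm2_ge0//.
    have e0 := ltW (exp_weight_gt0 n t0).
    rewrite expr2 ler_piMl//; apply: prodr_ile1 => i _.
    by rewrite exprn_ge0 ?exprn_ile1 ?ltW.
  by rewrite -mulr_suml ler_wpM2r// exp_weight_summable.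
have Hw t : 0 < t < 1 ->
    l2le (fun n => schrodinger V (w t) n - z * w t n)
         ((k * ((t^-1 - 1) * l2norm (w t))) ^+ 2).
  move=> t01; have /andP[t0 t1] := t01.
  have tinv : 0 <= t^-1 - 1 by rewrite subr_ge0 ltW// invf_gt1.
  pose F (e : dir) n : C := (exp_weight t (n + step e) - exp_weight t n)%:C * psi (n + step e).
  have -> : (fun n => schrodinger V (w t) n - z * w t n) =
      fun n => \sum_(e <- index_enum dir) F e n.
    apply/funext => n; rewrite /F; under [RHS]eq_bigr do rewrite rmorphB/= mulrBl.
    rewrite [RHS]big_split/= sumrN -mulr_sumr -(laplacianE psi).
    have E := eig n; rewrite /schrodinger in E; rewrite /schrodinger (laplacianE (w t)).
    have -> : z * w t n = (exp_weight t n)%:C * (laplacian psi n + (V n)%:C * psi n).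
      by rewrite E /w mulrCA.
    by rewrite /w; ring.
  apply: l2le_sum_triangle => [|e]; first by rewrite mulr_ge0 ?l2norm_ge0.
  move=> s us.
  have : \sum_(n <- s) nrm2 (F e n) <=
      (t^-1 - 1) ^+ 2 * \sum_(n <- [seq n + step e | n <- s]) nrm2 (w t n).
    rewrite big_map mulr_sumr; apply: ler_sum => n _.
    rewrite /F /w !nrm2M !nrm2_real mulrA ler_wpM2r ?nrm2_ge0// -exprMn.
    rewrite -real_normK ?num_real//; apply: lerXn2r; rewrite ?nnegrE ?normr_ge0//.
      by rewrite mulr_ge0// ltW// exp_weight_gt0.
    exact: exp_weight_step.
  move=> /le_trans; apply; rewrite exprMn ler_wpM2l ?sqr_ge0//.
  apply: l2norm_sqr; first exact: w2.
  by rewrite map_inj_uniq// => x y /addIr.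
have wpos t : 0 < t < 1 -> 0 < l2norm (w t).
  move=> t01; have /andP[t0 t1] := t01.
  rewrite lt_neqAle l2norm_ge0 andbT eq_sym; apply/eqP => w0.
  have := l2le_pt n0 (l2norm_sqr (w2 t t01)); rewrite w0 expr0n/= => wn.
  have : w t n0 = 0 by apply/nrm2_eq0/eqP; rewrite eq_le wn nrm2_ge0.
  move=> /eqP; rewrite mulf_eq0 (negbTE psi0) orbF => /eqP[] /eqP.
  by rewrite gt_eqF// exp_weight_gt0.
have ineq t : 0 < t < 1 -> 1 <= `|c| * (k * (t^-1 - 1)).
  move=> t01; have /andP[t0 t1] := t01.
  have tinv : 0 <= t^-1 - 1 by rewrite subr_ge0 ltW// invf_gt1.
  have k0 : 0 <= k by rewrite ler0n.
  have D2 : l2 (fun n => schrodinger V (w t) n - z * w t n) by apply/l2P; eexists; exact: Hw.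
  have := Bc _ D2; rewrite (Binv _ (w2 t t01)).2 => h.
  have : l2norm (w t) <= `|c| * (k * ((t^-1 - 1) * l2norm (w t))).
    apply: le_trans h _; apply: le_trans (ler_wpM2r (l2norm_ge0 _) (ler_norm c)) _.
    apply: ler_wpM2l => //; apply: l2norm_le (Hw t t01).
    by rewrite !mulr_ge0 ?l2norm_ge0.
  rewrite [X in _ <= X](_ : _ = `|c| * (k * (t^-1 - 1)) * l2norm (w t)); last by ring.
  by rewrite -{1}[l2norm _]mul1r ler_pM2r// wpos.
(* At [t = (1 + y)^-1] the factor [t^-1 - 1 = y] is too small for [ineq]. *)
pose y := (2 * (`|c| * k + 1))^-1.
have ck0 : 0 <= `|c| * k by rewrite mulr_ge0 ?ler0n.
have y0 : 0 < y by rewrite invr_gt0; lra.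
have := ineq (1 + y)^-1; rewrite invrK.
have -> : `|c| * (k * (1 + y - 1)) = `|c| * k * y by ring.
have h : 0 < (1 + y)^-1 < 1 by rewrite invr_gt0 invf_lt1; lra.
move=> /(_ h); apply/negP; rewrite -ltNge /y ltr_pdivrMr; lra.
Qed.

End BoundedEigenfunctions.

(** * Floquet-Bloch matrices *)

Section FloquetMatrices.
Variables (R : realType) (d : nat).
Local Notation C := R[i].
Local Notation cj := (@Num.conj C).
Local Notation Z := 'rV[int]_d.
Local Notation Fun := (Z -> C).
Local Notation dir := (bool * 'I_d)%type.
Local Open Scope complex_scope.
Local Open Scope sesquilinear_scope.
Local Open Scope ring_scope.
Implicit Types (x y : 'I_d -> R) (f : Fun).

(** The symbol of the Laplacian. *)
Definition dispersion x : R := 2 * \sum_i cos (x i).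

Lemma sum_plane_wave_step y : \sum_(e : dir) plane_wave y (step e) = (dispersion y)%:C.
Proof.
rewrite -(pair_bigA _ (fun b i => plane_wave y (step (b, i))))/= big_bool/= -big_split/=.
rewrite /dispersion mulr_sumr rmorph_sum; apply: eq_bigr => i _.
have dotE (b : bool) : dot y (step (b, i)) = (if b then 1 else -1) * y i.
  rewrite /dot (bigD1 i)//= big1 ?addr0 => [|j ji].
    by rewrite stepE eqxx/=; case: b; rewrite ?mulr1 ?mul1r// mulrN1 mulN1r.
  by rewrite stepE/= eq_sym (negbTE ji) mulr0.
rewrite /plane_wave !dotE mul1r mulN1r /expi cosN sinN.
by apply/eqP; rewrite eq_complex/=; apply/andP; split; apply/eqP; ring.
Qed.

Variables (m : nat) (G : set Z).
Hypothesis GM : forall k : Z, G (k *+ m.+1).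
Variable V : Z -> R.
Hypothesis VG : lattice_periodic G V.
Local Notation M := (m.+1).
Local Notation J := {ffun 'I_d -> 'I_m.+1}.
Local Notation DF := (dual_freqs R m G).
Local Notation N := #|DF|.
Local Notation fr i := (freq R (@enum_val _ (mem DF) i)).

Definition shifted x (i : 'I_N) (j : 'I_d) : R := x j + fr i j.

Definition potential_mx : 'M[C]_N := \matrix_(i, j)
  ((M ^ d)%:R^-1 * \sum_(q : J) (V (box_point q))%:C *
     (plane_wave (fr i) (box_point q) * cj (plane_wave (fr j) (box_point q)))).

(** [H - c] on the Bloch functions of quasi-momentum [x], in the basis of plane
    waves. *)
Definition floquet_mx x (c : R) : 'M[C]_N :=
  diag_mx (\row_i (dispersion (shifted x i) - c)%:C) + potential_mx.

Lemma mul_potential_mx (v : 'rV[C]_N) :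
  v *m potential_mx =
    \row_j fourier_coef (fun n => (V n)%:C * synth v n) (enum_val j).
Proof.
apply/rowP => j; rewrite !mxE /fourier_coef.
under eq_bigr do rewrite mxE mulrCA mulr_sumr.
rewrite -mulr_sumr exchange_big/=; congr (_ * _); apply: eq_bigr => q _.
rewrite /synth mulr_sumr mulr_suml; apply: eq_bigr => i _; ring.
Qed.

Lemma synthZ (a : C) (v : 'rV[C]_N) n : synth (a *: v) n = a * synth v n.
Proof. by rewrite /synth mulr_sumr; apply: eq_bigr => i _; rewrite mxE mulrA. Qed.

Lemma mxform_floquet x c v : mxform (floquet_mx x c) v =
  (\sum_i (dispersion (shifted x i) - c) * nrm2 (v 0 i) +
   (M ^ d)%:R^-1 * \sum_(q : J) V (box_point q) * nrm2 (synth v (box_point q)))%:C.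
Proof.
rewrite mxformD mxform_diag rmorphD/= rmorph_sum/=; congr (_ + _).
  by apply: eq_bigr => i _; rewrite mxE rmorphM/= nrm2C.
rewrite /mxform mul_potential_mx mxE rmorphM/= fmorphV rmorph_nat rmorph_sum/=.
rewrite /fourier_coef; under eq_bigr do rewrite !mxE -mulrA mulr_suml.
rewrite -mulr_sumr exchange_big/=; congr (_ * _); apply: eq_bigr => q _.
rewrite rmorphM/= nrm2C normCK {3}/synth rmorph_sum/= !mulr_sumr.
by apply: eq_bigr => j _; rewrite rmorphM/= -mulr_sumr -/(synth v _); ring.
Qed.

Lemma floquet_hermitian x c : floquet_mx x c \is hermsymmx.
Proof.
apply/is_hermitianmxP; rewrite expr0 scale1r; apply/matrixP => i j; rewrite !mxE.
rewrite [RHS](rmorphD cj)/=; congr (_ + _).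
  rewrite eq_sym; case: eqP => [->|_]; last by rewrite !mulr0n rmorph0.
  by rewrite !mulr1n; apply/esym/conjc_real.
rewrite [RHS](rmorphM cj)/= (fmorphV cj) (rmorph_nat cj) (rmorph_sum cj)/=.
congr (_ * _); apply: eq_bigr => q _.
rewrite !(rmorphM cj)/= conjCK [X in _ = X * _](conjc_real (V _)).
by congr (_ * _); rewrite mulrC.
Qed.

Lemma bloch_wave x c v : v *m floquet_mx x c = 0 ->
  forall n, schrodinger V (fun n => plane_wave x n * synth v n) n =
    c%:C * (plane_wave x n * synth v n).
Proof.
move=> vQ n.
have Vsynth : (V n)%:C * synth v n = synth (v *m potential_mx) n.
  rewrite mul_potential_mx -(synth_series GM (f := fun n => (V n)%:C * synth v n))//.
  move=> a Ga k; rewrite (synth_periodic v Ga) ?VG//.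
have lap : laplacian (fun n => plane_wave x n * synth v n) n =
    plane_wave x n * synth (v *m diag_mx (\row_i (dispersion (shifted x i))%:C)) n.
  rewrite laplacianE /synth; under eq_bigr do rewrite mulr_sumr.
  rewrite exchange_big/= mulr_sumr; apply: eq_bigr => i _.
  rewrite mul_mx_diag !mxE -sum_plane_wave_step !(mulr_sumr, mulr_suml).
  apply: eq_bigr => e _; rewrite !plane_waveD (plane_waveDl x (fr i)); ring.
rewrite /schrodinger lap mulrCA Vsynth -mulrDr mulrCA; congr (_ * _).
rewrite -synthZ /synth -big_split/=; apply: eq_bigr => i _.
rewrite -mulrDl; congr (_ * _).
move: vQ; rewrite /floquet_mx mulmxDr !mul_mx_diag.
move: (v *m potential_mx) => W /rowP/(_ i); rewrite !mxE rmorphB/= => h.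
by apply/eqP; rewrite -subr_eq0; apply/eqP; rewrite -[RHS]h; ring.
Qed.

Lemma bloch_spectrum x c (v : 'rV[C]_N) : v != 0 -> v *m floquet_mx x c = 0 ->
  spectrum (schrodinger V) c%:C.
Proof.
move=> v0 vQ; pose b : R := (\sum_i Normc.normc (v 0 i)) ^+ 2.
have normpw y n : Normc.normc (plane_wave y n : C) = 1.
  by have := norm_expi (dot y n); rewrite /plane_wave => -[].
apply: (@bounded_eigenfunction_spectrum _ _ V (fun n => plane_wave x n * synth v n) _ b).
- move=> n; rewrite -nrm2E Normc.normcM normpw mul1r.
  have normc_ge0 (z : C) : 0 <= Normc.normc z by case: z => ? ?; exact: sqrtr_ge0.
  apply: lerXn2r; rewrite ?nnegrE ?sumr_ge0//.
  rewrite /synth.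
  apply: (@le_trans _ _ (\sum_i Normc.normc (v 0 i * plane_wave (fr i) n))).
    apply: (big_ind2 (fun (z : C) (r : R) => Normc.normc z <= r)).
    - by rewrite Normc.normc0.
    - by move=> z r z' r' zr zr'; apply: le_trans (le_normcD _ _) _; exact: lerD.
    - by [].
  by apply: ler_sum => i _; rewrite Normc.normcM normpw mulr1.
- exact: bloch_wave.
- apply: contrapT => none; move/eqP: v0; apply; apply: synth_eq0 => n.
  apply: contrapT => /eqP sn; apply: none; exists n; rewrite mulf_neq0//.
  by rewrite -normr_eq0 norm_expi oner_eq0.
Qed.

Variable vmax : R.
Hypothesis Vbound : forall n, `|V n| <= vmax.

Lemma sqnorm_nrm2 (v : 'rV[C]_N) : sqnorm v = (\sum_i nrm2 (v 0 i))%:C.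
Proof. by rewrite rmorph_sum/=; apply: eq_bigr => i _; rewrite nrm2C. Qed.

Lemma potential_form_bound (v : 'rV[C]_N) :
  `|(M ^ d)%:R^-1 * \sum_(q : J) V (box_point q) * nrm2 (synth v (box_point q))| <=
    vmax * \sum_i nrm2 (v 0 i).
Proof.
have Md0 : 0 < (M ^ d)%:R :> R by rewrite ltr0n expn_gt0.
have P : \sum_(q : J) nrm2 (synth v (box_point q)) = (M ^ d)%:R * \sum_i nrm2 (v 0 i).
  apply: complexI; rewrite rmorphM/= -sqnorm_nrm2 rmorph_nat -synth_parseval rmorph_sum/=.
  by apply: eq_bigr => q _; rewrite nrm2C.
rewrite normrM gtr0_norm ?invr_gt0// ler_pdivrMl// mulrCA -P mulr_sumr.
apply: le_trans (ler_norm_sum _ _ _) _; apply: ler_sum => q _.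
by rewrite normrM (ger0_norm (nrm2_ge0 _)) ler_wpM2r ?nrm2_ge0.
Qed.

Lemma supported_vector (I : {set 'I_N}) : exists B : 'M[C]_N, \rank B = #|I| /\
  forall v : 'rV_N, (v <= B)%MS -> forall i, i \notin I -> v 0 i = 0.
Proof.
have u1 : (1%:M : 'M[C]_N) \is unitarymx.
  by apply/unitarymxP; rewrite trmx1 map_mx1 mulmx1.
have [B [rB BI]] := rows_span I u1; exists B; split=> // v /BI[w ->].
by rewrite mulmx1.
Qed.

Lemma weighted_sum_gt0 (I : {set 'I_N}) (a : 'I_N -> R) (v : 'rV[C]_N) :
  (forall i, i \in I -> 0 < a i) -> (forall i, i \notin I -> v 0 i = 0) -> v != 0 ->
  0 < \sum_i a i * nrm2 (v 0 i).
Proof.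
move=> aI vI v0; have term i : 0 <= a i * nrm2 (v 0 i).
  have [iI|/vI->] := boolP (i \in I); last by rewrite nrm20 mulr0.
  by rewrite mulr_ge0 ?nrm2_ge0// ltW// aI.
rewrite lt_neqAle sumr_ge0// andbT eq_sym psumr_eq0//.
apply: contra v0 => /allP h; apply/eqP/rowP => i; rewrite mxE.
have [iI|/vI//] := boolP (i \in I).
have := h i (mem_index_enum i); rewrite /= mulf_eq0 gt_eqF ?aI//= => /eqP.
exact: nrm2_eq0.
Qed.

Lemma floquet_positive x c :
  has_positive_subspace (floquet_mx x c) #|[set i | dispersion (shifted x i) > c + vmax]|.
Proof.
set I := [set i | _]; have [B [rB BI]] := supported_vector I.
exists B; split; first by rewrite rB.
move=> v v0 /BI vI; rewrite mxform_floquet ltcR.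
have /(weighted_sum_gt0 (a := fun i => dispersion (shifted x i) - c - vmax)) :
    forall i, i \in I -> 0 < dispersion (shifted x i) - c - vmax.
  by move=> i; rewrite inE => ?; rewrite -addrA -opprD subr_gt0.
move=> /(_ v vI v0); have := potential_form_bound v.
under [X in _ -> 0 < X -> _]eq_bigr do rewrite mulrBl.
rewrite sumrB -mulr_sumr ler_norml => /andP[+ _]; lra.
Qed.

Lemma floquet_negative x c :
  has_positive_subspace (- floquet_mx x c) #|[set i | dispersion (shifted x i) < c - vmax]|.
Proof.
set I := [set i | _]; have [B [rB BI]] := supported_vector I.
exists B; split; first by rewrite rB.
move=> v v0 /BI vI; rewrite mxformN mxform_floquet oppr_gt0 ltcR.
have /(weighted_sum_gt0 (a := fun i => c - dispersion (shifted x i) - vmax)) :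
    forall i, i \in I -> 0 < c - dispersion (shifted x i) - vmax.
  by move=> i; rewrite inE => ?; rewrite addrAC subr_gt0.
move=> /(_ v vI v0); have := potential_form_bound v.
under [X in _ -> 0 < X -> _]eq_bigr do rewrite mulrBl -[c - _]opprB mulNr.
rewrite sumrB -mulr_sumr sumrN ler_norml => /andP[_ +]; lra.
Qed.

(** Along the segment from [x0] to [x1] the number of negative directions of
    [H - c] has to change, which makes a Floquet matrix singular on the way; its
    kernel is a Bloch wave of energy [c]. *)
Lemma band_crossing x0 x1 c r0 r1 :
  has_positive_subspace (floquet_mx x0 c) r0 ->
  has_positive_subspace (- floquet_mx x1 c) r1 -> (N < r0 + r1)%N ->
  spectrum (schrodinger V) c%:C.
Proof.
move=> p0 p1 Nr.
pose x (s : R) i := x0 i + s * (x1 i - x0 i).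
have x00 : x 0 = x0 by apply/funext => i; rewrite /x mul0r addr0.
have x11 : x 1 = x1 by apply/funext => i; rewrite /x mul1r addrC subrK.
have [|||||s [v v0 vQ]] := @definite_rank_change_singular R N
  (fun s => floquet_mx (x s) c) r0 r1.
- by move=> s; exact: floquet_hermitian.
- move=> s e e0.
  have cont (i : 'I_N) : {for s, continuous (fun s => dispersion (shifted (x s) i))}.
    apply: (@continuousM _ _ (fun=> 2) _ s); first exact: cvg_cst.
    have : continuous (fun s => \sum_(j < d) cos (shifted (x s) i j)).
      have sumc (r : seq 'I_d) : continuous (fun s => \sum_(j <- r) cos (shifted (x s) i j)).
        elim: r => [|j r IH].
          by under eq_fun do rewrite big_nil; move=> t; exact: cvg_cst.
        under eq_fun do rewrite big_cons; move=> t.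
        apply: (@continuousD _ _ _ (fun s => cos (shifted (x s) i j)) _ t); last exact: IH.
        apply: (@continuous_comp _ _ _ (fun s => shifted (x s) i j) (@cos R)).
          rewrite /shifted /x; apply: continuousD; last exact: cvg_cst.
          apply: continuousD; first exact: cvg_cst.
          by apply: continuousM; [exact: cvg_id|exact: cvg_cst].
        exact: continuous_cos.
      exact: sumc.
    exact.
  have near_i : \forall s' \near s, forall i : 'I_N,
      `|dispersion (shifted (x s) i) - dispersion (shifted (x s') i)| < e.
    apply: (@filter_forall R 'I_N (fun i s' =>
      `|dispersion (shifted (x s) i) - dispersion (shifted (x s') i)| < e) (nbhs s)) => i.
    exact: (cvgr_dist_lt _ _ (cont i)).
  near=> s' => v.
  have close : forall i : 'I_N,
      `|dispersion (shifted (x s) i) - dispersion (shifted (x s') i)| < e.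
    by near: s'.
  have sum_le : `|\sum_i (dispersion (shifted (x s) i) - c) * nrm2 (v 0 i) -
      \sum_i (dispersion (shifted (x s') i) - c) * nrm2 (v 0 i)| <= e * \sum_i nrm2 (v 0 i).
    rewrite -sumrB mulr_sumr; apply: le_trans (ler_norm_sum _ _ _) _.
    apply: ler_sum => i _; rewrite -mulrBl normrM (ger0_norm (nrm2_ge0 _)).
    rewrite ler_wpM2r ?nrm2_ge0// opprB addrA subrK.
    exact: ltW.
  rewrite !mxform_floquet sqnorm_nrm2 -rmorphM/= -rmorphB/= -rmorphD/= !lecR.
  by move: sum_le; rewrite ler_norml => /andP[]; lra.
- by rewrite x00.
- by rewrite x11.
- by [].
- exact: bloch_spectrum vQ.
Unshelve. all: by end_near.
Qed.

End FloquetMatrices.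

Section FloquetAverage.
Variables (R : realType) (d : nat).
Local Notation C := R[i].
Local Notation cj := (@Num.conj C).
Local Notation Z := 'rV[int]_d.
Local Notation Fun := (Z -> C).
Local Notation dir := (bool * 'I_d)%type.
Local Open Scope complex_scope.
Implicit Types (x y : 'I_d -> R) (f g : Fun).

Lemma fsupp_sumD f g : finsupported f -> finsupported g ->
  fsupp_sum (fun n => f n + g n) = fsupp_sum f + fsupp_sum g.
Proof.
move=> [s1 fs] [s2 gs]; pose s := s1 ++ s2.
have fs' n : n \notin s -> f n = 0 by rewrite mem_cat negb_or => /andP[/fs].
have gs' n : n \notin s -> g n = 0 by rewrite mem_cat negb_or => /andP[_ /gs].
rewrite (fsupp_sumE fs') (fsupp_sumE gs') (@fsupp_sumE _ _ _ s) ?big_split//.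
by move=> n sn; rewrite fs'// gs'// addr0.
Qed.

Lemma fsupp_sum_sum (I : eqType) (r : seq I) (F : I -> Fun) :
  (forall i, finsupported (F i)) ->
  fsupp_sum (fun n => \sum_(i <- r) F i n) = \sum_(i <- r) fsupp_sum (F i).
Proof.
move=> Ff; elim: r => [|i r IH].
  rewrite big_nil (@fsupp_sumE _ _ _ [::]) ?big_nil// => n _; exact: big_nil.
have -> : (fun n => \sum_(j <- i :: r) F j n) = fun n => F i n + \sum_(j <- r) F j n.
  by apply/funext => n; rewrite big_cons.
by rewrite fsupp_sumD ?IH ?big_cons//; exact: finsupported_sum.
Qed.

Definition fourier f y : C := fsupp_sum (fun n => f n * cj (plane_wave y n)).

Lemma finsupported_mulr f (u : Z -> C) : finsupported f -> finsupported (fun n => f n * u n).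
Proof. by move=> [s fs]; exists s => n /fs ->; rewrite mul0r. Qed.

Lemma fourier_laplacian f y : finsupported f ->
  fourier (laplacian f) y = (dispersion y)%:C * fourier f y.
Proof.
move=> ff; rewrite /fourier.
have -> : (fun n => laplacian f n * cj (plane_wave y n)) =
    fun n => \sum_(e <- index_enum dir) f (n + step e) * cj (plane_wave y n).
  by apply/funext => n; rewrite laplacianE mulr_suml.
rewrite fsupp_sum_sum => [|e]; last exact/finsupported_mulr/finsupported_shift.
rewrite -sum_plane_wave_step mulr_suml; apply: eq_bigr => e _.
rewrite /fsupp_sum [in RHS](reindex_fsbigT (fun n => n + step e)); last first.
  by exists (fun n => n - step e) => n; rewrite ?addrK ?subrK.
rewrite mulr_fsumr; apply: eq_fsbigr => n _.
rewrite plane_waveD rmorphM/= mulrCA; congr (_ * _).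
by rewrite mulrCA /plane_wave expi_mulJ mulr1.
Qed.

(** Sampling the Fourier transform at the frequencies of a discrete torus larger
    than the support loses nothing. *)
Lemma fourier_plancherel (s : seq Z) : exists k : nat, forall f g x,
  (forall n, n \notin s -> f n = 0) -> (forall n, n \notin s -> g n = 0) ->
  \sum_(q : {ffun 'I_d -> 'I_k.+1})
    fourier f (fun i => freq R q i + x i) * cj (fourier g (fun i => freq R q i + x i)) =
  (k.+1 ^ d)%:R * fsupp_sum (fun n => f n * cj (g n)).
Proof.
(* Two points of [s] then differ by at most [k] in each coordinate, so they are
   congruent modulo [k.+1] only if they coincide. *)
pose k := (2 * \max_(n <- s) \max_i `|n 0%R i|)%N.
have sk n i : n \in s -> (2 * `|n 0%R i| <= k)%N.
  move=> ns; rewrite leq_mul2l/=; apply: leq_trans (leq_bigmax_seq _ ns isT).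
  exact: leq_bigmax.
exists k => f g x fs gs.
have E h y : (forall n, n \notin s -> h n = 0) ->
    fourier h y = \sum_(n <- undup s) h n * cj (plane_wave y n).
  by move=> hs; apply: fsupp_sumE => n /hs ->; rewrite mul0r.
under eq_bigr => q _ do rewrite !E// rmorph_sum/= big_distrlr/=.
rewrite exchange_big/= (@fsupp_sumE _ _ _ s) => [|n /fs ->]; last by rewrite mul0r.
rewrite mulr_sumr; apply: eq_big_seq => n; rewrite mem_undup => ns.
rewrite exchange_big/=.
have term n' : n' \in undup s -> \sum_(q : {ffun 'I_d -> 'I_k.+1})
    f n * cj (plane_wave (fun i => freq R q i + x i) n) *
      cj (g n' * cj (plane_wave (fun i => freq R q i + x i) n')) =
    if n' == n then (k.+1 ^ d)%:R * (f n * cj (g n)) else 0.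
  rewrite mem_undup => ns'.
  have -> : \sum_(q : {ffun 'I_d -> 'I_k.+1})
      f n * cj (plane_wave (fun i => freq R q i + x i) n) *
        cj (g n' * cj (plane_wave (fun i => freq R q i + x i) n')) =
      (f n * cj (g n') * plane_wave x (n' - n)) *
      \sum_(q : {ffun 'I_d -> 'I_k.+1}) plane_wave (freq R q) (n' - n).
    rewrite mulr_sumr; apply: eq_bigr => q _.
    by rewrite rmorphM/= conjCK !plane_waveDl rmorphM/= !plane_waveD !plane_waveN; ring.
  rewrite sum_plane_wave; case: eqP => [->|nn'].
    rewrite subrr plane_wave0 ifT; first by ring.
    by apply/forallP => i; rewrite mxE dvdz0.
  rewrite ifF ?mulr0//; apply/negP => /forallP h; apply: nn'; apply/rowP => i.
  have := h i; have := sk n i ns; have := sk n' i ns'; rewrite !mxE.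
  move: (n 0 i) (n' 0 i) => a b; move: k {sk h} => K hb ha; rewrite dvdzE/= => hd.
  apply/eqP; rewrite -subr_eq0 -absz_eq0 -leqn0 leqNgt; apply/negP => pos.
  by have := dvdn_leq pos hd; lia.
rewrite (eq_big_seq _ term) -big_mkcond -big_filter.
rewrite (_ : [seq i <- undup s | i == n] = [:: n]) ?big_seq1//.
by rewrite (filter_pred1_uniq (undup_uniq s)) ?mem_undup.
Qed.

Variables (m : nat) (G : set Z).
Hypothesis GM : forall k : Z, G (k *+ m.+1).
Variable V : Z -> R.
Hypothesis VG : lattice_periodic G V.
Local Notation M := (m.+1).
Local Notation J := {ffun 'I_d -> 'I_m.+1}.
Local Notation DF := (dual_freqs R m G).
Local Notation N := #|DF|.
Local Notation fr i := (freq R (@enum_val _ (mem DF) i)).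

Lemma zero_dual_freq : [ffun=> ord0] \in DF.
Proof.
rewrite inE; apply/asboolP => a _; rewrite /plane_wave /dot big1 ?expi0// => i _.
by rewrite /freq ffunE mulr0 !mul0r.
Qed.

(** The kernel [\sum_i plane_wave (fr i) (l - n)] reproduces the values at [n] of
    [G]-periodic functions of [l]; here it is applied to its own product with
    [V]. *)
Lemma average_potential (n : Z) :
  (M ^ d)%:R^-1 * \sum_(q : J) (V (box_point q))%:C *
    `|\sum_(i < N) plane_wave (fr i) (box_point q - n)| ^+ 2 = N%:R * (V n)%:C :> C.
Proof.
pose F (l : Z) : C := (V l)%:C * \sum_(i < N) plane_wave (fr i) (l - n).
have FG a : G a -> periodic F a.
  move=> Ga l; rewrite /F VG//; congr (_ * _); apply: eq_bigr => i _.
  have pwa : plane_wave (fr i) a = 1.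
    by have := enum_valP i; rewrite inE => /asboolP; exact.
  by rewrite addrAC [LHS]plane_waveD pwa mulr1.
have := synth_series GM n FG; rewrite /F subrr.
under eq_bigr do rewrite plane_wave0; rewrite sumr_const card_ord mulrC => ->.
rewrite /synth; under [RHS]eq_bigr do rewrite mxE /fourier_coef -mulrA mulr_suml.
rewrite -mulr_sumr exchange_big/=; congr (_ * _); apply: eq_bigr => q _.
rewrite normCK rmorph_sum/= mulrA mulr_sumr; apply: eq_bigr => i _.
by rewrite plane_waveD plane_waveN rmorphM/= conjCK; ring.
Qed.

(** The form of [H - c] on a finitely supported function is the average of the
    Floquet forms of its Bloch components. *)
Lemma floquet_average f c : finsupported f -> exists (k : nat) (y : {ffun 'I_d -> 'I_k.+1} -> 'I_d -> R)
    (v : {ffun 'I_d -> 'I_k.+1} -> 'rV[C]_N) (w : R), 0 < w /\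
  \sum_q mxform (floquet_mx m G V (y q) c) (v q) =
    (w * (rip (schrodinger V f) f - c * rip f f))%:C.
Proof.
move=> ff; have [s1 fs1] := ff.
have lapf : finsupported (laplacian f).
  have -> : laplacian f = fun n => \sum_(e <- index_enum dir) f (n + step e).
    by apply/funext => n; exact: laplacianE.
  by apply: finsupported_sum => e; exact: finsupported_shift.
have [s2 fs2] := lapf; pose s := s1 ++ s2.
have fs n : n \notin s -> f n = 0 by rewrite mem_cat negb_or => /andP[/fs1].
have ls n : n \notin s -> laplacian f n = 0 by rewrite mem_cat negb_or => /andP[_ /fs2].
have [k planch] := fourier_plancherel s.
pose y (q : {ffun 'I_d -> 'I_k.+1}) := freq R q.
pose v q : 'rV[C]_N := \row_i fourier f (shifted (y q) i).
pose w : R := (k.+1 ^ d)%:R * N%:R.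
have N0 : (0 < N)%N by apply/card_gt0P; eexists; exact: zero_dual_freq.
exists k, y, v, w; split; first by rewrite mulr_gt0// ltr0n ?expn_gt0.
pose ip f g := fsupp_sum (fun n => f n * cj (g n)) : C.
have diag_part : \sum_q \sum_i ((dispersion (shifted (y q) i) - c) * nrm2 (v q 0 i))%:C =
    (k.+1 ^ d)%:R * N%:R * (ip (laplacian f) f - c%:C * ip f f).
  rewrite exchange_big/=.
  have term i : \sum_q ((dispersion (shifted (y q) i) - c) * nrm2 (v q 0 i))%:C =
      (k.+1 ^ d)%:R * (ip (laplacian f) f - c%:C * ip f f).
    rewrite mulrBr mulrCA -!(planch _ _ (fr i))// mulr_sumr -sumrB.
    apply: eq_bigr => q _; rewrite fourier_laplacian// rmorphM/= nrm2C mxE normCK.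
    by rewrite -!mulrA -mulrBl rmorphB.
  rewrite (eq_bigr _ (fun i _ => term i)) sumr_const card_ord -[LHS]mulr_natl.
  by rewrite mulrCA mulrA.
have pot_part : \sum_q ((M ^ d)%:R^-1 * \sum_(b : J) V (box_point b) *
      nrm2 (synth (v q) (box_point b)))%:C =
    (k.+1 ^ d)%:R * N%:R * ip (fun n => (V n)%:C * f n) f :> C.
  pose U l : C := \sum_(i < N) plane_wave (fr i) l.
  have synthE q l : synth (v q) l = fourier (fun n => f n * U (l - n)) (y q).
    rewrite /synth /fourier.
    have -> : (fun n => f n * U (l - n) * cj (plane_wave (y q) n)) =
        fun n => \sum_(i <- index_enum 'I_N)
          (f n * (cj (plane_wave (shifted (y q) i) n) * plane_wave (fr i) l)).
      apply/funext => n; rewrite /U mulr_sumr mulr_suml; apply: eq_bigr => i _.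
      by rewrite plane_waveDl rmorphM/= plane_waveD plane_waveN; ring.
    rewrite fsupp_sum_sum => [|i]; last exact: finsupported_mulr.
    apply: eq_bigr => i _; rewrite mxE /fourier /fsupp_sum mulr_fsuml.
    by apply: eq_fsbigr => n _; rewrite mulrA.
  have fU l n : n \notin s -> f n * U (l - n) = 0 by move=> /fs ->; rewrite mul0r.
  have normsum l : \sum_q (nrm2 (synth (v q) l))%:C =
      (k.+1 ^ d)%:R * \sum_(n <- undup s) `|f n| ^+ 2 * `|U (l - n)| ^+ 2.
    have := planch _ _ (fun=> 0) (fU l) (fU l).
    rewrite (@fsupp_sumE _ _ _ s) => [|n /fU ->]; last by rewrite mul0r.
    under [X in _ = _ * X -> _]eq_bigr do rewrite -normCK normrM exprMn.
    move=> <-; apply: eq_bigr => q _; rewrite nrm2C synthE normCK.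
    by congr (fourier _ _ * cj (fourier _ _)); apply/funext => i; rewrite addr0.
  under eq_bigr => q _.
    rewrite rmorphM/= fmorphV rmorph_nat rmorph_sum/=.
    under eq_bigr do rewrite rmorphM/=.
    over.
  rewrite -mulr_sumr exchange_big/=.
  under eq_bigr do rewrite -mulr_sumr normsum mulrCA mulr_sumr.
  rewrite -mulr_sumr exchange_big/= mulrCA -mulrA; congr (_ * _).
  rewrite mulr_sumr /ip (@fsupp_sumE _ _ _ s) => [|n /fs ->]; last by rewrite mulr0 mul0r.
  rewrite mulr_sumr; apply: eq_bigr => n _.
  under eq_bigr do rewrite mulrCA.
  rewrite -mulr_sumr mulrCA average_potential normCK; ring.
pose X : C := ip (schrodinger V f) f - c%:C * ip f f.
have tot : \sum_q mxform (floquet_mx m G V (y q) c) (v q) = w%:C * X.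
  under eq_bigr do rewrite mxform_floquet// rmorphD/= rmorph_sum/=.
  rewrite big_split/= diag_part pot_part -mulrDr /w rmorphM/= !rmorph_nat.
  congr (_ * _); rewrite addrAC /X; congr (_ - _).
  rewrite /ip -fsupp_sumD; last 2 first.
  - exact: finsupported_mulr.
  - by apply: finsupported_mulr; exists s => n /fs ->; rewrite mulr0.
  by congr fsupp_sum; apply/funext => n; rewrite -mulrDl.
have w0 : w%:C != 0 :> C.
  by rewrite (inj_eq (@complexI R) _ 0) mulf_neq0 ?pnatr_eq0 ?expn_eq0 -?lt0n.
have Xreal : X = (complex.Re X)%:C.
  have [r rE] : exists r : R, \sum_q mxform (floquet_mx m G V (y q) c) (v q) = r%:C.
    by eexists; under eq_bigr do rewrite mxform_floquet//; rewrite -rmorph_sum.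
  have -> : X = (w^-1 * r)%:C by rewrite rmorphM/= fmorphV -rE tot mulKf.
  by [].
have Re_ip h g : finsupported h -> complex.Re (ip h g) = rip h g.
  move=> [t ht]; rewrite /ip /rip !(@fsupp_sumE _ _ _ t) => [|n /ht->|n /ht->].
  - rewrite (big_morph (@complex.Re R) (id1 := 0) (op1 := +%R))//; last by move=> [? ?] [? ?].
    apply: eq_bigr => n _; case: (h n) (g n) => a b [a' b']; rewrite /rdot/=; ring.
  - by rewrite ?mul0r// /rdot/= !mul0r addr0.
  - by rewrite ?mul0r// /rdot/= !mul0r addr0.
rewrite tot Xreal -rmorphM/=; congr ((_ * _)%:C).
have ReB (u u' : C) : complex.Re (u - c%:C * u') = complex.Re u - c * complex.Re u'.
  by case: u u' => a b [a' b'] /=; ring.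
rewrite /X ReB !Re_ip//. exact: (op_finsupported (schrodinger_symop V) ff).
Qed.

End FloquetAverage.

(** * Overlap of the unperturbed bands *)

Section BandOverlap.
Variables (R : realType) (d : nat).
Local Notation Z := 'rV[int]_d.
Variables (m : nat) (G : set Z).
Local Notation M := (m.+1).
Local Notation J := {ffun 'I_d -> 'I_m.+1}.
Local Notation A := (dual_freqs R m G).
Implicit Types (x : 'I_d -> R) (g : J).

(** The eigenvalue of the Laplacian on the plane wave of frequency [x + g]. *)
Definition branch x (g : J) : R := dispersion (fun i => x i + freq R g i).

(** When the branches above the level at one quasi-momentum and those below it at
    another outnumber the branches, the numbers of branches above the level at the
    two quasi-momenta differ: the level lies strictly inside a band. The margin
    [e] is what a perturbation may use up. *)
Definition overlap_at (lambda : R) (e : R) : Prop := exists x0 x1,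
  (#|A| < #|[set g in A | (branch x0 g > lambda + e)%R]| +
          #|[set g in A | (branch x1 g < lambda - e)%R]|)%N.

Definition translate x (k : 'I_d) (t : R) (i : 'I_d) : R := x i + (if i == k then t else 0).

Lemma branch_translate x k t g : branch (translate x k t) g =
  branch x g + 2 * (cos (x k + freq R g k + t) - cos (x k + freq R g k)).
Proof.
rewrite /branch /dispersion (bigD1 k)//= [X in _ = 2 * X + _](bigD1 k)//= /translate eqxx.
rewrite (eq_bigr (fun i => cos (x i + freq R g i))) => [|i /negbTE->]; last by rewrite addr0.
by rewrite -[x k + t + _]addrAC; ring.
Qed.

Lemma cosB_sin (a t : R) : cos (a + t) - cos a = - 2 * sin (a + t / 2) * sin (t / 2).
Proof.
have -> : cos (a + t) = cos (a + t / 2 + t / 2) by rewrite -addrA -splitr.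
rewrite cosD; have -> : cos a = cos (a + t / 2 - t / 2) by rewrite addrK.
by rewrite cosB; ring.
Qed.

Lemma branch_translate_cvg x k g (s : R) :
  ((fun t => branch (translate x k (s * t)) g) @ 0^'+ --> branch x g)%classic.
Proof.
have -> : branch x g = branch (translate x k (s * 0)) g.
  by rewrite branch_translate mulr0 addr0 subrr mulr0 addr0.
under eq_fun do rewrite branch_translate; rewrite branch_translate.
apply: cvg_at_right_filter.
have : continuous (fun t : R => branch x g +
    2 * (cos (x k + freq R g k + s * t) - cos (x k + freq R g k))).
  move=> t; apply: cvgD; first exact: cvg_cst.
  apply: cvgM; first exact: cvg_cst.
  apply: cvgB; last exact: cvg_cst.
  apply: (@continuous_comp _ _ _ (fun t => x k + freq R g k + s * t) (@cos R)).
    apply: cvgD; first exact: cvg_cst.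
    by apply: cvgM; [exact: cvg_cst|exact: cvg_id].
  exact: continuous_cos.
exact.
Qed.

Lemma cos_monotone_near (a s : R) : s = 1 \/ s = -1 -> sin a != 0 ->
  \forall t \near ((0:R)^'+)%classic, 0 < s * sin a * (cos a - cos (a + s * t)).
Proof.
move=> s1 sa.
have s2 : s * s = 1 by case: s1 => ->; rewrite ?mulrNN ?mulr1.
have cvs : ((fun t => sin a * sin (a + s * t / 2)) @ (0:R)^'+ --> sin a * sin (a + s * 0 / 2))%classic.
  apply: cvg_at_right_filter; apply: cvgM; first exact: cvg_cst.
  apply: (@continuous_comp _ _ _ (fun t : R => a + s * t / 2) (@sin R)).
    apply: cvgD; first exact: cvg_cst.
    apply: cvgM; last exact: cvg_cst.
    by apply: cvgM; [exact: cvg_cst|exact: cvg_id].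
  exact: continuous_sin.
have sa0 : 0 < sin a * sin (a + s * 0 / 2).
  by rewrite mulr0 mul0r addr0 -expr2 exprn_even_gt0.
near=> t.
have t0 : 0 < t by near: t; exact: nbhs_right_gt.
have tpi : t < 2 * pi.
  by near: t; apply: nbhs_right_lt; rewrite mulr_gt0 ?pi_gt0.
have st : 0 < sin (t / 2) by apply: sin_gt0_pi; apply/andP; split; lra.
have ssin : sin (s * t / 2) = s * sin (t / 2).
  by case: s1 => ->; rewrite ?mul1r// !mulN1r mulNr sinN.
have -> : s * sin a * (cos a - cos (a + s * t)) =
   (s * s) * 2 * (sin a * sin (a + s * t / 2)) * sin (t / 2).
  by rewrite -[cos a - _]opprB cosB_sin ssin; ring.
rewrite s2 mul1r mulr_gt0// mulr_gt0//; near: t; exact: (cvgr_gt _ cvs _ sa0).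
Unshelve. all: by end_near.
Qed.

Lemma card_disjoint_le (X Y T : {set J}) : (forall g, g \in X -> g \notin Y) ->
  X \subset T -> Y \subset T -> (#|X| + #|Y| <= #|T|)%N.
Proof.
move=> XY XT YT; rewrite -cardsUI [X in (_ + X)%N](_ : _ = 0%N); last first.
  apply/eqP; rewrite cards_eq0; apply/eqP/setP => g; rewrite !inE.
  by apply/negP => /andP[/XY/negbTE->].
by rewrite addn0; apply: subset_leq_card; rewrite finset.subUset XT.
Qed.

(** Moving slightly along the axis [k] pushes the branches of [S] with one sign of
    the sine above the level and the others below it; moving backwards exchanges
    the two, and all other branches stay on their side. If the two groups have
    different sizes, letting the larger one be above at [x0] and below at [x1]
    counts more branches than there are. *)
Lemma local_overlap x (k : 'I_d) (lambda : R) :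
  let S := [set g in A | branch x g == lambda] in
  (forall g, g \in S -> sin (x k + freq R g k) != 0) ->
  #|[set g in S | 0 < sin (x k + freq R g k)]| !=
    #|[set g in S | sin (x k + freq R g k) < 0]| ->
  overlap_at lambda 0.
Proof.
move=> S sinS unbalanced.
pose sn g := sin (x k + freq R g k).
pose xt s t := translate x k (s * t).
have near_all : \forall t \near ((0:R)^'+)%classic, forall (g : J) (b : bool),
    let s := (-1) ^+ b in
    (branch x g < lambda -> branch (xt s t) g < lambda) /\
    (lambda < branch x g -> lambda < branch (xt s t) g) /\
    (g \in S -> 0 < s * sn g * (lambda - branch (xt s t) g)).
  apply: (@filter_forall R J (fun g t => forall b : bool, let s := (-1) ^+ b in
    (branch x g < lambda -> branch (xt s t) g < lambda) /\
    (lambda < branch x g -> lambda < branch (xt s t) g) /\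
    (g \in S -> 0 < s * sn g * (lambda - branch (xt s t) g))) (0^'+)%classic) => g.
  apply: (@filter_forall R bool (fun b t => let s := (-1) ^+ b in
    (branch x g < lambda -> branch (xt s t) g < lambda) /\
    (lambda < branch x g -> lambda < branch (xt s t) g) /\
    (g \in S -> 0 < s * sn g * (lambda - branch (xt s t) g))) (0^'+)%classic) => b.
  have : (-1) ^+ b = 1 :> R \/ (-1) ^+ b = -1 :> R.
    by case: b; [right; rewrite expr1|left; rewrite expr0].
  move: ((-1) ^+ b) => s s1 {b} /=.
  have cv := @branch_translate_cvg x k g s.
  have [gS|gS] := boolP (g \in S).
    have [gA /eqP gl] : g \in A /\ branch x g == lambda by move: gS; rewrite inE => /andP.
    near=> t; rewrite gl ltxx; split=> //; split=> // _.
    rewrite branch_translate gl opprD addNKr -mulrN opprB mulrCA pmulr_rgt0//.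
    by near: t; apply: cos_monotone_near => //; exact: sinS.
  have [bl|bl|bl] := ltgtP (branch x g) lambda.
  - near=> t; split; last by split.
    by move=> _; near: t; exact: (cvgr_lt _ cv _ bl).
  - near=> t; split=> //; split=> //.
    by move=> _; near: t; exact: (cvgr_gt _ cv _ bl).
  - by near=> t.
have [t tP] : exists t : R, forall (g : J) (b : bool),
    let s := (-1) ^+ b in
    (branch x g < lambda -> branch (xt s t) g < lambda) /\
    (lambda < branch x g -> lambda < branch (xt s t) g) /\
    (g \in S -> 0 < s * sn g * (lambda - branch (xt s t) g)).
  exact: (filter_ex near_all).
pose Al := [set g in A | branch x g < lambda]; pose Ar := [set g in A | lambda < branch x g].
pose Sp := [set g in S | 0 < sn g]; pose Sn := [set g in S | sn g < 0].
have cardA : (#|A| <= #|Ar| + #|Al| + #|Sp| + #|Sn|)%N.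
  have sub : A \subset Ar :|: Al :|: Sp :|: Sn.
    apply/fintype.subsetP => g gA; rewrite !inE in gA *; rewrite gA /=.
    case: ltgtP => //= gl; have : g \in S by rewrite !inE gA gl /=.
    by move=> /sinS; rewrite -/(sn g) neq_lt orbC.
  apply: leq_trans (subset_leq_card sub) _.
  do 2![apply: leq_trans (leq_card_setU _ _) _; rewrite leq_add2r].
  exact: leq_card_setU.
have sgn g (b : bool) : g \in S -> 0 < sn g * (-1) ^+ b -> branch (xt ((-1) ^+ b) t) g < lambda.
  move=> gS s0; have [_ [_ /(_ gS)]] := tP g b.
  by rewrite [_ * sn g]mulrC pmulr_rgt0// subr_gt0.
have sgn' g (b : bool) : g \in S -> sn g * (-1) ^+ b < 0 -> lambda < branch (xt ((-1) ^+ b) t) g.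
  move=> gS s0; have [_ [_ /(_ gS)]] := tP g b.
  by rewrite [_ * sn g]mulrC nmulr_rgt0// subr_lt0.
have Sdef g : g \in S -> g \in A /\ branch x g = lambda by rewrite inE => /andP[? /eqP].
have up (b : bool) : (#|Ar| + #|if b then Sp else Sn| <=
    #|[set g in A | (branch (xt ((-1) ^+ b) t) g > lambda + 0)%R]|)%N.
  have inS g : g \in (if b then Sp else Sn) -> g \in S /\ sn g * (-1) ^+ b < 0.
    by case: (b); rewrite inE => /andP[? ?]; rewrite ?expr1 ?mulrN1 ?oppr_lt0 ?expr0 ?mulr1.
  apply: card_disjoint_le.
  - move=> g; rewrite inE => /andP[_ gl]; apply/negP => /inS[/Sdef[_ E] _].
    by rewrite E ltxx in gl.
  - apply/fintype.subsetP => g; rewrite inE => /andP[gA gl]; rewrite inE gA addr0.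
    exact: (tP g b).2.1.
  - apply/fintype.subsetP => g /inS[gS gs]; rewrite inE addr0 sgn'// andbT.
    exact: (Sdef g gS).1.
have down (b : bool) : (#|Al| + #|if b then Sn else Sp| <=
    #|[set g in A | (branch (xt ((-1) ^+ b) t) g < lambda - 0)%R]|)%N.
  have inS g : g \in (if b then Sn else Sp) -> g \in S /\ 0 < sn g * (-1) ^+ b.
    by case: (b); rewrite inE => /andP[? ?]; rewrite ?expr1 ?mulrN1 ?oppr_gt0 ?expr0 ?mulr1.
  apply: card_disjoint_le.
  - move=> g; rewrite inE => /andP[_ gl]; apply/negP => /inS[/Sdef[_ E] _].
    by rewrite E ltxx in gl.
  - apply/fintype.subsetP => g; rewrite inE => /andP[gA gl]; rewrite inE gA subr0.
    exact: (tP g b).1.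
  - apply/fintype.subsetP => g /inS[gS gs]; rewrite inE subr0 sgn// andbT.
    exact: (Sdef g gS).1.
have [lt|gt|eq] := ltngtP #|Sp| #|Sn|.
- exists (xt ((-1) ^+ false) t), (xt ((-1) ^+ true) t).
  apply: leq_trans (leq_add (up false) (down true)); move: cardA lt => /=; lia.
- exists (xt ((-1) ^+ true) t), (xt ((-1) ^+ false) t).
  apply: leq_trans (leq_add (up true) (down false)); move: cardA gt => /=; lia.
- by move: unbalanced; rewrite -/sn -/Sp -/Sn eq eqxx.
Unshelve. all: by end_near.
Qed.

End BandOverlap.

Section LevelSets.
Variables (R : realType) (d : nat).
Local Notation Z := 'rV[int]_d.
Variables (m : nat) (G : set Z).
Local Notation M := (m.+1).
Local Notation J := {ffun 'I_d -> 'I_m.+1}.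
Local Notation A := (dual_freqs R m G).
Implicit Types (x : 'I_d -> R) (g : J).

Lemma nonroot_in_itv (p : {poly R}) (a b : R) : p != 0 -> a < b ->
  exists2 c, a < c < b & p.[c] != 0.
Proof.
move=> p0 ab; apply: contrapT => none.
pose f (k : 'I_(size p)) : R := a + (b - a) * (k.+1%:R / (size p).+1%:R).
have n0 : 0 < (size p).+1%:R :> R by rewrite ltr0n.
have fitv k : a < f k < b.
  rewrite ltrDl mulr_gt0 ?divr_gt0 ?subr_gt0 ?ltr0n//= -ltrBrDl.
  by rewrite gtr_pMr ?subr_gt0// ltr_pdivrMr// mul1r ltr_nat ltnS ltn_ord.
have finj : injective f.
  move=> k k' /addrI/(mulfI _); rewrite subr_eq0 gt_eqF// => /(_ isT).
  move=> /(mulIf _); rewrite invr_eq0 gt_eqF// => /(_ isT)/eqP.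
  by rewrite eqr_nat => /eqP[/val_inj].
have := max_poly_roots p0 (rs := [seq f k | k <- enum 'I_(size p)]).
rewrite map_inj_uniq// enum_uniq size_map size_enum_ord ltnn => h.
suff : false by []; apply: h => //; apply/allP => _ /mapP[k _ ->].
by apply: contrapT => /negP fk; apply: none; exists (f k).
Qed.

Lemma freq_itv (g : J) i : 0 <= freq R g i < 2 * pi.
Proof.
have M0 : 0 < M%:R :> R by rewrite ltr0n.
rewrite /freq !mulr_ge0 ?pi_ge0 ?invr_ge0//= -mulrA gtr_pMr ?mulr_gt0 ?pi_gt0//.
by rewrite ltr_pdivrMr// mul1r ltr_nat.
Qed.

Lemma cos_freq1 (g : J) i : cos (freq R g i) = 1 -> freq R g i = 0.
Proof.
move=> c1; have /andP[f0 f1] := freq_itv g i.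
apply/eqP; apply: contraT => fn0; have := @expi_eq1_itv R (freq R g i).
rewrite lt_neqAle eq_sym fn0 f0 f1 => /(_ isT)/eqP; case.
rewrite /expi c1; have := sin2cos2 (freq R g i).
by rewrite c1 expr1n subrr => /eqP; rewrite expf_eq0/= => /eqP ->.
Qed.

Lemma cos_freqN1 (g : J) i : cos (freq R g i) = -1 -> freq R g i = pi.
Proof.
move=> c1; have /andP[f0 f1] := freq_itv g i.
have p0 := pi_gt0 R.
have sin0 : sin (freq R g i) = 0.
  have := sin2cos2 (freq R g i).
  by rewrite c1 sqrrN expr1n subrr => /eqP; rewrite expf_eq0/= => /eqP.
have E t : (t = freq R g i - pi \/ t = pi - freq R g i) -> ~~ (0 < t < 2 * pi).
  move=> tE; apply/negP => /expi_eq1_itv/eqP; apply.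
  by case: tE => ->; rewrite /expi cosB sinB cospi sinpi c1 sin0 !mulr0 !mul0r mulrNN mulr1 subr0 addr0.
have [lt|gt|//] := ltgtP (freq R g i) pi.
  by have := E _ (or_intror erefl); rewrite subr_gt0 lt /= -leNgt; lra.
by have := E _ (or_introl erefl); rewrite subr_gt0 gt /= -leNgt; lra.
Qed.

Lemma freq_eq0 (g : J) : (forall i, freq R g i = 0) -> g = [ffun=> ord0].
Proof.
move=> h; apply/ffunP => i; rewrite ffunE; apply/val_inj => /=.
have := h i; rewrite /freq => /eqP; rewrite mulf_eq0 invr_eq0 pnatr_eq0 orbF.
by rewrite mulf_eq0 mulf_eq0 pnatr_eq0/= gt_eqF ?pi_gt0//= pnatr_eq0 => /eqP.
Qed.

Lemma freq0 i : freq R ([ffun=> ord0] : J) i = 0.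
Proof. by rewrite /freq ffunE mulr0 mul0r. Qed.

(** Eliminating the square roots [X = sqrt (1 - c^2)] and [Y = sqrt (1 - e^2)]
    from [l = p X + q Y]. *)
Lemma eliminate_roots (l p q X Y : R) : l = p * X + q * Y ->
  (l ^+ 2 - p ^+ 2 * X ^+ 2 - q ^+ 2 * Y ^+ 2) ^+ 2 -
    4 * (p ^+ 2 * X ^+ 2) * (q ^+ 2 * Y ^+ 2) = 0.
Proof. by move=> ->; ring. Qed.

(** If the eliminant vanished identically, then at a point [c] with [|c| < 1] and
    [|e| > 1], or conversely, it would be positive unless [p q = 0]; such a point
    is missing only when [e = -c]. If [p q = 0], the remaining square vanishes
    where its root term does, at two points, which determines the affine [l]. *)
Lemma eliminant_nonzero (mu D k1 k2 p q : R) : 1 <= D -> `|mu| < D + 1 ->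
  (D = 1 -> mu <> 0) ->
  (forall c, let l := k1 * c + k2 in let e := (mu - c) / D in
    (l ^+ 2 - p ^+ 2 * (1 - c ^+ 2) - q ^+ 2 * (1 - e ^+ 2)) ^+ 2 -
      4 * (p ^+ 2 * (1 - c ^+ 2)) * (q ^+ 2 * (1 - e ^+ 2)) = 0) ->
  [/\ p = 0, q = 0, k1 = 0 & k2 = 0].
Proof.
move=> D1 muD notsym vanish.
have D0 : 0 < D by lra.
have Dn : D != 0 by rewrite gt_eqF.
have [ml mr] : - (D + 1) < mu /\ mu < D + 1 by move: muD; rewrite ltr_norml => /andP.
have sqr0 (t : R) : t ^+ 2 = 0 -> t = 0 by move=> /eqP; rewrite expf_eq0/= => /eqP.
have pq0 : p = 0 \/ q = 0.
  apply: contrapT => /not_orP[/eqP p0 /eqP q0].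
  have p2 : 0 < p ^+ 2 by rewrite exprn_even_gt0.
  have q2 : 0 < q ^+ 2 by rewrite exprn_even_gt0.
  have crit (c : R) : (1 - c ^+ 2) * (1 - ((mu - c) / D) ^+ 2) < 0 -> False.
    move=> neg; have := vanish c => /=.
    set s := (_ - _ - _) ^+ 2; have s0 : 0 <= s by exact: sqr_ge0.
    have : 0 < p ^+ 2 * q ^+ 2 * - ((1 - c ^+ 2) * (1 - ((mu - c) / D) ^+ 2)).
      by apply: mulr_gt0; [exact: mulr_gt0|rewrite oppr_gt0].
    by move: (p ^+ 2) (q ^+ 2) ((_ / D) ^+ 2) => P Q E; nra.
  have eE (c : R) : 1 - ((mu - c) / D) ^+ 2 = (D - (mu - c)) * (D + (mu - c)) / D ^+ 2.
    by field.
  have iD : 0 < (D ^+ 2)^-1 by rewrite invr_gt0 exprn_gt0.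
  have [h|h] := ltP 1 (mu + D).
    apply: (crit ((1 + mu + D) / 2)); rewrite eE mulrA pmulr_llt0//.
    set c := (1 + mu + D) / 2.
    have c1 : 1 < c by rewrite /c; lra.
    have c2 : 0 < D + (mu - c) by rewrite /c; lra.
    have c3 : 0 < D - (mu - c) by rewrite /c; lra.
    rewrite nmulr_rlt0 ?mulr_gt0//; nra.
  have [h'|h'] := ltP (mu - D) (-1).
    apply: (crit ((- 1 + mu - D) / 2)); rewrite eE mulrA pmulr_llt0//.
    set c := (- 1 + mu - D) / 2.
    have c1 : c < -1 by rewrite /c; lra.
    have c2 : 0 < D + (mu - c) by rewrite /c; lra.
    have c3 : 0 < D - (mu - c) by rewrite /c; lra.
    rewrite nmulr_rlt0 ?mulr_gt0//; nra.
  by apply: notsym; lra.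
have affine a b : a != b -> k1 * a + k2 = 0 -> k1 * b + k2 = 0 -> k1 = 0 /\ k2 = 0.
  move=> ab ha hb; have : k1 * (a - b) = 0 by lra.
  move=> /eqP; rewrite mulf_eq0 subr_eq0 (negbTE ab) orbF => /eqP k10.
  by split=> //; move: ha; rewrite k10 mul0r add0r.
case: pq0 => h0.
- have pt c : (k1 * c + k2) ^+ 2 = q ^+ 2 * (1 - ((mu - c) / D) ^+ 2).
    have := vanish c => /=; rewrite h0 expr0n/= mul0r mulr0 mul0r !subr0.
    by move=> /sqr0/eqP; rewrite subr_eq0 => /eqP.
  have h1 : k1 * (mu - D) + k2 = 0.
    apply: sqr0; rewrite pt; have -> : (mu - (mu - D)) / D = 1 by field.
    by rewrite expr1n subrr mulr0.
  have h2 : k1 * (mu + D) + k2 = 0.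
    apply: sqr0; rewrite pt; have -> : (mu - (mu + D)) / D = -1 by field.
    by rewrite sqrrN expr1n subrr mulr0.
  have [k10 k20] : k1 = 0 /\ k2 = 0.
    by apply: affine h1 h2; apply/eqP => E; lra.
  split=> //; apply: sqr0.
  by have := pt mu; rewrite k10 k20 mul0r addr0 expr0n/= subrr mul0r expr0n/= subr0 mulr1.
- have pt c : (k1 * c + k2) ^+ 2 = p ^+ 2 * (1 - c ^+ 2).
    have := vanish c => /=; rewrite h0 expr0n/= mul0r mulr0 !subr0.
    by move=> /sqr0/eqP; rewrite subr_eq0 => /eqP.
  have h1 : k1 * 1 + k2 = 0 by apply: sqr0; rewrite pt expr1n subrr mulr0.
  have h2 : k1 * (-1) + k2 = 0 by apply: sqr0; rewrite pt sqrrN expr1n subrr mulr0.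
  have [k10 k20] : k1 = 0 /\ k2 = 0 by apply: affine h1 h2; apply/eqP; lra.
  split=> //; apply: sqr0.
  by have := pt 0; rewrite k10 k20 mul0r addr0 expr0n/= subr0 mulr1.
Qed.

End LevelSets.

Section LevelOverlap.
Variables (R : realType) (d : nat).
Local Notation Z := 'rV[int]_d.
Variables (m : nat) (G : set Z).
Local Notation M := (m.+1).
Local Notation J := {ffun 'I_d -> 'I_m.+1}.
Local Notation A := (dual_freqs R m G).
Local Notation g0 := ([ffun=> ord0] : J).
Implicit Types (x : 'I_d -> R) (g : J).
Hypothesis d_ge2 : (2 <= d)%N.
Hypothesis noneven : forall g, g \in A -> ~ forall i, freq R g i = pi.

Definition axis0 : 'I_d := Ordinal (ltnW d_ge2).

Lemma g0_in_A : g0 \in A.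
Proof. exact: zero_dual_freq. Qed.

Lemma one_sub_sqr_gt0 (t : R) : -1 < t -> t < 1 -> 0 < 1 - t ^+ 2.
Proof. by move=> t1 t2; nra. Qed.

(** Take the curve [cos x_0 = c], [cos x_i = (mu - c) / (d - 1)] in the level set of
    the branch [g0], with [mu = lambda / 2]. The branch of another frequency [g]
    meets the level along it only at zeros of the polynomial eliminant, which is
    zero only if all the angles of [g] are 0 or all are [pi]; the lattice not being
    even excludes the latter. So at most points of the curve [g0] alone is at the
    level. *)
Lemma overlap_level_generic (lambda : R) : `|lambda| < 2 * d%:R ->
  (d = 2%N -> lambda <> 0) -> overlap_at m G lambda 0.
Proof.
move=> lam_d notsym.
pose mu := lambda / 2; pose D : R := d.-1%:R.
have dD : d%:R = D + 1 :> R by rewrite /D natr1 prednK// (ltnW d_ge2).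
have D1 : 1 <= D by rewrite /D ler1n; lia.
have D0 : 0 < D by lra.
have Dn : D != 0 by rewrite gt_eqF.
have muD : `|mu| < D + 1.
  by rewrite /mu normrM (ger0_norm (x := 2^-1)) ?invr_ge0// ltr_pdivrMr// mulrC -dD.
have Dmu : D = 1 -> mu <> 0.
  move=> D11 mu0; apply: notsym; last by rewrite -[lambda](mulfVK (_ : 2 != 0)) ?pnatr_eq0// -/mu mu0 mul0r.
  by move: D11; rewrite /D => /eqP; rewrite pnatr_eq1; lia.
pose al (g : J) := cos (freq R g axis0); pose p (g : J) := sin (freq R g axis0).
pose Cs (g : J) := \sum_(i | i != axis0) cos (freq R g i).
pose q (g : J) := \sum_(i | i != axis0) sin (freq R g i).
pose k1 g := al g - Cs g / D; pose k2 g := mu * Cs g / D - mu.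
pose e c := (mu - c) / D.
pose P g : {poly R} := let l := (k1 g)%:P * 'X + (k2 g)%:P in
  let ep := (mu%:P - 'X) * (D^-1)%:P in
  (l ^+ 2 - (p g ^+ 2)%:P * (1 - 'X ^+ 2) - (q g ^+ 2)%:P * (1 - ep ^+ 2)) ^+ 2 -
  4%:P * ((p g ^+ 2)%:P * (1 - 'X ^+ 2)) * ((q g ^+ 2)%:P * (1 - ep ^+ 2)).
have PE g c : (P g).[c] =
   ((k1 g * c + k2 g) ^+ 2 - p g ^+ 2 * (1 - c ^+ 2) - q g ^+ 2 * (1 - e c ^+ 2)) ^+ 2 -
      4 * (p g ^+ 2 * (1 - c ^+ 2)) * (q g ^+ 2 * (1 - e c ^+ 2)).
  by rewrite /P /e !hornerE.
have cosle (t : R) : cos t <= 1 by exact: cos_le1.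
have cosge (t : R) : -1 <= cos t by exact: cos_geN1.
have Pneq0 g : g \in A -> g != g0 -> P g != 0.
  move=> gA gn0; apply/negP => /eqP Pg0.
  have [||||p0 q0 k10 k20] := @eliminant_nonzero R mu D (k1 g) (k2 g) (p g) (q g) => //.
    by move=> c; rewrite /= -/(e c) -PE Pg0 horner0.
  have al2 : al g ^+ 2 = 1 by have := cos2sin2 (freq R g axis0); rewrite -/(p g) p0 expr0n subr0.
  have CsE : Cs g = al g * D.
    by move/eqP: k10; rewrite /k1 subr_eq0 => /eqP ->; rewrite mulfVK.
  have sum0 : \sum_(i | i != axis0) (1 - al g * cos (freq R g i)) = 0.
    rewrite sumrB -mulr_sumr -/(Cs g) CsE mulrA -expr2 al2 mul1r sumr_const.
    by rewrite cardC1 card_ord subrr.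
  have al1 : al g = 1 \/ al g = -1.
    by move/eqP: al2; rewrite sqrf_eq1 => /orP[/eqP|/eqP]; [left|right].
  have term0 i : i != axis0 -> 1 - al g * cos (freq R g i) = 0.
    apply: (psumr_eq0P _ sum0) => j _.
    have b1 := cosle (freq R g j); have b2 := cosge (freq R g j).
    by rewrite subr_ge0; case: al1 => ->; clear -b1 b2; lra.
  have allcos i : cos (freq R g i) = al g.
    have [->//|/term0] := eqVneq i axis0.
    by case: al1 => ->; clear; lra.
  case: al1 => al1.
    by move/eqP: gn0; apply; apply: (@freq_eq0 R) => i; apply: cos_freq1; rewrite allcos.
  by apply: (noneven gA) => i; apply: cos_freqN1; rewrite allcos.
pose PP := \prod_(g in A | g != g0) P g.
have PP0 : PP != 0.
  by rewrite prodf_seq_neq0; apply/allP => g _; apply/implyP => /andP[? ?]; exact: Pneq0.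
have [ml mr] : - (D + 1) < mu /\ mu < D + 1 by move: muD; rewrite ltr_norml => /andP.
have itv : Num.max (-1) (mu - D) < Num.min 1 (mu + D).
  by rewrite lt_min !gt_max; apply/andP; split; apply/andP; split; clear -ml mr D1; lra.
have [c /andP[]] := nonroot_in_itv PP0 itv.
rewrite gt_max lt_min => /andP[c1 c2] /andP[c3 c4] PPc.
have e1 : -1 < e c by rewrite /e ltr_pdivlMr//; clear -c4; lra.
have e2 : e c < 1 by rewrite /e ltr_pdivrMr//; clear -c2; lra.
have cI : -1 <= c <= 1 by rewrite !ltW.
have eI : -1 <= e c <= 1 by rewrite !ltW.
pose x (i : 'I_d) := if i == axis0 then acos c else acos (e c).
pose X := Num.sqrt (1 - c ^+ 2); pose Y := Num.sqrt (1 - e c ^+ 2).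
have X2 : X ^+ 2 = 1 - c ^+ 2 by rewrite sqr_sqrtr// ltW// one_sub_sqr_gt0.
have Y2 : Y ^+ 2 = 1 - e c ^+ 2 by rewrite sqr_sqrtr// ltW// one_sub_sqr_gt0.
have X0 : 0 < X by rewrite sqrtr_gt0 one_sub_sqr_gt0.
have branchE g : branch x g = 2 * (c * al g - X * p g + (e c * Cs g - Y * q g)).
  rewrite /branch /dispersion (bigD1 axis0)//= {1}/x eqxx cosD acosK ?in_itv//= sin_acos//.
  congr (_ * (_ + _)); rewrite !mulr_sumr -sumrB; apply: eq_bigr => i i0.
  by rewrite /x (negbTE i0) cosD acosK ?in_itv//= sin_acos.
have mainS g : g \in A -> branch x g = lambda -> g = g0.
  move=> gA gl; apply/eqP; apply: contraT => gn0.
  move: PPc; rewrite horner_prod => /prodf_neq0/(_ g); rewrite gA gn0 => /(_ isT)/eqP; case.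
  rewrite PE -X2 -Y2; apply: eliminate_roots.
  have : c * al g - X * p g + (e c * Cs g - Y * q g) = mu by rewrite /mu -gl branchE; clear; lra.
  rewrite /k1 /k2 /e => h.
  have -> : (al g - Cs g / D) * c + (mu * Cs g / D - mu) = c * al g + (mu - c) / D * Cs g - mu by ring.
  clear -h; lra.
have g0l : branch x g0 = lambda.
  have cs : \sum_(i | i != axis0) cos (freq R g0 i) = D.
    by under eq_bigr do rewrite freq0 cos0; rewrite sumr_const cardC1 card_ord.
  have sn : \sum_(i | i != axis0) sin (freq R g0 i) = 0.
    by rewrite big1// => i _; rewrite freq0 sin0.
  by rewrite branchE /al /p /Cs /q cs sn freq0 cos0 sin0 /e mulfVK// /mu; clear; lra.
apply: (local_overlap (x := x) (k := axis0)).
  move=> g; rewrite inE => /andP[gA /eqP gl]; rewrite (mainS g gA gl) freq0 addr0.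
  by rewrite /x eqxx sin_acos// gt_eqF.
have s0 : 0 < sin (x axis0 + freq R g0 axis0) by rewrite freq0 addr0 /x eqxx sin_acos.
have -> : [set g in [set g in A | branch x g == lambda] | 0 < sin (x axis0 + freq R g axis0)]
    = finset.set1 g0.
  apply/setP => g; rewrite !inE; apply/idP/eqP => [/andP[/andP[gA /eqP gl] _]|->].
    by apply: mainS => //; rewrite inE.
  by have := g0_in_A; rewrite inE => ->; rewrite g0l eqxx s0.
have -> : [set g in [set g in A | branch x g == lambda] | sin (x axis0 + freq R g axis0) < 0]
    = finset.set0.
  apply/setP => g; rewrite !inE; apply/negP => /andP[/andP[gA /eqP gl]].
  by rewrite (mainS g) ?inE// ltNge ltW.
by rewrite cards1 cards0.
Qed.

End LevelOverlap.

Section PlaneZeroLevel.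
Variable R : realType.
Local Notation Z := 'rV[int]_2.
Variables (m : nat) (G : set Z).
Local Notation M := (m.+1).
Local Notation J := {ffun 'I_2 -> 'I_m.+1}.
Local Notation A := (dual_freqs R m G).
Local Notation g0 := ([ffun=> ord0] : J).
Implicit Types (g : J).
Hypothesis noneven : forall g, g \in A -> ~ forall i, freq R g i = pi.

(** An odd multiple of [pi / (2 M)] is not a multiple of [pi]. *)
Lemma sin_odd_neq0 (K : int) : ~~ (2 %| K)%Z -> sin (pi * K%:~R / (2 * M%:R) : R) != 0.
Proof.
move=> Kodd; apply: contra Kodd => /eqP s0.
set u := pi * K%:~R / (2 * M%:R) : R in s0.
have M0 : M%:R != 0 :> R by rewrite pnatr_eq0.
have z1 : expi (u + u) = 1.
  by rewrite /expi cosD sinD s0 !(mulr0, mul0r) addr0 subr0 -expr2 cos2sin2 s0 expr0n subr0.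
have dM : ((m.*2.+1).+1%:R : R) = 2 * M%:R by rewrite -natrM; congr _%:R; lia.
have := geometric_sum_expi R (m.*2.+1) K.
have -> : \sum_(j < (m.*2.+1).+1) expi (2 * pi * (j : nat)%:R / (m.*2.+1).+1%:R * K%:~R : R) =
    (m.*2.+1).+1%:R.
  rewrite -[X in _ = X%:R](card_ord (m.*2.+1).+1) -sumr_const; apply: eq_bigr => j _.
  rewrite [X in expi X](_ : _ = (u + u) *+ j); last first.
    by rewrite -mulr_natr dM /u; field.
  by rewrite expiMn z1 expr1n.
case: ifP => [/dvdzP[t ->] _|_ /eqP]; last by rewrite pnatr_eq0.
by apply/dvdzP; exists (t * M%:Z); rewrite -mulrA; congr (_ * _); lia.
Qed.

(** For [d = 2] the level set of 0 contains the line [x_0 + x_1 = pi], on which other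
    branches may vanish identically. The points [(tau, pi - tau)] and
    [(-tau, pi + tau)] lie on either side of the saddle point [(0, pi)]; the
    branches at the level 0 are the same at both, and only [g0] changes its
    direction from one to the other. Hence the numbers of rising and falling
    branches cannot agree on both sides. *)
Lemma overlap_level_plane : overlap_at m G (0 : R) 0.
Proof.
pose i1 : 'I_2 := lift ord0 ord0.
(* A quarter of the spacing of the frequencies keeps the sines below away from
   their zeros. *)
pose tau : R := pi / (2 * M%:R).
have M0 : 0 < M%:R :> R by rewrite ltr0n.
have p0 := pi_gt0 R.
pose x (s : R) (i : 'I_2) := if i == ord0 then s * tau else pi - s * tau.
pose a g : nat := g ord0.
pose S0 := [set g in A | sin ((freq R g ord0 + freq R g i1) / 2) == 0].
have branchE s g : branch (x s) g = - 4 *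
    sin (s * tau + (freq R g ord0 - freq R g i1) / 2) * sin ((freq R g ord0 + freq R g i1) / 2).
  rewrite /branch /dispersion big_ord_recl big_ord1 /x /= -/i1.
  set u := s * tau + _ / 2; set v := (_ + _) / 2.
  have -> : s * tau + freq R g ord0 = u + v by rewrite /u /v; field.
  have -> : pi - s * tau + freq R g i1 = - (u - v) + pi by rewrite /u /v; field.
  by rewrite cosDpi cosN cosD cosB; ring.
have sgn (b : bool) : ((-1) ^+ b : R) = (if b then -1 else 1) by case: b; rewrite ?expr1 ?expr0.
have first_neq0 (b : bool) g :
    sin ((-1) ^+ b * tau + (freq R g ord0 - freq R g i1) / 2) != 0.
  have -> : (-1) ^+ b * tau + (freq R g ord0 - freq R g i1) / 2 =
      pi * ((if b then -1 else 1) + 2 * ((g ord0)%:Z - (g i1)%:Z))%:~R / (2 * M%:R).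
    rewrite sgn /tau /freq; case: b; rewrite rmorphD rmorphM rmorphB ?rmorphN /= -!pmulrn;
    by field; rewrite gt_eqF.
  by apply: sin_odd_neq0; case: b; lia.
have second_neq0 (b : bool) g : sin ((-1) ^+ b * tau + freq R g ord0) != 0.
  have -> : (-1) ^+ b * tau + freq R g ord0 =
      pi * ((if b then -1 else 1) + 4 * (g ord0)%:Z)%:~R / (2 * M%:R).
    rewrite sgn /tau /freq; case: b; rewrite rmorphD rmorphM ?rmorphN /= -!pmulrn;
    by field; rewrite gt_eqF.
  by apply: sin_odd_neq0; case: b; lia.
have SE (b : bool) : [set g in A | branch (x ((-1) ^+ b)) g == 0] = S0.
  apply/setP => g; rewrite !inE; congr (_ && _).
  by rewrite branchE !mulf_eq0 oppr_eq0 pnatr_eq0/= (negbTE (first_neq0 b g)).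
have argE (b : bool) g : (-1) ^+ b * tau + freq R g ord0 =
    pi * ((4 * (a g)%:R + (-1) ^+ b) / (2 * M%:R)).
  by rewrite /tau /freq /a; field; rewrite gt_eqF.
have a0 g : g \in S0 -> a g = 0%N -> g = g0.
  rewrite inE => /andP[gA /eqP s0] ag.
  have f0 : freq R g ord0 = 0 by rewrite /freq -/(a g) ag mulr0 mul0r.
  apply: (@freq_eq0 R) => i; have [->//|i0] := eqVneq i ord0.
  have -> : i = i1 by apply/val_inj; case: i i0 => [[|[|k]]] //.
  have /andP[h1 h2] := freq_itv R g i1.
  apply/eqP; apply: contraT => fn0; move: s0; rewrite f0 add0r => /eqP.
  have f1 : 0 < freq R g i1 by rewrite lt_neqAle eq_sym fn0.
  by rewrite gt_eqF//; apply: sin_gt0_pi; apply/andP; split; lra.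
have aM g : g \in S0 -> (2 * a g)%N != M.
  rewrite inE => /andP[gA /eqP s0]; apply/eqP => ag.
  have f0 : freq R g ord0 = pi.
    by rewrite /freq -/(a g) -ag natrM; field; rewrite pnatr_eq0; move: ag; rewrite /a; lia.
  apply: (noneven gA) => i; have [->//|i0] := eqVneq i ord0.
  have -> : i = i1 by apply/val_inj; case: i i0 => [[|[|k]]] //.
  apply: cos_freqN1; move: s0; rewrite f0 mulrDl addrC sinDpihalf => c0.
  by rewrite -[freq R g i1](mulfVK (_ : 2 != 0)) ?pnatr_eq0// mulr_natr cos_mulr2n c0 expr0n mul0rn sub0r.
have a_lt g : (a g < M)%N by exact: ltn_ord.
have bsgn (b : bool) : -1 <= ((-1) ^+ b : R) <= 1 by rewrite sgn; case: b; lra.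
have sin_pos (b : bool) g : (0 < a g)%N -> (2 * a g < M)%N ->
    0 < sin ((-1) ^+ b * tau + freq R g ord0).
  move=> ag0 agM; rewrite argE; have /andP[b1 b2] := bsgn b.
  have A1 : 1 <= (a g)%:R :> R by rewrite ler1n.
  have A2 : 2 * (a g)%:R + 1 <= M%:R :> R by rewrite -natrM natr1 ler_nat.
  apply: sin_gt0_pi; rewrite mulr_gt0 ?divr_gt0 ?mulr_gt0//=; last lra.
  by rewrite gtr_pMr// ltr_pdivrMr ?mulr_gt0//; lra.
have sin_neg (b : bool) g : (M < 2 * a g)%N ->
    sin ((-1) ^+ b * tau + freq R g ord0) < 0.
  move=> agM; have /andP[b1 b2] := bsgn b.
  have A1 : (a g)%:R + 1 <= M%:R :> R by rewrite natr1 ler_nat.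
  have A2 : M%:R + 1 <= 2 * (a g)%:R :> R by rewrite natr1 -natrM ler_nat.
  rewrite -[X in sin X](subrK pi) sinDpi oppr_lt0.
  have -> : (-1) ^+ b * tau + freq R g ord0 - pi =
     pi * ((4 * (a g)%:R + (-1) ^+ b - 2 * M%:R) / (2 * M%:R)).
    by rewrite argE; field; rewrite gt_eqF.
  apply: sin_gt0_pi; rewrite mulr_gt0 ?divr_gt0 ?mulr_gt0//=; last lra.
  by rewrite gtr_pMr// ltr_pdivrMr ?mulr_gt0//; lra.
have sin_g0 (b : bool) : 0 < (-1) ^+ b * sin ((-1) ^+ b * tau + freq R g0 ord0).
  have st : 0 < sin tau.
    apply: sin_gt0_pi; rewrite divr_gt0 ?mulr_gt0//= /tau ltr_pdivrMr ?mulr_gt0//.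
    have : 1 <= M%:R :> R by rewrite ler1n.
    by nra.
  by rewrite freq0 addr0 sgn; case: b; rewrite ?mul1r// !mulN1r sinN opprK.
have g0S : g0 \in S0.
  by rewrite inE g0_in_A !freq0 addr0 mul0r sin0 eqxx.
clearbody S0.
pose P := [set g in S0 | (0 < a g)%N && (2 * a g < M)%N].
pose Q := [set g in S0 | (M < 2 * a g)%N].
have cases g : g \in S0 -> [\/ g = g0, (0 < a g)%N && (2 * a g < M)%N | (M < 2 * a g)%N].
  move=> gS; have := aM g gS; have [ag|ag] := posnP (a g).
    by constructor 1; exact: a0.
  by case: ltngtP => // h _; [constructor 2|constructor 3].
have ag0 : a g0 = 0%N by rewrite /a ffunE.
have over (b : bool) : #|[set g in S0 | 0 < sin ((-1) ^+ b * tau + freq R g ord0)]| !=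
    #|[set g in S0 | sin ((-1) ^+ b * tau + freq R g ord0) < 0]| -> overlap_at m G (0 : R) 0.
  move=> h; apply: (local_overlap (x := x ((-1) ^+ b)) (k := ord0)); rewrite SE.
    by move=> g _; rewrite /x eqxx; exact: second_neq0.
  by rewrite /x eqxx.
have s0T : 0 < sin ((-1) ^+ false * tau + freq R g0 ord0) by have := sin_g0 false; rewrite expr0 !mul1r.
have s0F : sin ((-1) ^+ true * tau + freq R g0 ord0) < 0.
  by have := sin_g0 true; rewrite expr1 !mulN1r oppr_gt0.
have E1 : [set g in S0 | 0 < sin ((-1) ^+ false * tau + freq R g ord0)] = g0 |: P.
  apply/setP => g; rewrite !inE.
  have [gS|gS] /= := boolP (g \in S0); last by rewrite orbF; apply/esym/eqP => E; rewrite E g0S in gS.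
  case: (cases g gS) => [->|h|h].
  - by rewrite eqxx s0T.
  - by rewrite h orbT; case/andP: h => *; exact: (sin_pos false).
  - rewrite ltNge (ltW (sin_neg false g h))/=; apply/esym/negP => /orP[/eqP E|/andP[_ h']].
      by move: h; rewrite E ag0.
    by move: h h'; lia.
have E2 : [set g in S0 | sin ((-1) ^+ false * tau + freq R g ord0) < 0] = Q.
  apply/setP => g; rewrite !inE.
  have [gS|gS] //= := boolP (g \in S0).
  case: (cases g gS) => [->|h|h].
  - by rewrite ag0 ltNge (ltW s0T).
  - have /andP[h1 h2] := h; rewrite ltNge (ltW (sin_pos false g h1 h2))/=.
    by apply/esym/negP; lia.
  - by rewrite h; exact: (sin_neg false).
have E3 : [set g in S0 | 0 < sin ((-1) ^+ true * tau + freq R g ord0)] = P.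
  apply/setP => g; rewrite !inE.
  have [gS|gS] //= := boolP (g \in S0).
  case: (cases g gS) => [->|h|h].
  - by rewrite ag0 ltNge (ltW s0F).
  - by rewrite h; case/andP: h => *; exact: (sin_pos true).
  - rewrite ltNge (ltW (sin_neg true g h))/=; apply/esym/negP; lia.
have E4 : [set g in S0 | sin ((-1) ^+ true * tau + freq R g ord0) < 0] = g0 |: Q.
  apply/setP => g; rewrite !inE.
  have [gS|gS] /= := boolP (g \in S0); last by rewrite orbF; apply/esym/eqP => E; rewrite E g0S in gS.
  case: (cases g gS) => [->|h|h].
  - by rewrite eqxx s0F.
  - have /andP[h1 h2] := h; rewrite ltNge (ltW (sin_pos true g h1 h2))/=.
    apply/esym/negP => /orP[/eqP E|]; last by lia.
    by move: h1; rewrite E ag0.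
  - by rewrite h orbT; exact: (sin_neg true).
have g0P : g0 \notin P by rewrite inE g0S ag0.
have g0Q : g0 \notin Q by rewrite inE g0S ag0 muln0.
have := over false; have := over true; rewrite E1 E2 E3 E4 !cardsU1 g0P g0Q.
case: (#|Q| =P (1 + #|P|)%N) => [-> h _|/eqP ne _ h].
  by apply: h; apply/eqP; clear; lia.
by apply: h; rewrite eq_sym.
Qed.

End PlaneZeroLevel.

(** * The spectrum for small potentials *)

Section SmallPotentials.
Variables (R : realType) (d : nat).
Local Notation C := R[i].
Local Notation Z := 'rV[int]_d.
Variables (m : nat) (G : set Z).
Local Notation M := (m.+1).
Local Notation J := {ffun 'I_d -> 'I_m.+1}.
Local Notation A := (dual_freqs R m G).
Local Notation N := #|A|.
Local Open Scope complex_scope.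
Implicit Types (x : 'I_d -> R) (g : J).
Hypothesis d_ge2 : (2 <= d)%N.
Hypothesis noneven : forall g, g \in A -> ~ forall i, freq R g i = pi.

Lemma overlap_level (lambda : R) : `|lambda| < 2 * d%:R -> overlap_at m G lambda 0.
Proof.
move=> lam; have [[d2 l0]|h] := pselect (d = 2%N /\ lambda = 0); last first.
  by apply: (overlap_level_generic d_ge2 noneven lam) => d2 l0; apply: h.
by subst d lambda; exact: overlap_level_plane.
Qed.

Lemma overlap_shift (lambda e c e' : R) : `|c - lambda| <= e - e' ->
  overlap_at m G lambda e -> overlap_at m G c e'.
Proof.
rewrite ler_norml => /andP[h1 h2] [x0 [x1 lt]]; exists x0, x1; apply: leq_trans lt _.
apply: leq_add; apply: subset_leq_card; apply/fintype.subsetP => g;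
  rewrite !inE => /andP[-> /=]; lra.
Qed.

Lemma overlap_slack (lambda : R) : overlap_at m G lambda 0 ->
  exists2 e, 0 < e & overlap_at m G lambda e.
Proof.
move=> [x0 [x1 lt]].
pose a0 g := if branch x0 g > lambda then branch x0 g - lambda else 1.
pose a1 g := if branch x1 g < lambda then lambda - branch x1 g else 1.
have [e0 e00 h0] : exists2 e, 0 < e & forall g, e <= a0 g.
  apply: finite_pos_lower_bound => g; rewrite /a0.
  by case: ifP => //; rewrite subr_gt0.
have [e1 e10 h1] : exists2 e, 0 < e & forall g, e <= a1 g.
  apply: finite_pos_lower_bound => g; rewrite /a1.
  by case: ifP => //; rewrite subr_gt0.
exists (Num.min e0 e1 / 2); first by rewrite divr_gt0// lt_min e00.
have m0 : Num.min e0 e1 <= e0 by rewrite ge_min lexx.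
have m1 : Num.min e0 e1 <= e1 by rewrite ge_min lexx orbT.
exists x0, x1; apply: leq_trans lt _.
apply: leq_add; apply: subset_leq_card; apply/fintype.subsetP => g;
  rewrite !inE => /andP[-> /=]; rewrite ?addr0 ?subr0 => bl.
- by have := h0 g; rewrite /a0 bl; move: (Num.min _ _) m0 => u; lra.
- by have := h1 g; rewrite /a1 bl; move: (Num.min _ _) m1 => u; lra.
Qed.

(** The margin is locally uniform in the level, so compactness makes it uniform
    away from the edges [2 d] and [- 2 d]. *)
Lemma overlap_uniform (r : R) : r < 2 * d%:R ->
  exists2 e, 0 < e & forall c, `|c| <= r -> overlap_at m G c e.
Proof.
move=> rd.
have cov : (\forall e \near (0:R)^'+, `[- r, r] `<=` [set c | overlap_at m G c e])%classic.
  move/compact_near_coveringP : (@segment_compact R (- r) r); apply.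
  move=> l /=; rewrite in_itv/= => lr.
  have [|e e0 ov] := overlap_slack (overlap_level (lambda := l) _).
    by apply: le_lt_trans rd; rewrite ler_norml.
  near=> c e' => /=.
  apply: overlap_shift ov.
  have h1 : `|l - c| < e / 2.
    by near: c; apply: cvgr_dist_lt; [exact: cvg_id|rewrite divr_gt0].
  have h2 : e' < e / 2 by near: e'; apply: nbhs_right_lt; rewrite divr_gt0.
  by rewrite distrC; lra.
have [e [e0 he]] : exists e : R, 0 < e /\ (`[- r, r] `<=` [set c | overlap_at m G c e])%classic.
  apply: (@filter_ex _ (0^'+)%classic); near=> e; split; last by near: e.
  by near: e; exact: nbhs_right_gt.
exists e => // c cr; apply: he => /=; by rewrite in_itv/= -ler_norml.
Unshelve. all: by end_near.
Qed.

(** No branch is at an edge of the spectrum at this quasi-momentum. *)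
Lemma edge_free_quasimomentum : exists x, exists2 e, 0 < e &
  forall g, `|branch x g| <= 2 * d%:R - e.
Proof.
pose x (i : 'I_d) : R := pi / (2 * M%:R).
have M0 : 0 < M%:R :> R by rewrite ltr0n.
have bx g : 0 < 2 * d%:R - `|branch x g|.
  rewrite subr_gt0 /branch /dispersion normrM ger0_norm// ltr_pM2l//.
  apply: le_lt_trans (ler_norm_sum _ _ _) _.
  have -> : d%:R = \sum_(i < d) (1 : R) by rewrite sumr_const card_ord.
  have clt i : `|cos (x i + freq R g i)| < 1.
    rewrite lt_neqAle cos_max andbT norm_cos_eq1.
    have -> : x i + freq R g i = pi * (1 + 4 * (g i)%:Z)%:~R / (2 * M%:R).
      by rewrite rmorphD rmorphM /= -!pmulrn /x /freq; field; rewrite gt_eqF.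
    by apply: sin_odd_neq0; lia.
  apply: ltr_sum => //; apply/hasP; exists (axis0 d_ge2) => //; exact: mem_index_enum.
have [e e0 he] := finite_pos_lower_bound bx.
by exists x, e => // g; have := he g; lra.
Qed.

Lemma card_branches (Q : pred J) :
  #|[set i : 'I_N | Q (enum_val i)]| = #|[set g in A | Q g]|.
Proof.
rewrite -(card_imset _ (@enum_val_inj _ (mem A))); apply: eq_card => g.
apply/imsetP/idP => [[i + ->]|]; rewrite !inE.
  by move=> Qi; rewrite Qi andbT; have := enum_valP i; rewrite inE.
move=> /andP[gA Qg]; have gA' : g \in A by rewrite inE.
by exists (enum_rank_in gA' g); rewrite ?inE enum_rankK_in.
Qed.

Hypothesis GM : forall k : Z, G (k *+ m.+1).

Section FixedPotential.
Variables (V : Z -> R) (e : R).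
Hypothesis VG : lattice_periodic G V.
Hypothesis Ve : forall n, `|V n| <= e.
Local Notation H := (schrodinger V).

Lemma overlap_spectrum c : overlap_at m G c e -> spectrum H c%:C.
Proof.
move=> [x0 [x1 lt]].
refine (band_crossing GM VG (floquet_positive m G Ve x0 c) (floquet_negative m G Ve x1 c) _).
have := card_branches (fun g => branch x0 g > c + e).
have := card_branches (fun g => branch x1 g < c - e).
by move=> /= E1 E2; rewrite E1 E2.
Qed.

Lemma form_real x c (v : 'rV[C]_N) : exists r : R, mxform (floquet_mx m G V x c) v = r%:C.
Proof. by rewrite mxform_floquet//; eexists. Qed.

(** All branches are below [c] at [x], while a point [b > c] of the spectrum yields a
    Bloch component of energy above [c] at some other quasi-momentum. *)
Lemma spectrum_upper_edge x b c : (forall g, branch x g < c - e) -> spectrum H b%:C ->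
  c < b -> spectrum H c%:C.
Proof.
move=> xc sb cb; have [f ff pos] := spectrum_above Ve sb cb.
have [k [y [v [w [w0 avg]]]]] := floquet_average GM VG c ff.
have [q vq] : exists q, 0 < mxform (floquet_mx m G V (y q) c) (v q).
  apply: contrapT => none.
  have le0 q : mxform (floquet_mx m G V (y q) c) (v q) <= 0.
    have [r rE] := form_real (y q) c (v q); rewrite rE lecR leNgt; apply/negP => r0.
    by apply: none; exists q; rewrite rE ltcR.
  have : \sum_q mxform (floquet_mx m G V (y q) c) (v q) <= 0 by apply: sumr_le0.
  by rewrite avg lecR leNgt mulr_gt0// subr_gt0.
refine (band_crossing GM VG (positive_vector vq) (floquet_negative m G Ve x c) _).
have := card_branches (fun g => branch x g < c - e) => /= ->.
rewrite add1n ltnS; apply: subset_leq_card; apply/fintype.subsetP => g gA.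
by move: gA; rewrite !inE => ->; rewrite xc.
Qed.

Lemma spectrum_lower_edge x a c : (forall g, c + e < branch x g) -> spectrum H a%:C ->
  a < c -> spectrum H c%:C.
Proof.
move=> xc sa ac; have [f ff neg] := spectrum_below Ve sa ac.
have [k [y [v [w [w0 avg]]]]] := floquet_average GM VG c ff.
have [q vq] : exists q, 0 < mxform (- floquet_mx m G V (y q) c) (v q).
  apply: contrapT => none.
  have ge0 q : 0 <= mxform (floquet_mx m G V (y q) c) (v q).
    have [r rE] := form_real (y q) c (v q); rewrite rE lecR leNgt; apply/negP => r0.
    by apply: none; exists q; rewrite mxformN rE oppr_gt0 ltcR.
  have : 0 <= \sum_q mxform (floquet_mx m G V (y q) c) (v q) by apply: sumr_ge0.
  by rewrite avg lecR leNgt pmulr_rlt0// subr_lt0 neg.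
refine (band_crossing GM VG (floquet_positive m G Ve x c) (positive_vector vq) _).
have := card_branches (fun g => c + e < branch x g) => /= ->.
rewrite addn1 ltnS; apply: subset_leq_card; apply/fintype.subsetP => g gA.
by move: gA; rewrite !inE => ->; rewrite xc.
Qed.

End FixedPotential.

Lemma spectrum_interval : exists e : R, 0 < e /\ forall V : Z -> R,
  lattice_periodic G V -> (forall n, `|V n| <= e) ->
  complex_interval (spectrum (schrodinger V)).
Proof.
have [x [dl dl0 xd]] := edge_free_quasimomentum.
have dl2 : dl <= 2 * d%:R.
  by rewrite -subr_ge0; apply: le_trans (xd [ffun=> ord0]).
have [|e1 e10 ov] := @overlap_uniform (2 * d%:R - dl / 2); first lra.
pose e := Num.min e1 (dl / 4).
have e0 : 0 < e by rewrite lt_min e10 divr_gt0.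
have ee1 : e <= e1 by rewrite ge_min lexx.
have edl : e <= dl / 4 by rewrite ge_min lexx orbT.
exists e; split=> // V VG Ve.
have mid c : `|c| <= 2 * d%:R - dl / 2 -> spectrum (schrodinger V) c%:C.
  move=> /ov ovc; apply: (overlap_spectrum VG Ve); apply: overlap_shift ovc.
  by rewrite subrr normr0 subr_ge0.
exists [set t | spectrum (schrodinger V) t%:C]%classic; split.
- move=> a b sa sb c /andP[ac cb].
  have [<-//|/eqP can] := eqVneq a c; have [->//|/eqP cbn] := eqVneq c b.
  have {}ac : a < c by rewrite lt_neqAle ac andbT; apply/eqP.
  have {}cb : c < b by rewrite lt_neqAle cb andbT; apply/eqP.
  have [/mid//|big] := leP `|c| (2 * d%:R - dl / 2).
  have [c0|c0] := leP 0 c.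
    rewrite ger0_norm// in big; apply: (spectrum_upper_edge (x := x) VG Ve _ sb cb) => g.
    by have := ler_norm (branch x g); have := xd g; lra.
  rewrite ltr0_norm// in big; apply: (spectrum_lower_edge (x := x) VG Ve _ sa ac) => g.
  by have := ler_norm (- branch x g); rewrite normrN; have := xd g; lra.
- by exists 0; apply: mid; rewrite normr0; lra.
- apply/seteqP; split=> [z sz|_ [t st <-]//].
  have z0 := spectrum_real Ve sz; exists (complex.Re z).
    by move: sz; case: z z0 => u w /= ->.
  by case: z z0 {sz} => u w /= ->.
Qed.

End SmallPotentials.

Theorem theorem1p3 (R : realType) (d : nat) (hd : (2 <= d)%N)
  (G : set 'rV[int]_d)
  (hG : full_rank_lattice R G)
  (hodd : ~ even_lattice R G) :
  exists eps : R, 0 < eps /\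
    forall V : 'rV[int]_d -> R,
      lattice_periodic G V -> (sup_norm V < eps%:E)%E ->
      complex_interval (spectrum (schrodinger V)).
Proof.
have [m GM] := lattice_multiple hG.
have noneven g : g \in dual_freqs R m G -> ~ forall i, freq R g i = pi.
  rewrite inE => /asboolP gdual gpi; apply: hodd => a Ga.
  rewrite -[RHS](gdual a Ga) /plane_wave; congr expi.
  rewrite /inner /dot mulr_sumr; apply: eq_bigr => i _.
  by rewrite !mxE gpi; field.
have [e [e0 he]] := spectrum_interval hd noneven GM.
exists e; split=> // V VG Ve; apply: he => // n.
rewrite -lee_fin; apply: le_trans (ltW Ve); apply: ereal_sup_ubound.
by exists n.
Qed.
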